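(* Let $u_0\in L^2(\Omega)$ and $f\in L^2(0,T;H^{-1}(\Omega))$. Then the weak solution of problem (P) is unique (problem (P) and the notion of weak solution are given in the context).
   Context: Setting. $\Omega\subset\mathbb{R}^d$, $d\ge 1$, is a bounded simply connected convex domain with Lipschitz boundary; $T>0$; $M$ is a positive integer; $\nu>0$, $\alpha>0$, $\beta_\ell\in\mathbb{R}$ $(1\le \ell\le M)$; $2\le p<\infty$ and $2\le q_\ell<p$ for $1\le\ell\le M$; $p'=p/(p-1)$. $H_0^1(\Omega)$ is normed by $\|\nabla u\|_{L^2}$ and $H^{-1}(\Omega)$ is its dual. Problem (P): $\partial_t u-\nu\Delta u+\alpha|u|^{p-2}u-\sum_{\ell=1}^M\beta_\ell|u|^{q_\ell-2}u=f$ in $\Omega\times(0,T)$, $u=0$ on $\partial\Omega\times[0,T]$, $u(\cdot,0)=u_0$ in $\Omega$. Weak solution. A function $u\in L^\infty(0,T;L^2(\Omega))\cap L^2(0,T;H_0^1(\Omega))\cap L^p(0,T;L^p(\Omega))$ with $\partial_tu\in L^2(0,T;H^{-1}(\Omega))+L^{p'}(0,T;L^{p'}(\Omega))$ is a weak solution of (P) if, for all $v\in H_0^1(\Omega)\cap L^p(\Omega)$ and a.e. $t\in[0,T]$, $\langle\partial_tu,v\rangle+\nu(\nabla u,\nabla v)+\alpha\langle|u|^{p-2}u,v\rangle-\sum_{\ell=1}^M\beta_\ell\langle|u|^{q_\ell-2}u,v\rangle=\langle f,v\rangle$, and $(u(0),v)=(u_0,v)$ (such a $u$ has a representative that is weakly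 continuous in time with values in $H^{-1}(\Omega)+L^{p'}(\Omega)$, so $u(0)$ makes sense). *)

(* Defs.v *)
From HB Require Import structures.
From mathcomp Require Import all_boot all_order all_algebra.
From mathcomp Require Import all_classical all_reals all_analysis.

Set Implicit Arguments.
Unset Strict Implicit.
Unset Printing Implicit Defensive.

Import Order.TTheory GRing.Theory Num.Theory.
Import numFieldNormedType.Exports.

Local Open Scope classical_set_scope.
Local Open Scope ring_scope.

(* R^n is 'rV[R]_n with the sigma-algebra generated by the coordinates; its
   Lebesgue measure is the n-fold product of lebesgue_measure, transported along
   cons_rV : R * R^n -> R^(n+1). *)

Definition rV_display : measure_display.
Proof. exact: default_measure_display. Qed.

Section rV_measurable.
Variables (R : realType) (n : nat).

Let coord (i : 'I_n) (x : 'rV[R]_n) : measurableTypeR R := x ord0 i.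

Let rV_set0 : g_sigma_preimage coord set0.
Proof. exact: sigma_algebra0. Qed.

Let rV_setC A : g_sigma_preimage coord A -> g_sigma_preimage coord (~` A).
Proof. exact: sigma_algebraC. Qed.

Let rV_bigcup (F : (set 'rV[R]_n)^nat) :
  (forall i, g_sigma_preimage coord (F i)) ->
  g_sigma_preimage coord (\bigcup_i (F i)).
Proof. exact: sigma_algebra_bigcup. Qed.

HB.instance Definition _ := @isMeasurable.Build rV_display 'rV[R]_n
  (g_sigma_preimage coord) rV_set0 rV_setC rV_bigcup.

Lemma measurable_coord (i : 'I_n) :
  measurable_fun [set: 'rV[R]_n] (fun x : 'rV[R]_n => (x ord0 i : R)).
Proof.
move=> _ Y mY; rewrite setTI; apply: sub_sigma_algebra => /=.
rewrite -bigcup_seq/=; exists i => /=; first by rewrite mem_index_enum.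
by exists Y => //; rewrite setTI.
Qed.

Lemma measurable_fun_rV d (T : measurableType d) (f : T -> 'rV[R]_n) :
  (forall i, measurable_fun [set: T] (fun t => (f t ord0 i : R))) ->
  measurable_fun [set: T] f.
Proof.
move=> mf.
suff H : g_sigma_preimage (fun i => coord i \o f) `<=` measurable.
  move=> _ Y mY; rewrite setTI.
  have := @g_sigma_preimage_comp _ _ _ _ coord _ f.
  move=> E; apply: H; rewrite E; exists Y => //.
  by rewrite setTI.
apply: smallest_sub; first exact: sigma_algebra_measurable.
rewrite -bigcup_seq => A [i /= _] [B mB <-].
exact: mf.
Qed.

End rV_measurable.

Definition cons_rV (R : realType) (n : nat) (xy : R * 'rV[R]_n) :
    'rV[R]_n.+1 :=
  \row_(i < n.+1) oapp (fun j => xy.2 ord0 j) xy.1 (unlift ord0 i).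

Lemma measurable_cons_rV (R : realType) (n : nat) :
  measurable_fun [set: measurableTypeR R * 'rV[R]_n] (@cons_rV R n).
Proof.
apply: measurable_fun_rV => i; under eq_fun do rewrite mxE.
case: (unliftP ord0 i) => [j _|_] /=.
  exact: (measurableT_comp (measurable_coord j) measurable_snd).
exact: measurable_fst.
Qed.


Definition uncons_rV (R : realType) (n : nat) (x : 'rV[R]_n.+1) :
    R * 'rV[R]_n :=
  (x ord0 ord0, \row_(j < n) x ord0 (lift ord0 j)).

Lemma cons_rVK (R : realType) (n : nat) :
  cancel (@cons_rV R n) (@uncons_rV R n).
Proof.
move=> [a y]; rewrite /uncons_rV /cons_rV mxE unlift_none/=; congr pair.
by apply/rowP => j; rewrite !mxE liftK.
Qed.

Lemma measurable_uncons_rV (R : realType) (n : nat) :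
  measurable_fun setT
    (@uncons_rV R n : 'rV[R]_n.+1 -> measurableTypeR R * 'rV[R]_n).
Proof.
apply/measurable_fun_pairP; split; first exact: (measurable_coord ord0).
apply: measurable_fun_rV => j; under eq_fun do rewrite /= mxE.
exact: measurable_coord.
Qed.

Section cons_measure.
Context (R : realType) (n : nat).
Variable m : {sigma_finite_measure set 'rV[R]_n -> \bar R}.

Definition cons_measure : set 'rV[R]_n.+1 -> \bar R :=
  pushforward (@lebesgue_measure R \x m)%E (@cons_rV R n).

HB.instance Definition _ := Measure.copy cons_measure
  (measure_function_pushforward__canonical__measure_function_Measure
    (@lebesgue_measure R \x m)%E (@measurable_cons_rV R n)).

Let cons_measure_sigma_finite : sigma_finite setT cons_measure.
Proof.
have /sigma_finiteP[F [TF ndF Foo]] := sigma_finiteT (@lebesgue_measure R).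
have /sigma_finiteP[G [TG ndG Goo]] := sigma_finiteT m.
exists (fun k => @uncons_rV R n @^-1` (F k `*` G k)).
  rewrite -preimage_bigcup; apply/esym/seteqP; split => // x _ /=.
  have [a _ Fa] : (\bigcup_k F k) (uncons_rV x).1 by rewrite -TF.
  have [b _ Gb] : (\bigcup_k G k) (uncons_rV x).2 by rewrite -TG.
  exists (maxn a b) => //; split.
  - by move: Fa; exact/subsetPset/ndF/leq_maxl.
  - by move: Gb; exact/subsetPset/ndG/leq_maxr.
move=> k; have [mF Fk] := Foo k; have [mG Gk] := Goo k; split.
  rewrite -[X in measurable X]setTI; apply: measurable_uncons_rV => //.
  exact: measurableX.
rewrite /cons_measure /pushforward -comp_preimage.
rewrite (_ : _ \o _ = id) ?preimage_id; last exact/funext/cons_rVK.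
by rewrite product_measure1E// lte_mul_pinfty// ge0_fin_numE.
Qed.

HB.instance Definition _ :=
  Measure_isSigmaFinite.Build _ _ _ cons_measure cons_measure_sigma_finite.

End cons_measure.

Fixpoint lebesgue_rV (R : realType) (n : nat) :
    {sigma_finite_measure set 'rV[R]_n -> \bar R} :=
  match n with
  | 0 => \d_(0 : 'rV[R]_0)
  | k.+1 => cons_measure (lebesgue_rV R k)
  end.

Lemma lebesgue_rV_box (R : realType) (n : nat) (A : 'I_n -> set R) :
  (forall i, measurable (A i)) ->
  lebesgue_rV R n [set x : 'rV[R]_n | forall i, A i (x ord0 i)] =
  (\prod_(i < n) lebesgue_measure (A i))%E.
Proof.
elim: n A => [|n IH] A mA.
  by rewrite big_ord0 /= diracE mem_set// => -[].
rewrite big_ord_recl -IH//.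
pose B := [set x : 'rV[R]_n | forall i, A (lift ord0 i) (x ord0 i)].
rewrite -/B.
have mB : measurable B.
  rewrite (_ : B = \bigcap_(i : 'I_n)
    [set x : 'rV[R]_n | A (lift ord0 i) (x ord0 i)]); last first.
    by apply/seteqP; split => x /= H i // *; exact: H.
  apply: fin_bigcap_measurable => // i _.
  by rewrite -[X in measurable X]setTI; exact: measurable_coord.
rewrite /= /cons_measure /pushforward -product_measure1E//; last exact: mA.
congr (_ _); apply/seteqP; split => -[a y] /= H.
  split; first by have := H ord0; rewrite mxE unlift_none.
  by move=> i; have := H (lift ord0 i); rewrite mxE liftK.
move=> i; rewrite mxE; case: (unliftP ord0 i) => [j|] -> /=.
  exact: H.2.
exact: H.1.
Qed.

Section domains.
Variables (R : realType) (d : nat).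
Implicit Type A : set 'rV[R]_d.

Definition domain A := [/\ open A, A !=set0 & connected A].

Definition path_in A (g : R -> 'rV[R]_d) :=
  {within `[0, 1], continuous g} /\ (forall s, s \in `[0, 1] -> A (g s)).

Definition path_connected A :=
  forall x y, A x -> A y -> exists g, [/\ path_in A g, g 0 = x & g 1 = y].

Definition null_homotopic A (g : R -> 'rV[R]_d) :=
  exists H : R * R -> 'rV[R]_d,
    [/\ {within `[0, 1]%classic `*` `[0, 1]%classic, continuous H},
        (forall st, (`[0, 1]%classic `*` `[0, 1]%classic) st -> A (H st)),
        (forall s, s \in `[0, 1] -> H (s, 0) = g s),
        (forall s, s \in `[0, 1] -> H (s, 1) = g 0)
      & (forall t, t \in `[0, 1] -> H (0, t) = g 0 /\ H (1, t) = g 0)].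

Definition simply_connected A :=
  path_connected A /\
  forall g, path_in A g -> g 0 = g 1 -> null_homotopic A g.

Definition dot_rV (x y : 'rV[R]_d) : R := \sum_(i < d) x ord0 i * y ord0 i.

(* Near each boundary point, A is the part of space lying above the graph of a
   Lipschitz function h over the hyperplane orthogonal to a unit vector e. *)
Definition lipschitz_boundary A :=
  forall x, (closure A `\` interior A) x ->
  exists (e : 'rV[R]_d) (h : 'rV[R]_d -> R) (r L : R),
    [/\ dot_rV e e = 1, 0 < r,
        (forall y z, `|h y - h z| <= L * `|y - z|)
      & forall y, ball x r y ->
          (A y <-> h (y - dot_rV y e *: e) < dot_rV y e)].

End domains.

(* Elements of the function spaces on Om are functions on R^d of which only the
   restriction to Om, up to null sets, matters. *)

Section function_spaces.
Variables (R : realType) (d : nat) (Om : set 'rV[R]_d).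
Implicit Types v w phi : 'rV[R]_d -> R.
Local Notation mu := (lebesgue_rV R d).

Definition Lp (p : \bar R) : set ('rV[R]_d -> R) :=
  [set v | (v \_ Om) \in Lfun mu p].

Definition Lp_norm (p : \bar R) v : \bar R :=
  ('N[mu]_p [EFin \o (v \_ Om)])%E.

(* <v, w> for v in L^p' and w in L^p; the L^2 inner product when p = 2 *)
Definition dotL v w : R := \int[mu]_(x in Om) (v x * w x).

Definition partial (i : 'I_d) v : 'rV[R]_d -> R :=
  'D_(delta_mx ord0 i : 'rV[R]_d) v.

Fixpoint Ck (k : nat) v : Prop :=
  match k with
  | 0 => continuous v
  | k'.+1 => [/\ continuous v,
      (forall i x, derivable v x (delta_mx ord0 i : 'rV[R]_d))
    & (forall i, Ck k' (partial i v))]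
  end.

Definition test_fun : set ('rV[R]_d -> R) :=
  [set phi | (forall k, Ck k phi) /\
    exists K : set 'rV[R]_d,
      [/\ compact K, K `<=` Om & forall x, ~ K x -> phi x = 0]].

Definition is_weak_gradient v (G : 'I_d -> 'rV[R]_d -> R) :=
  forall i, Lp 2%:E (G i) /\
    forall phi, test_fun phi -> dotL v (partial i phi) = - dotL (G i) phi.

Definition H1 : set ('rV[R]_d -> R) :=
  [set v | Lp 2%:E v /\ exists G, is_weak_gradient v G].

Definition grad v : 'I_d -> 'rV[R]_d -> R :=
  xget (fun _ _ => 0) [set G | is_weak_gradient v G].

Definition grad_norm v : \bar R :=
  Lp_norm 2%:E (fun x => Num.sqrt (\sum_(i < d) grad v i x ^+ 2)).

Definition dot_grad v w : R := \sum_(i < d) dotL (grad v i) (grad w i).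

Definition H10 : set ('rV[R]_d -> R) :=
  [set v | H1 v /\ forall e : R, 0 < e -> exists phi,
    [/\ test_fun phi, (Lp_norm 2%:E (v - phi)%R < e%:E)%E
      & (grad_norm (v - phi)%R < e%:E)%E]].

(* An element of H^-1 is a function on all of 'rV_d -> R of which only the
   values on H10 matter. *)
Definition Hm1 : set (('rV[R]_d -> R) -> R) :=
  [set g | (forall (a : R) v w, H10 v -> H10 w ->
             g (a *: v + w) = a * g v + g w) /\
    exists C : R, forall v, H10 v -> (`|g v|%:E <= C%:E * grad_norm v)%E].

Definition Hm1_norm (g : ('rV[R]_d -> R) -> R) : \bar R :=
  ereal_sup [set `|g v|%:E | v in [set v | H10 v /\ (grad_norm v <= 1)%E]].

Definition H10_Lp (p : R) : set ('rV[R]_d -> R) := H10 `&` Lp p%:E.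

Definition conj_exp (p : R) : R := p / (p - 1).

(* the dual H^-1 + L^p' of H10_Lp p *)
Definition Hm1_add_Lp (p : R) : set (('rV[R]_d -> R) -> R) :=
  [set l | exists g h, [/\ Hm1 g, Lp (conj_exp p)%:E h
    & forall v, H10_Lp p v -> l v = g v + dotL h v]].

End function_spaces.

(* The Banach space underlying a Bochner space is given as a linear subspace X of
   E and a function N, a seminorm on X, with functions identified when N of their
   difference is 0. Since lebesgue_measure lives on Borel sets, t |-> N (u t) is
   measurable only up to a null set; the integral of a nonnegative function is a
   supremum over simple functions below it, which null sets do not affect. *)

Section bochner.
Variables (R : realType) (T : R) (E : lmodType R).
Implicit Types (X : set E) (N : E -> \bar R) (u : R -> E).

Definition simple_in X u :=
  exists (k : nat) (A : 'I_k -> set R) (x : 'I_k -> E),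
    [/\ (forall i, measurable (A i)), (forall i, X (x i))
      & forall t, u t = \sum_(i < k) (\1_(A i) t : R) *: x i].

Definition strongly_measurable X N u :=
  exists s : nat -> R -> E, (forall n, simple_in X (s n)) /\
    {ae @lebesgue_measure R, forall t, t \in `]0, T[ ->
      N (s n t - u t) @[n --> \oo] --> 0%E}.

Definition bochner (q : \bar R) X N : set (R -> E) :=
  [set u | [/\ {ae @lebesgue_measure R, forall t, t \in `]0, T[ -> X (u t)},
    strongly_measurable X N u
  & ('N[@lebesgue_measure R]_q [((N \o u) \_ `]0%R, T[)] < +oo)%E]].

End bochner.

Section problem.
Variables (R : realType) (d : nat) (Om : set 'rV[R]_d) (T : R).
Local Notation leb := (@lebesgue_measure R).
Implicit Types (p : R) (u : R -> 'rV[R]_d -> R) (v : 'rV[R]_d -> R).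
Implicit Type D : R -> ('rV[R]_d -> R) -> R.

Definition time_test_fun : set (R -> R) :=
  [set phi | (forall k t, derivable (derive1n k phi) t 1) /\
    exists K : set R,
      [/\ compact K, K `<=` `]0, T[ & forall t, ~ K t -> phi t = 0]].

(* D is the distributional derivative of u, as a function with values in the
   dual of H10_Lp p, into which u(t) embeds as v |-> (u(t), v). *)
Definition is_time_derivative p u D :=
  forall v phi, H10_Lp Om p v -> time_test_fun phi ->
    \int[leb]_(t in `]0, T[) (dotL Om (u t) v * derive1 phi t) =
    - \int[leb]_(t in `]0, T[) (D t v * phi t).

(* L^2(0, T; H^-1) + L^p'(0, T; L^p') *)
Definition time_dual p D :=
  exists (g : R -> ('rV[R]_d -> R) -> R) (h : R -> 'rV[R]_d -> R),
    [/\ bochner T 2%:E (Hm1 Om) (Hm1_norm Om) g,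
        bochner T (conj_exp p)%:E (Lp Om (conj_exp p)%:E)
          (Lp_norm Om (conj_exp p)%:E) h
      & {ae leb, forall t, t \in `]0, T[ -> forall v, H10_Lp Om p v ->
          D t v = g t v + dotL Om (h t) v}].

(* (u(0), v) = (u0, v), where u(0) is the value at 0 of the representative U of
   u that is weakly continuous on [0, T] with values in H^-1 + L^p' *)
Definition initial_condition p u (u0 : 'rV[R]_d -> R) :=
  exists U : R -> ('rV[R]_d -> R) -> R,
    [/\ (forall t, t \in `[0, T] -> Hm1_add_Lp Om p (U t)),
        (forall v, H10_Lp Om p v -> {within `[0, T], continuous (U ^~ v)}),
        {ae leb, forall t, t \in `]0, T[ -> forall v, H10_Lp Om p v ->
          U t v = dotL Om (u t) v}
      & forall v, H10_Lp Om p v -> U 0 v = dotL Om u0 v].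

Definition power_nl p v : 'rV[R]_d -> R := fun x => `|v x| `^ (p - 2) * v x.

Definition weak_solution (M : nat) (nu alpha : R) (beta : 'I_M -> R) (p : R)
    (q : 'I_M -> R) (f : R -> ('rV[R]_d -> R) -> R)
    (u0 : 'rV[R]_d -> R) u : Prop :=
  [/\ bochner T +oo%E (Lp Om 2%:E) (Lp_norm Om 2%:E) u,
      bochner T 2%:E (H10 Om) (grad_norm Om) u,
      bochner T p%:E (Lp Om p%:E) (Lp_norm Om p%:E) u
    & exists D, [/\ time_dual p D,
        is_time_derivative p u D,
        (forall v, H10_Lp Om p v -> {ae leb, forall t, t \in `]0, T[ ->
          D t v + nu * dot_grad Om (u t) v
            + alpha * dotL Om (power_nl p (u t)) v
            - \sum_(l < M) beta l * dotL Om (power_nl (q l) (u t)) v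
          = f t v})
      & initial_condition p u u0]].

End problem.

(* Main.v *)
(* The difference z = u - w satisfies (1/2) d/dt |z|^2 <= K |z|^2 in L^2, because
   the gradient term and the p-term are monotone and the p-term absorbs the
   q_l-terms up to a multiple of |z|^2; Gronwall's lemma then gives z = 0.

   Since d/dt z = G + H with G in L^2(H^-1) and H in L^p'(L^p') only, the energy
   inequality replaces the chain rule for |z|^2. From
     |z(t)|^2 - |z(t-h)|^2 <= 2 (z(t) - z(t-h), z(t))
                            = 2 \int_(t-h)^t <(G + H)(r), z(t)> dr
   one approximates G and H by step functions of r, up to an error controlled by
   Young's inequality, divides by h, integrates in t and lets h tend to 0; this
   only needs Lebesgue differentiation of integrable functions of one variable.
   The equation, known for each test function outside a null set depending on
   it, may be tested with z(t) because the values of z are separable. *)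

(* The object to control is the kernel [b r t], the derivative of [z] at time [r] paired with [z t].
   Lebesgue differentiation does not apply directly to its averages over [r] in []t - h, t]],
   because the test vector moves with [t]; this obstacle shapes the proof. After approximation the
   kernel reads [\sum_i c i t * \1_(A i) r], so only finitely many scalar indicators are
   differentiated, and the error splits as [alpha r + beta t] with small integrals. Averaging in [r]
   does not increase the integral of [alpha], so the error survives the limit unharmed. On the
   diagonal [r = t] the approximation is undone and the equation bounds [b t t]. Extending the
   scalar time functions by 0 to [t <= 0] builds in the zero initial value and makes the increment
   inequality true for [t < h] as well. The two pairings, H^-1 with H_0^1 and L^p' with L^p, are
   instances of one abstract pairing of seminormed spaces. The value spaces carry no sigma-algebra;
   every vector-valued function of time is restricted to a measurable subset of full measure in []0,
   T[] on which its properties hold at each point. *)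
From HB Require Import structures.
From mathcomp Require Import all_boot all_order all_algebra.
From mathcomp Require Import all_classical all_reals all_analysis.
From mathcomp Require Import measurable_realfun ring lra.
Require Import Defs.

Set Implicit Arguments.
Unset Strict Implicit.
Unset Printing Implicit Defensive.

Import Order.TTheory GRing.Theory Num.Theory.
Import numFieldNormedType.Exports.

Local Open Scope classical_set_scope.
Local Open Scope ring_scope.

(** * Smooth functions of one variable *)

Section smooth_functions.
Context {R : realType}.
Implicit Types (f g : R -> R) (x : R).

(** The recursion strips the innermost derivative, so that the closure properties follow by
    induction on [k] with the functions generalized; [smoothP] returns to the iterated derivatives
    of [time_test_fun]. *)
Fixpoint differentiable_n (k : nat) f : Prop :=
  if k is k'.+1 then (forall x, derivable f x 1) /\ differentiable_n k' (derive1 f)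
  else True.

Definition smooth f := forall k, differentiable_n k f.

Lemma derive1_val f (df : R -> R) :
  (forall x, is_derive x 1 f (df x)) -> (derive1 f) = df.
Proof. by move=> h; apply/funext => x; rewrite derive1E; exact: derive_val. Qed.

Lemma is_derive1P f : (forall x, derivable f x 1) ->
  forall x, is_derive x 1 f ((derive1 f) x).
Proof. by move=> df x; rewrite derive1E; exact/derivableP. Qed.

Lemma differentiable_nS k f df : (forall x, is_derive x 1 f (df x)) ->
  differentiable_n k df -> differentiable_n k.+1 f.
Proof.
move=> h kdf; split; first by move=> x; have [] := h x.
by rewrite (derive1_val h).
Qed.

Lemma differentiable_nW k f : differentiable_n k.+1 f -> differentiable_n k f.
Proof. by elim: k f => // k IH f [df] /IH. Qed.

Lemma differentiable_nD k f g : differentiable_n k f -> differentiable_n k g ->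
  differentiable_n k (f + g).
Proof.
elim: k f g => // k IH f g [df kf] [dg kg].
apply: (@differentiable_nS _ _ ((derive1 f) + (derive1 g))); last exact: IH.
by move=> x; apply: is_deriveD; exact: is_derive1P.
Qed.

Lemma differentiable_nM k f g : differentiable_n k f -> differentiable_n k g ->
  differentiable_n k (f * g).
Proof.
elim: k f g => // k IH f g Hf Hg; have [df kf] := Hf; have [dg kg] := Hg.
apply: (@differentiable_nS _ _ (f * (derive1 g) + g * (derive1 f))).
  by move=> x; apply: is_deriveM; exact: is_derive1P.
by apply: differentiable_nD; apply: IH => //; exact: differentiable_nW.
Qed.

Lemma differentiable_n_cst k (c : R) : differentiable_n k (cst c).
Proof.
elim: k c => // k IH c.
by apply: (@differentiable_nS _ _ (cst 0)) => // x; exact: is_derive_cst.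
Qed.

Lemma differentiable_nZ k (c : R) f : differentiable_n k f ->
  differentiable_n k (fun x => c * f x).
Proof. by move=> kf; apply: (@differentiable_nM _ (cst c)) => //; exact: differentiable_n_cst. Qed.

Lemma is_derive_affine (a b x : R) : is_derive x 1 (fun x => a * x + b) a.
Proof.
by apply: is_derive_eq; rewrite /GRing.scale/= mulr1 addr0.
Qed.

Lemma is_derive_comp_affine (a b : R) f df :
  (forall x, is_derive x 1 f (df x)) ->
  forall x, is_derive x 1 (fun x => f (a * x + b)) (a * df (a * x + b)).
Proof.
move=> h x; rewrite mulrC.
exact: (@is_derive1_comp _ f (fun x => a * x + b) x _ _ (h _) (is_derive_affine _ _ _)).
Qed.

Lemma differentiable_n_comp_affine k (a b : R) f : differentiable_n k f ->
  differentiable_n k (fun x => f (a * x + b)).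
Proof.
elim: k f => // k IH f [df kf].
apply: (@differentiable_nS _ _ (fun x => a * derive1 f (a * x + b))).
  by apply: is_derive_comp_affine; exact: is_derive1P.
by apply: differentiable_nZ; exact: IH.
Qed.

Lemma smoothP f : smooth f -> forall k x, derivable (derive1n k f) x 1.
Proof.
move=> sf k; have {sf} := sf k.+1.
by elim: k f => [f [] //|k IH f [_ /IH]]; rewrite -derive1Sn.
Qed.

Lemma smooth_derivable f : smooth f -> forall x, is_derive x 1 f ((derive1 f) x).
Proof. by move=> sf; apply: is_derive1P; have [] := sf 1%N. Qed.

Lemma smooth_derive f : smooth f -> smooth (derive1 f).
Proof. by move=> sf k; have [] := sf k.+1. Qed.

Lemma smooth_continuous f : smooth f -> continuous f.
Proof.
move=> sf x; apply: differentiable_continuous; apply/derivable1_diffP.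
by have [] := smooth_derivable sf x.
Qed.

Lemma smoothD f g : smooth f -> smooth g -> smooth (f + g).
Proof. by move=> sf sg k; apply: differentiable_nD. Qed.

Lemma smoothM f g : smooth f -> smooth g -> smooth (f * g).
Proof. by move=> sf sg k; apply: differentiable_nM. Qed.

Lemma smoothZ c f : smooth f -> smooth (fun x => c * f x).
Proof. by move=> sf k; apply: differentiable_nZ. Qed.

Lemma smooth_comp_affine (a b : R) f : smooth f ->
  smooth (fun x => f (a * x + b)).
Proof. by move=> sf k; apply: differentiable_n_comp_affine. Qed.

(* The derivatives of expR (- x^-1) on x > 0 are combinations of the functions
   x ^- n * expR (- x^-1). *)
Definition flat (n : nat) x : R := if 0 < x then x ^- n * expR (- x^-1) else 0.

Lemma flat_ge0 n x : 0 <= flat n x.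
Proof.
rewrite /flat; case: ifP => // x0.
by rewrite mulr_ge0// ?expR_ge0// invr_ge0 exprn_ge0// ltW.
Qed.

Lemma flat_le n x : flat n x <= n.+1`!%:R * `|x|.
Proof.
rewrite /flat; case: ifP => [x0|_]; last by rewrite mulr_ge0.
have y0 : 0 < x^-1 by rewrite invr_gt0.
have := @expR_ge1Dxn _ x^-1 n (ltW y0).
rewrite gtr0_norm// expRN => h.
rewrite ler_pdivrMr ?expR_gt0//.
have {h} : x^-1 ^+ n.+1 / n.+1`!%:R <= expR x^-1.
  by apply: le_trans h; rewrite lerDr.
rewrite ler_pdivrMr ?ltr0n ?fact_gt0// => h.
have -> : x ^- n = x^-1 ^+ n.+1 * x.
  by rewrite exprS exprVn mulrAC mulVf ?gt_eqF// mul1r.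
by rewrite mulrAC ler_pM2r// mulrC.
Qed.

(** The family is closed under differentiation up to linear combinations. At 0 the difference
    quotient of [flat n] is [flat n.+1] itself, which tends to 0 by [flat_le]. *)
Lemma is_derive_flat n x : is_derive x 1 (flat n) (flat n.+2 x - n%:R * flat n.+1 x).
Proof.
have [x0|x0|x0] := ltgtP x 0.
- have nx : \near x, cst 0 x = flat n x.
    near=> y; rewrite /flat ltNge ltW//.
    by near: y; exact: lt_nbhsl.
  apply: near_eq_is_derive nx _.
  rewrite /flat (ltNge 0 x) ltW//= mulr0 subr0; exact: is_derive_cst.
- have nx : \near x, (fun y => y^-1 ^+ n * expR (- y^-1)) x = flat n x.
    near=> y; rewrite /flat ifT ?exprVn//.
    by near: y; exact: lt_nbhsr.
  apply: near_eq_is_derive nx _.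
  have xn0 : x != 0 by rewrite gt_eqF.
  have dV : is_derive x 1 (fun y : R => y^-1) (- x ^- 2).
    have D := @is_deriveV _ (fun y : R => y) x 1 1 xn0 (is_derive_id _ _).
    by apply: is_derive_eq D _; rewrite /GRing.scale/= mulr1.
  have dE : is_derive x 1 (fun y : R => expR (- y^-1)) (expR (- x^-1) * x ^- 2).
    have dN : is_derive x 1 (fun y : R => - y^-1) (x ^- 2).
      by have := @is_deriveN _ _ _ _ _ _ _ dV; rewrite opprK.
    exact: (@is_derive1_comp _ expR (fun y => - y^-1) x _ _ _ dN).
  have dX := @is_deriveX _ _ (fun y : R => y^-1) n x 1 _ dV.
  have dP := @is_deriveM _ _ _ _ x 1 _ _ dX dE.
  have -> : (fun y : R => y^-1 ^+ n * expR (- y^-1)) =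
      (fun y : R => y^-1) ^+ n * (fun y : R => expR (- y^-1)).
    by apply/funext => y; rewrite fctE exprfctE.
  apply: is_derive_eq dP _.
  rewrite /flat x0 /GRing.scale/= -!exprVn exprfctE.
  case: n {dX} => [|n]; first by rewrite !expr0 !mul0r mulr0 addr0 subr0 mul1r expr2 mulrC.
  rewrite /= !exprS expr0; ring.
- rewrite x0 {2 3}/flat ltxx mulr0 subr0.
  have cvg0 : h^-1 *: ((flat n \o shift 0) (h *: 1) - flat n 0) @[h --> 0^'] --> (0 : R).
    apply/cvgr0Pnorm_le => e e0; near=> h.
    rewrite /= addr0 {2}/flat ltxx subr0 /GRing.scale/= mulr1.
    have -> : h^-1 * flat n h = flat n.+1 h.
      rewrite /flat; case: ifP => [h0|]; last by rewrite mulr0.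
      by rewrite mulrA -invfM -exprS.
    rewrite ger0_norm ?flat_ge0// (le_trans (flat_le _ _))//.
    rewrite mulrC -ler_pdivlMr ?ltr0n ?fact_gt0//.
    near: h; apply: dnbhs0_le; rewrite divr_gt0// ltr0n fact_gt0//.
  by apply: DeriveDef; [apply/cvg_ex; exists 0|exact: cvg_lim].
Unshelve. all: by end_near. Qed.

Lemma smooth_flat n : smooth (flat n).
Proof.
move=> k; elim: k n => // k IH n.
apply: (differentiable_nS (is_derive_flat n)).
apply: (differentiable_nD (IH n.+2)).
have -> : (fun x => - (n%:R * flat n.+1 x)) = (fun x => (- n%:R) * flat n.+1 x).
  by apply/funext => x; rewrite mulNr.
exact/differentiable_nZ/IH.
Qed.

Definition bump : R -> R := fun x => flat 0 x * flat 0 (1 - x).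

Lemma smooth_bump : smooth bump.
Proof.
apply: smoothM; first exact: smooth_flat.
have -> : (fun x => flat 0 (1 - x)) = (fun x => flat 0 ((-1) * x + 1)).
  by apply/funext => x; rewrite mulN1r addrC.
exact/smooth_comp_affine/smooth_flat.
Qed.

Lemma bump_ge0 x : 0 <= bump x.
Proof. by rewrite mulr_ge0 ?flat_ge0. Qed.

Lemma bump_gt0 x : 0 < x < 1 -> 0 < bump x.
Proof.
move=> /andP[x0 x1]; rewrite /bump /flat x0 subr_gt0 x1 !expr0 invr1 !mul1r.
by rewrite mulr_gt0// expR_gt0.
Qed.

Lemma bump_eq0 x : (x <= 0) || (1 <= x) -> bump x = 0.
Proof.
rewrite /bump /flat => /orP[|] h.
  by rewrite ltNge h mul0r.
by rewrite subr_gt0 [x < 1]ltNge h mulr0.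
Qed.

End smooth_functions.

(** * Integrals and null sets *)

Section almost_everywhere.
Context d (T : measurableType d) (R : realType).
Variable mu : {measure set T -> \bar R}.
Implicit Types P Q : T -> Prop.

Lemma aeS P Q : (forall x, P x -> Q x) ->
  {ae mu, forall x, P x} -> {ae mu, forall x, Q x}.
Proof. by move=> PQ; apply: filterS. Qed.

Lemma aeI P Q : {ae mu, forall x, P x} -> {ae mu, forall x, Q x} ->
  {ae mu, forall x, P x /\ Q x}.
Proof. by move=> aP aQ; apply: filterS2 aP aQ. Qed.

Lemma ae_countable (I : countType) (P : I -> T -> Prop) :
  (forall i, {ae mu, forall x, P i x}) -> {ae mu, forall x, forall i, P i x}.
Proof.
move=> aP; pose N n : set T := if unpickle n is Some i then ~` [set x | P i x] else set0.
have Nneg : mu.-negligible (\bigcup_n N n).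
  apply: negligible_bigcup => n; rewrite /N; case: unpickle => [i|]; first exact: aP.
  exact: negligible_set0.
apply: negligibleS Nneg.
  move=> x /= /existsNP[i nP]; exists (pickle i) => //.
  by rewrite /N pickleK.
Qed.

End almost_everywhere.

Section measure_helpers.
Context d (T : measurableType d) (R : realType).
Variable mu : {measure set T -> \bar R}.
Implicit Types (D : set T) (f g : T -> R).

Import HBNNSimple.

(* The integral of a nonmeasurable nonnegative function is the supremum over
   the simple functions below it, which is not affected by a null set. *)
Lemma ge0_le_integral_ae (f g : T -> \bar R) :
  (forall x, 0 <= f x)%E -> (forall x, 0 <= g x)%E ->
  {ae mu, forall x, f x = g x} -> (\int[mu]_x f x <= \int[mu]_x g x)%E.
Proof.
move=> f0 g0 [N [mN N0 fgN]]; have mCN := measurableC mN.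
rewrite ge0_integralTE// [leRHS]ge0_integralTE//.
apply: ge_ereal_sup => /= _ [h hf <-].
apply: (@le_trans _ _ (sintegral mu (proj_nnsfun h mCN))); last first.
  apply: ereal_sup_ubound; exists (proj_nnsfun h mCN) => // x.
  rewrite /proj_nnsfun/= mindicE; have [xN|xN] := boolP (x \in ~` N).
    rewrite mulr1 -(_ : f x = g x) ?hf//; apply: contrapT => fg.
    by move/set_mem : xN; apply; apply: fgN.
  by rewrite mulr0.
rewrite -!integralT_nnsfun le_eqVlt; apply/orP; left; apply/eqP.
apply: ae_eq_integral => //; [exact/measurable_EFinP|exact/measurable_EFinP|].
exists N; split => // x /= hx; apply: contrapT => xN; apply: hx => _.
by rewrite /proj_nnsfun/= mindicE mem_set// mulr1.
Qed.

(** Measurability is not assumed because this is applied to [N \o u] for a Bochner function [u] and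
    to the integrands of [is_time_derivative], which are known only through their values almost
    everywhere. *)
Lemma ae_eq_integral_nomeas D (f g : T -> \bar R) :
  {ae mu, forall x, D x -> f x = g x} ->
  (\int[mu]_(x in D) f x = \int[mu]_(x in D) g x)%E.
Proof.
move=> [N [mN N0 fgN]].
have fg x : ~ N x -> (f \_ D) x = (g \_ D) x.
  move=> Nx; rewrite !patchE; case: ifPn => // /set_mem Dx.
  by apply: contrapT => fg; apply/Nx/fgN => /(_ Dx).
rewrite integral_mkcond [RHS]integral_mkcond integralE [RHS]integralE.
have H (h k : T -> \bar R) : (forall x, 0 <= h x)%E -> (forall x, 0 <= k x)%E ->
    (forall x, ~ N x -> h x = k x) -> (\int[mu]_x h x = \int[mu]_x k x)%E.
  move=> h0 k0 hk; apply/eqP; rewrite eq_le; apply/andP; split;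
    apply: ge0_le_integral_ae => //; exists N; split => // x /= hx;
    by apply: contrapT => /hk E; apply: hx; rewrite E.
by congr (_ - _)%E; apply: H => // x /fg E; rewrite ?funeposE ?funenegE E.
Qed.

Lemma ae_eq_Rintegral D f g : {ae mu, forall x, D x -> f x = g x} ->
  \int[mu]_(x in D) f x = \int[mu]_(x in D) g x.
Proof.
move=> fg; congr fine; apply: ae_eq_integral_nomeas.
by apply: filterS fg => x /[apply] ->.
Qed.

Lemma ae_dominated_Rcvg D (f_ : nat -> T -> R) f g : measurable D ->
  (forall n, measurable_fun D (f_ n)) -> measurable_fun D f ->
  {ae mu, forall x, D x -> f_ n x @[n --> \oo] --> f x} ->
  mu.-integrable D (EFin \o g) ->
  (forall n x, D x -> `|f_ n x| <= g x) ->
  mu.-integrable D (EFin \o f) /\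
  \int[mu]_(x in D) f_ n x @[n --> \oo] --> \int[mu]_(x in D) f x.
Proof.
move=> mD mf_ mf f_f ig fg.
have [||||fi _ cv] := @dominated_convergence _ _ _ mu D mD
  (fun n => EFin \o f_ n) (EFin \o f) (EFin \o g) _ _ _ ig.
- by move=> n; exact/measurable_EFinP.
- exact/measurable_EFinP.
- apply: filterS f_f => x fx Dx; apply: cvg_EFin; first exact: nearW.
  exact: fx.
- by apply: aeW => x n Dx; rewrite lee_fin fg.
split => //; apply: fine_cvg; rewrite fineK//; exact: integrable_fin_num.
Qed.

Lemma dominated_Rcvg D (f_ : nat -> T -> R) f g : measurable D ->
  (forall n, measurable_fun D (f_ n)) ->
  (forall x, D x -> f_ n x @[n --> \oo] --> f x) ->
  mu.-integrable D (EFin \o g) ->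
  (forall n x, D x -> `|f_ n x| <= g x) ->
  mu.-integrable D (EFin \o f) /\
  \int[mu]_(x in D) f_ n x @[n --> \oo] --> \int[mu]_(x in D) f x.
Proof.
move=> mD mf_ f_f ig fg.
have mf : measurable_fun D f by apply: measurable_fun_cvg f_f.
apply: ae_dominated_Rcvg ig fg => //; exact: aeW.
Qed.

Lemma integrable_dominated D f g : measurable D -> measurable_fun D f ->
  mu.-integrable D (EFin \o g) -> (forall x, D x -> `|f x| <= g x) ->
  mu.-integrable D (EFin \o f).
Proof.
move=> mD mf ig fg; apply: le_integrable ig => //; first exact/measurable_EFinP.
by move=> x Dx /=; rewrite lee_fin (le_trans (fg _ Dx))// ler_norm.
Qed.

Lemma ae_le_Rintegral D f g : measurable D ->
  mu.-integrable D (EFin \o f) -> mu.-integrable D (EFin \o g) ->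
  {ae mu, forall x, D x -> f x <= g x} ->
  \int[mu]_(x in D) f x <= \int[mu]_(x in D) g x.
Proof.
move=> mD fi gi fg.
have mf : measurable_fun D f by apply/measurable_EFinP; exact: measurable_int fi.
have mg : measurable_fun D g by apply/measurable_EFinP; exact: measurable_int gi.
(* The maximum equals [g] almost everywhere and dominates [f] everywhere, so that the pointwise
   comparison of integrals applies. *)
have -> : \int[mu]_(x in D) g x = \int[mu]_(x in D) (Num.max (f x) (g x)).
  apply: ae_eq_Rintegral; apply: filterS fg => x /[apply] h.
  by apply/esym/max_idPr.
apply: le_Rintegral => //; last by move=> x _; rewrite le_max lexx.
apply: (@integrable_dominated _ _ (fun x => `|f x| + `|g x|)) => //.
- exact: measurable_maxr.
- exact: (integrableD mD (integrable_norm fi) (integrable_norm gi)).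
- move=> x _; have [_|_] := leP (f x) (g x); rewrite ?lerDl ?lerDr//.
Qed.

End measure_helpers.

Section lebesgue_helpers.
Context {R : realType}.
Notation leb := (@lebesgue_measure R).

Lemma integrable_subset (D E : set R) (f : R -> R) : measurable E ->
  measurable D -> D `<=` E -> leb.-integrable E (EFin \o f) ->
  leb.-integrable D (EFin \o f).
Proof. by move=> mE mD DE; exact: integrableS. Qed.

Lemma integrable_add (D : set R) (f g : R -> R) : measurable D ->
  leb.-integrable D (EFin \o f) -> leb.-integrable D (EFin \o g) ->
  leb.-integrable D (EFin \o (fun t => f t + g t)).
Proof. by move=> mD fi gi; exact: (integrableD _ fi gi). Qed.

Lemma integrable_sub (D : set R) (f g : R -> R) : measurable D ->
  leb.-integrable D (EFin \o f) -> leb.-integrable D (EFin \o g) ->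
  leb.-integrable D (EFin \o (fun t => f t - g t)).
Proof. by move=> mD fi gi; exact: (integrableB _ fi gi). Qed.

Lemma integrable_scale (D : set R) (k : R) (f : R -> R) : measurable D ->
  leb.-integrable D (EFin \o f) -> leb.-integrable D (EFin \o (fun t => k * f t)).
Proof. by move=> mD fi; exact: (integrableZl _ k fi). Qed.

Lemma integrable_bigsum (D : set R) (I : finType) (f : I -> R -> R) : measurable D ->
  (forall i, leb.-integrable D (EFin \o f i)) ->
  leb.-integrable D (EFin \o (fun t => \sum_i f i t)).
Proof.
move=> mD fi; have -> : EFin \o (fun t => \sum_i f i t) = (fun t => \sum_i (f i t)%:E)%E.
  by apply/funext => t /=; rewrite sumEFin.
by apply: integrable_sum => // i _; exact: fi.
Qed.

Lemma integrable_indic_subset (A : set R) (T : R) : measurable A -> A `<=` `]0, T[ ->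
  leb.-integrable setT (EFin \o (\1_A : R -> R)).
Proof.
move=> mA AT; apply: (@integrable_dominated _ _ _ leb setT _ (\1_`]0, T[ : R -> R)).
- exact: measurableT.
- by apply: measurable_indic; exact: mA.
- exact: (@integrable_indic_itv R 0 T false true).
- move=> x _; rewrite !indicE; have [/set_mem/AT xT|_] := boolP (x \in A).
    by rewrite mem_set// normr1.
  by rewrite normr0.
Qed.

Lemma integrable_cst_itv (a b k : R) (x y : bool) :
  leb.-integrable [set` Interval (BSide x a) (BSide y b)] (EFin \o (fun=> k)).
Proof.
apply: measurable_bounded_integrable => //=.
  by rewrite lebesgue_measure_itv/=; case: ifP => // _; rewrite -EFinD ltry.
by exists `|k|; split => // z zk t _ /=; rewrite ltW.
Qed.

Lemma Rintegral_cst_itv (a b k : R) (x y : bool) : a <= b ->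
  \int[leb]_(t in [set` Interval (BSide x a) (BSide y b)]) k = k * (b - a).
Proof.
move=> ab; rewrite Rintegral_cst//; congr (_ * _).
have -> : fine (leb [set` Interval (BSide x a) (BSide y b)]) = b - a => //.
rewrite lebesgue_measure_itv/= lte_fin; case: ltP => //= ba.
by apply/esym/eqP; rewrite subr_eq0 eq_le ba.
Qed.

End lebesgue_helpers.

Lemma cvg_bigsum (R : realType) (I : finType) (f : I -> nat -> R) (l : I -> R) :
  (forall i, f i n @[n --> \oo] --> l i) ->
  (\sum_i f i n) @[n --> \oo] --> \sum_i l i.
Proof.
by move=> fl; apply: cvg_big => //; exact: add_continuous.
Qed.

Notation leb_integrable f :=
  ((@lebesgue_measure _).-integrable setT (EFin \o f)) (only parsing).

(** * Translation invariance on the line *)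

Section translation.
Context {R : realType}.
Notation leb := (@lebesgue_measure R).
Variable h : R.
Let sh : R -> measurableTypeR R := fun t => t + h.

Let msh : measurable_fun [set: measurableTypeR R] sh.
Proof. exact: measurable_funD. Qed.

Lemma lebesgue_measure_shift (A : set R) : measurable A ->
  pushforward leb sh A = leb A.
Proof.
move=> mA; apply/esym/lebesgue_measure_unique => //= _ [[a b]] _ <-.
rewrite /pushforward.
have -> : sh @^-1` `]a, b] = `](a - h), (b - h)]%classic.
  by apply/seteqP; split => x /=; rewrite !in_itv/= /sh ltrBlDr lerBrDr.
by rewrite !lebesgue_measure_itv/= !lte_fin ltrD2r; case: ifP => // _; rewrite -!EFinD; congr EFin; ring.
Qed.

Lemma ae_shift (P : R -> Prop) : {ae leb, forall t, P t} ->
  {ae leb, forall t, P (t + h)}.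
Proof.
move=> [N [mN N0 PN]]; exists (sh @^-1` N); split.
- by rewrite -[X in measurable X]setTI; exact: msh.
- by rewrite -[LHS]/(pushforward leb sh N) lebesgue_measure_shift.
- by move=> x /= Px; apply: PN.
Qed.

Lemma integral_shift (D : set R) (f : R -> R) : measurable D ->
  measurable_fun setT f -> leb.-integrable D (EFin \o f) ->
  leb.-integrable [set t | D (t + h)] (fun t => (f (t + h))%:E) /\
  \int[leb]_(t in [set t | D (t + h)]) f (t + h) = \int[leb]_(t in D) f t.
Proof.
move=> mD mf intf.
have mD' : measurable [set t | D (t + h)].
  by rewrite -[X in measurable X]setTI; exact: msh.
have E (g : R -> \bar R) : (\int[pushforward leb sh]_(y in D) g y = \int[leb]_(y in D) g y)%E.
  by apply: eq_measure_integral => A mA _; exact: lebesgue_measure_shift.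
have intfh : leb.-integrable [set t | D (t + h)] (fun t => (f (t + h))%:E).
  apply/integrableP; split.
    apply/measurable_EFinP; apply: measurable_funTS.
    exact: measurableT_comp msh.
  move/integrableP : intf => [_]; rewrite -E ge0_integral_pushforward//.
  by apply: measurableT_comp => //; apply/measurable_EFinP; exact: measurable_funTS.
split => //; rewrite /Rintegral -[in RHS]E.
by rewrite (integral_pushforward msh)//; exact/measurable_EFinP.
Qed.

End translation.

(** * Weak derivatives in time *)

Section step_function.
Context {R : realType}.
Implicit Types x : R.
Notation leb := (@lebesgue_measure R).
Notation bump := (@bump R).

Lemma bump_le1 x : bump x <= 1.
Proof.
rewrite /bump -[leRHS]mulr1 ler_pM ?flat_ge0// /flat; case: ifP => // x0;
  by rewrite expr0 invr1 mul1r expR_le1 oppr_le0 invr_ge0 ltW//.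
Qed.

Lemma continuous_bump : continuous bump.
Proof. exact/smooth_continuous/smooth_bump. Qed.

Lemma integrable_bump : leb_integrable bump.
Proof.
apply: (@integrable_dominated _ _ _ leb setT bump \1_`[0, 1]) => //.
- by apply: continuous_measurable_fun; exact: continuous_bump.
- exact: (@integrable_indic_itv R 0 1 true false).
- move=> x _; rewrite ger0_norm ?bump_ge0// indicE; case: (boolP (_ \in _)) => [_|].
    exact: bump_le1.
  rewrite notin_setE/= in_itv/= => /negP; rewrite negb_and -!ltNge => h.
  by rewrite bump_eq0//; case/orP: h => /ltW ->; rewrite ?orbT.
Qed.

Definition step0 x : R := \int[leb]_(t in `]-oo, x]) bump t.

Lemma is_derive_step0 x : is_derive x 1 step0 (bump x).
Proof.
have ix : leb.-integrable `]-oo, (x + 1)] (EFin \o bump).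
  by apply: (integrable_subset _ _ _ integrable_bump).
have xx1 : x < x + 1 by rewrite ltrDl.
have [|d <-] := continuous_FTC1 xx1 ix (ltNyr x); first exact: continuous_bump.
by rewrite derive1E; exact/derivableP.
Qed.

Lemma step0_le0 x : x <= 0 -> step0 x = 0.
Proof.
move=> x0; rewrite /step0 (@eq_Rintegral _ _ _ leb _ (cst 0)); last first.
  by move=> t /[!inE]/= /[!in_itv]/= tx; rewrite bump_eq0// (le_trans tx).
by rewrite Rintegral_cst// mul0r.
Qed.

Lemma step0_const x : 1 <= x -> step0 x = step0 1.
Proof.
rewrite le_eqVlt => /predU1P[->//|x1].
have [||c + E] := @MVT _ step0 bump _ _ x1.
- by move=> *; exact: is_derive_step0.
- by apply: derivable_within_continuous => y _; have [] := is_derive_step0 y.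
rewrite in_itv/= => /andP[c1 _].
by apply/eqP; rewrite -subr_eq0 E bump_eq0 ?mul0r// (ltW c1) orbT.
Qed.

Lemma step0_homo : {homo step0 : x y / x <= y}.
Proof.
move=> x y; rewrite le_eqVlt => /predU1P[->//|xy].
have [||c _ E] := @MVT _ step0 bump _ _ xy.
- by move=> *; exact: is_derive_step0.
- by apply: derivable_within_continuous => z _; have [] := is_derive_step0 z.
by rewrite -subr_ge0 E mulr_ge0 ?bump_ge0// subr_ge0 ltW.
Qed.

Lemma step0_1_gt0 : 0 < step0 1.
Proof.
have [||c + E] := @MVT _ step0 bump _ _ (@ltr01 R).
- by move=> *; exact: is_derive_step0.
- by apply: derivable_within_continuous => z _; have [] := is_derive_step0 z.
rewrite in_itv/= => c01.
by rewrite -[step0 1]subr0 -[X in _ - X](@step0_le0 0)// E subr0 mulr1 bump_gt0.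
Qed.

(** A smooth transition, 0 up to 0 and 1 from 1 on. With argument [n%:R * (x - a)] it takes place in
    the layer [[a, a + n%:R^-1]]. *)
Definition step x := (step0 1)^-1 * step0 x.
Definition step' x := (step0 1)^-1 * bump x.

Lemma is_derive_step x : is_derive x 1 step (step' x).
Proof.
have := @is_deriveZ _ _ _ step0 (step0 1)^-1 x 1 _ (is_derive_step0 x); exact.
Qed.

Lemma smooth_step : smooth step.
Proof.
case=> // k; apply: (differentiable_nS is_derive_step).
exact/differentiable_nZ/smooth_bump.
Qed.

Lemma step_le0 x : x <= 0 -> step x = 0.
Proof. by move=> x0; rewrite /step (step0_le0 x0) mulr0. Qed.

Lemma step_ge1 x : 1 <= x -> step x = 1.
Proof. by move=> x1; rewrite /step (step0_const x1) mulVf// gt_eqF// step0_1_gt0. Qed.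

Lemma step_homo : {homo step : x y / x <= y}.
Proof. by move=> x y xy; rewrite ler_pM2l ?step0_homo// invr_gt0 step0_1_gt0. Qed.

Lemma step_ge0 x : 0 <= step x.
Proof.
have [x0|/ltW x0] := leP x 0; first by rewrite step_le0.
by rewrite -(@step_le0 0)// step_homo.
Qed.

Lemma step_le1 x : step x <= 1.
Proof.
have [x1|/ltW x0] := leP x 1; last by rewrite step_ge1.
by rewrite -[leRHS](@step_ge1 1)// step_homo.
Qed.

Lemma step'_ge0 x : 0 <= step' x.
Proof. by rewrite mulr_ge0 ?bump_ge0// invr_ge0 ltW// step0_1_gt0. Qed.

Lemma step'_eq0 x : (x <= 0) || (1 <= x) -> step' x = 0.
Proof. by move=> h; rewrite /step' (bump_eq0 h) mulr0. Qed.

Lemma cvg_step_gt a x : a < x -> step (n%:R * (x - a)) @[n --> \oo] --> (1 : R).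
Proof.
move=> ax; apply: cvg_near_cst; near=> n; apply: step_ge1.
rewrite -ler_pdivrMr ?subr_gt0//; near: n; exact: nbhs_infty_ger.
Unshelve. all: by end_near. Qed.

Definition cutoff (a b : R) (n : nat) x :=
  step (n%:R * (x - a)) * step (n%:R * (b - x)).

Lemma smooth_cutoff a b n : smooth (cutoff a b n).
Proof.
apply: smoothM.
  have -> : (fun x => step (n%:R * (x - a))) = (fun x => step (n%:R * x + - (n%:R * a))).
    by apply/funext => x; rewrite mulrBr.
  exact/smooth_comp_affine/smooth_step.
have -> : (fun x => step (n%:R * (b - x))) = (fun x => step (- n%:R * x + n%:R * b)).
  by apply/funext => x; rewrite mulrBr mulNr addrC.
exact/smooth_comp_affine/smooth_step.
Qed.

Lemma cutoff_ge0 a b n x : 0 <= cutoff a b n x.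
Proof. by rewrite mulr_ge0 ?step_ge0. Qed.

Lemma cutoff_le1 a b n x : cutoff a b n x <= 1.
Proof. by rewrite -[leRHS]mulr1 ler_pM ?step_ge0 ?step_le1. Qed.

Lemma cutoff_eq0 a b n x : ~~ (a < x < b) -> cutoff a b n x = 0.
Proof.
rewrite negb_and -!leNgt /cutoff => /orP[h|h].
  by rewrite step_le0 ?mul0r// mulr_ge0_le0 ?subr_le0.
by rewrite [X in _ * X]step_le0 ?mulr0// mulr_ge0_le0 ?subr_le0.
Qed.

(** Both factors of [cutoff] vanish at and beyond their own end point, so the limit is the indicator
    of the open interval at every point, end points included. *)
Lemma cvg_cutoff a b x : cutoff a b n x @[n --> \oo] --> ((a < x < b)%R%:R : R).
Proof.
have [/andP[ax xb]|h] := boolP (a < x < b); last first.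
  by under eq_fun do rewrite cutoff_eq0//; exact: cvg_cst.
by rewrite -[X in _ --> X]mulr1; apply: cvgM; exact: cvg_step_gt.
Qed.

End step_function.

Section du_bois_reymond.
Context {R : realType}.
Notation leb := (@lebesgue_measure R).
Variables (T : R) (M d : R -> R).
Hypotheses (T0 : 0 < T) (cM : {within `[0, T], continuous M}).
Hypothesis id_ : leb.-integrable `]0, T[ (EFin \o d).
Hypothesis weak : forall phi, time_test_fun T phi ->
  \int[leb]_(t in `]0, T[) (M t * derive1 phi t) =
  - \int[leb]_(t in `]0, T[) (d t * phi t).

(** The test functions are the differences [ramp a n - ramp b n]. Their derivatives consist of two
    opposite unit masses that concentrate at [a] and [b] from the right, so the weak equation tends
    to the increment of [M] between [a] and [b]. *)
Let ramp (c : R) (n : nat) (x : R) := step (n%:R * (x - c)).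
Let ramp' (c : R) (n : nat) (x : R) := n%:R * step' (n%:R * (x - c)).

Let rampE c n : ramp c n = (fun x => step (n%:R * x + - (n%:R * c))).
Proof. by apply/funext => x; rewrite /ramp mulrBr. Qed.

Let is_derive_ramp c n (x : R) : is_derive x 1 (ramp c n) (ramp' c n x).
Proof.
rewrite rampE /ramp' mulrBr.
exact: (is_derive_comp_affine _ _ is_derive_step).
Qed.

Let smooth_ramp c n : smooth (ramp c n).
Proof. by rewrite rampE; exact/smooth_comp_affine/smooth_step. Qed.

Let continuous_ramp' c n : continuous (ramp' c n).
Proof.
rewrite -(derive1_val (is_derive_ramp c n)).
exact/smooth_continuous/smooth_derive/smooth_ramp.
Qed.

Let ramp'_eq0 (c : R) (n : nat) (x : R) : (0 < n)%N -> (x <= c) || (c + n%:R^-1 <= x) -> ramp' c n x = 0.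
Proof.
move=> n0 h; rewrite /ramp' step'_eq0 ?mulr0//; case/orP: h => h; apply/orP.
  by left; rewrite mulr_ge0_le0// subr_le0.
by right; rewrite mulrC -ler_pdivrMr ?ltr0n// div1r lerBrDl.
Qed.

Let ramp'_ge0 c n x : 0 <= ramp' c n x.
Proof. by rewrite mulr_ge0// step'_ge0. Qed.

Let int_ramp' (c : R) (n : nat) : (0 < n)%N ->
  \int[leb]_(t in `[c, c + n%:R^-1]) ramp' c n t = 1.
Proof.
move=> n0; have cn : c < c + n%:R^-1 by rewrite ltrDl invr_gt0 ltr0n.
have cramp : continuous (ramp c n) by exact/smooth_continuous/smooth_ramp.
rewrite /Rintegral (continuous_FTC2 cn (F := ramp c n)).
- rewrite -EFinB /= /ramp subrr mulr0 [X in _ - X]step_le0// subr0 step_ge1//.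
  by rewrite addrAC subrr add0r divff// pnatr_eq0 -lt0n.
- exact/continuous_subspaceT/continuous_ramp'.
- split.
  + by move=> x _; have [] := is_derive_ramp c n x.
  + exact/cvg_at_right_filter/cramp.
  + exact/cvg_at_left_filter/cramp.
- by move=> x _; rewrite (derive1_val (is_derive_ramp c n)).
Qed.

Let integrable_Mk (k : R -> R) : continuous k ->
  leb.-integrable `[0, T] (EFin \o (fun t => M t * k t)).
Proof.
move=> ck; apply: (@continuous_compact_integrable _ (fun t => M t * k t)).
  exact: segment_compact.
move=> t; apply: cvgM; first exact: cM.
exact: (continuous_subspaceT ck).
Qed.

Let ramp_ge1 (c : R) (n : nat) (x : R) : (0 < n)%N -> c + n%:R^-1 <= x -> ramp c n x = 1.
Proof.
move=> n0 h; apply: step_ge1.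
by rewrite mulrC -ler_pdivrMr ?ltr0n// div1r lerBrDl.
Qed.

Let cvg_Mramp (c : R) : 0 < c < T ->
  \int[leb]_(t in `]0, T[) (M t * ramp' c n t) @[n --> \oo] --> M c.
Proof.
move=> /andP[c0 cT].
have cc : c \in `]0, T[ by rewrite in_itv/= c0.
have /cvgrPdist_le cMc : {for c, continuous M}.
  by apply: within_continuous_continuous T0 cM cc.
apply/cvgrPdist_le => e e0.
have [r /= r0 rM] := cMc _ e0.
near=> n.
have n0 : (0 < n)%N by near: n; exact: nbhs_infty_gt.
have nbnd (s : R) : 0 < s -> s^-1 < n%:R -> n%:R^-1 < s.
  by move=> s0 sn; rewrite invf_plt ?posrE// ltr0n.
have nr : n%:R^-1 < r.
  by apply: nbnd => //; near: n; exact: nbhs_infty_gtr.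
have nT : c + n%:R^-1 < T.
  rewrite -ltrBrDl; apply: nbnd; first by rewrite subr_gt0.
  by near: n; exact: nbhs_infty_gtr.
have sub0 : `[c, c + n%:R^-1] `<=` `]0, T[.
  by move=> t /=; rewrite !in_itv/= => /andP[ct tn]; rewrite (lt_le_trans c0 ct)/= (le_lt_trans tn).
have sub : `[c, c + n%:R^-1] `<=` `[0, T].
  by apply: (subset_trans sub0); exact: subset_itvW.
have -> : \int[leb]_(t in `]0, T[) (M t * ramp' c n t) =
    \int[leb]_(t in `[c, c + n%:R^-1]) (M t * ramp' c n t).
  rewrite -[in RHS](setIidr sub0) Rintegral_mkcondr; apply: eq_Rintegral => t _.
  rewrite patchE; case: ifPn => //; rewrite notin_setE/= in_itv/= => /negP.
  rewrite negb_and -!ltNge => h; rewrite ramp'_eq0 ?mulr0//.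
  by case/orP: h => /ltW ->; rewrite ?orbT.
have iI (k : R -> R) : {within `[0, T], continuous k} -> leb.-integrable `[c, c + n%:R^-1] (EFin \o k).
  move=> ck; apply: (integrable_subset _ _ sub) => //.
  by apply: continuous_compact_integrable => //; exact: segment_compact.
have i1 : leb.-integrable `[c, c + n%:R^-1] (EFin \o (fun t => M t * ramp' c n t)).
  exact: (integrable_subset _ _ sub (integrable_Mk (@continuous_ramp' c n))).
have i2 : leb.-integrable `[c, c + n%:R^-1] (EFin \o ramp' c n).
  by apply: iI; apply: continuous_subspaceT; exact: continuous_ramp'.
have i3 k : leb.-integrable `[c, c + n%:R^-1] (EFin \o (fun t => k * ramp' c n t)).
  by apply: (integrableZl _ k i2).
have -> : M c = \int[leb]_(t in `[c, c + n%:R^-1]) (M c * ramp' c n t).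
  by rewrite RintegralZl// int_ramp'// mulr1.
rewrite -RintegralB//.
have i4 : leb.-integrable `[c, c + n%:R^-1] (EFin \o (fun t => M c * ramp' c n t - M t * ramp' c n t)).
  exact: (integrableB _ (i3 _) i1).
apply: (le_trans (le_normr_Rintegral _ i4)) => //.
rewrite [leRHS](_ : e = \int[leb]_(t in `[c, c + n%:R^-1]) (e * ramp' c n t)); last first.
  by rewrite RintegralZl// int_ramp'// mulr1.
apply: le_Rintegral; [by []|exact: (integrable_norm i4)|exact: i3|].
move=> t /= tI; rewrite -mulrBl normrM (ger0_norm (ramp'_ge0 _ _ _)).
rewrite ler_wpM2r// rM//=; move: tI; rewrite in_itv/= => /andP[ct tn].
rewrite distrC ger0_norm ?subr_ge0// ltrBlDl (le_lt_trans tn)// ltrD2l//.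
Unshelve. all: by end_near. Qed.

Let cvg_ramp c (x : R) : ramp c n x @[n --> \oo] --> ((c < x)%R%:R : R).
Proof.
have [cx|xc] := ltP c x; first exact: cvg_step_gt.
under eq_fun do rewrite /ramp step_le0 ?mulr_ge0_le0 ?subr_le0//.
exact: cvg_cst.
Qed.

Let test_ramp (a b : R) (n : nat) : 0 < a -> a < b -> (0 < n)%N -> b + n%:R^-1 < T ->
  time_test_fun T (fun t => ramp a n t - ramp b n t).
Proof.
move=> a0 ab n0 bT; split.
  apply: smoothP.
  have -> : (fun t => ramp a n t - ramp b n t) = ramp a n + (fun t => (-1) * ramp b n t).
    by apply/funext => t; rewrite addrfctE mulN1r.
  by apply: smoothD => //; exact: smoothZ.
exists `[a, b + n%:R^-1]%classic; split.
- exact: segment_compact.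
- move=> t /=; rewrite !in_itv/= => /andP[at_ tb].
  by rewrite (lt_le_trans a0 at_)/= (le_lt_trans tb).
- move=> t /= /negP; rewrite in_itv/= negb_and -!ltNge => /orP[ta|bt].
    rewrite /ramp !step_le0 ?subrr// mulr_ge0_le0// subr_le0 ltW//.
    exact: lt_trans ab.
  rewrite !ramp_ge1 ?subrr// ltW//.
  by apply: lt_trans bt; rewrite ltrD2r.
Qed.

Let increment (a b : R) : 0 < a -> a < b -> b < T ->
  M b - M a = \int[leb]_(t in `]a, b]) d t.
Proof.
move=> a0 ab bT.
have Ma : \int[leb]_(t in `]0, T[) (M t * ramp' a n t) @[n --> \oo] --> M a.
  by apply: cvg_Mramp; rewrite a0 (lt_trans ab).
have Mb : \int[leb]_(t in `]0, T[) (M t * ramp' b n t) @[n --> \oo] --> M b.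
  by apply: cvg_Mramp; rewrite bT (lt_trans a0).
have sub : `]a, b] `<=` `]0, T[.
  by move=> t /=; rewrite !in_itv/= => /andP[at_ tb]; rewrite (lt_trans a0 at_)/= (le_lt_trans tb).
have [|||||_ D] := @dominated_Rcvg _ _ _ leb `]0, T[ (fun n t => d t * (ramp a n t - ramp b n t))
    (fun t => d t * \1_`]a, b] t) (fun t => 2 * `|d t|).
- exact: measurable_itv.
- move=> n; apply: measurable_funM.
    by apply/measurable_EFinP; exact: (measurable_int leb).
  apply: measurable_funTS; apply: measurable_funB;
    by apply: continuous_measurable_fun; apply/smooth_continuous/smooth_ramp.
- move=> t _; apply: cvgM; first exact: cvg_cst.
  have -> : \1_`]a, b] t = (a < t)%R%:R - (b < t)%R%:R :> R.
    rewrite indicE mem_setE/= in_itv/=; have [at_|ta] := ltP a t.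
      by rewrite ltNge; case: (t <= b); rewrite ?subr0 ?subrr.
    by rewrite ltNge (le_trans ta (ltW ab)) subrr.
  by apply: cvgB; exact: cvg_ramp.
- apply: (@integrableZl _ _ _ _ _ _ 2 _ (integrable_norm id_)); exact: measurable_itv.
- move=> n t _; rewrite normrM mulrC ler_wpM2r//.
  rewrite (le_trans (ler_normB _ _))// -[leRHS]/(1 + 1) /ramp.
  by rewrite lerD// ger0_norm ?step_ge0// step_le1.
have EI : \int[leb]_(t in `]0, T[) (d t * \1_`]a, b] t) = \int[leb]_(t in `]a, b]) d t.
  rewrite -[in RHS](setIidr sub) Rintegral_mkcondr; apply: eq_Rintegral => t _.
  by rewrite indicE patchE; case: ifP; rewrite ?mulr1 ?mulr0.
rewrite EI in D; move/cvgN : D => D.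
apply: oppr_inj; rewrite opprB.
apply: (cvg_unique _ _ D); first exact: Rhausdorff.
(* The difference of ramps is supported in [[a, b + n%:R^-1]], which lies in []0, T[] only for large
   [n]. *)
have E : \forall n \near \oo, \int[leb]_(t in `]0, T[) (M t * ramp' a n t) - \int[leb]_(t in `]0, T[) (M t * ramp' b n t) =
    - \int[leb]_(t in `]0, T[) (d t * (ramp a n t - ramp b n t)).
  near=> n.
  have n0 : (0 < n)%N by near: n; exact: nbhs_infty_gt.
  have nT : b + n%:R^-1 < T.
    rewrite -ltrBrDl invf_plt ?posrE ?ltr0n ?subr_gt0//.
    by near: n; exact: nbhs_infty_gtr.
  rewrite -(weak (test_ramp a0 ab n0 nT)).
  have DR (x : R) : is_derive x 1 (fun t => ramp a n t - ramp b n t) (ramp' a n x - ramp' b n x).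
    by apply: is_deriveB; exact: is_derive_ramp.
  rewrite (derive1_val DR).
  have iM c : leb.-integrable `]0, T[ (EFin \o (fun t => M t * ramp' c n t)).
    by apply: (integrable_subset _ _ _ (integrable_Mk (@continuous_ramp' c n))) => //; exact: subset_itvW.
  by rewrite -RintegralB//; apply: eq_Rintegral => t _; rewrite mulrBr.
apply: (cvg_trans (near_eq_cvg _) (cvgB Ma Mb)).
by apply: filterS E => n /= E'; exact: E'.
Unshelve. all: by end_near. Qed.

Lemma weak_derivative_increment (b : R) : 0 < b < T ->
  M b - M 0 = \int[leb]_(t in `]0, b[) d t.
Proof.
move=> /andP[b0 bT].
have [_ cM0 _] := (continuous_within_itvP _ T0).1 cM.
(* [increment] needs a positive left end, so 0 is reached as a limit, by right continuity of [M] at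
   0. The denominator starts at 2 to have [a n < b] for every [n]. *)
pose a n : R := b / n.+2%:R.
have a0 n : 0 < a n by rewrite divr_gt0.
have ab n : a n < b by rewrite ltr_pdivrMr// ltr_pMr// ltr1n.
have a_0 : a n @[n --> \oo] --> (0 : R).
  rewrite -(mulr0 b); apply: cvgM; first exact: cvg_cst.
  have := @cvg_harmonic R; rewrite -(cvg_shiftS (@harmonic R)); exact.
have Ma : M (a n) @[n --> \oo] --> M 0.
  by move/cvg_at_rightP : cM0; apply; split.
have id0b : leb.-integrable `]0, b] (EFin \o d).
  apply: (integrable_subset _ _ _ id_) => //; apply: subset_itv; rewrite bnd_simp//.
have [|||||_ D] := @dominated_Rcvg _ _ _ leb `]0, b] (fun n t => d t * \1_`]a n, b] t)
    d (fun t => `|d t|).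
- exact: measurable_itv.
- move=> n; apply: measurable_funM; last exact: measurable_indic.
  by apply/measurable_EFinP; exact: (measurable_int leb).
- move=> t /=; rewrite in_itv/= => /andP[t0 tb].
  rewrite -[X in _ --> X]mulr1; apply: cvgM; first exact: cvg_cst.
  apply: cvg_near_cst; near=> n; rewrite indicE mem_set//= in_itv/= tb andbT.
  near: n; move/cvgr_lt : a_0; exact.
- exact: integrable_norm.
- move=> n t _; rewrite normrM ler_piMr// indicE; case: (_ \in _); rewrite ?normr1 ?normr0//.
rewrite Rintegral_itv_bndo_bndc; last first.
  by apply: (integrable_subset _ _ _ id0b) => //; apply: subset_itv; rewrite bnd_simp.
apply: (cvg_unique _ _ D); first exact: Rhausdorff.
have -> : (fun n => \int[leb]_(t in `]0, b]) (d t * \1_`]a n, b] t)) = (fun n => M b - M (a n)).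
  apply/funext => n; rewrite increment//.
  have sub : `]a n, b] `<=` `]0, b] by apply: subset_itv; rewrite bnd_simp// ltW.
  rewrite -[in RHS](setIidr sub) Rintegral_mkcondr; apply: eq_Rintegral => t _.
  by rewrite indicE patchE; case: ifP; rewrite ?mulr1 ?mulr0.
by apply: cvgB => //; exact: cvg_cst.
Unshelve. all: by end_near. Qed.

End du_bois_reymond.

(** * Steklov averages and Gronwall's lemma *)

Section steklov.
Context {R : realType}.
Notation leb := (@lebesgue_measure R).
Implicit Types (f g : R -> R).

(** Starting at minus infinity allows negative arguments such as [t - h]: the integrands that matter
    vanish for [t <= 0], and so does their primitive. *)
Definition primitive f (x : R) : R := \int[leb]_(t in `]-oo, x]) f t.

Lemma primitive_eq0 f x : (forall t, t <= 0 -> f t = 0) -> x <= 0 ->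
  primitive f x = 0.
Proof.
move=> f0 x0; rewrite /primitive (@eq_Rintegral _ _ _ leb _ (cst 0)); last first.
  by move=> t /[!inE]/= /[!in_itv]/= tx; rewrite f0// (le_trans tx).
by rewrite Rintegral_cst// mul0r.
Qed.

Lemma primitiveB f x y : leb_integrable f -> x <= y ->
  primitive f y - primitive f x = \int[leb]_(t in `]x, y]) f t.
Proof.
move=> fi xy; rewrite /primitive Rintegral_itvB//.
- by apply: (integrable_subset _ _ _ fi).
Qed.

Lemma primitive_homo f : leb_integrable f ->
  (forall t, 0 <= f t) -> {homo primitive f : x y / x <= y}.
Proof.
by move=> fi f0 x y xy; rewrite -subr_ge0 primitiveB// Rintegral_ge0.
Qed.

Lemma primitive_ge0 f x : (forall t, 0 <= f t) -> 0 <= primitive f x.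
Proof. by move=> f0; rewrite Rintegral_ge0. Qed.

Lemma ge0_subset_Rintegral f (A B : set R) : measurable A -> measurable B ->
  A `<=` B -> leb.-integrable B (EFin \o f) -> (forall t, B t -> 0 <= f t) ->
  \int[leb]_(t in A) f t <= \int[leb]_(t in B) f t.
Proof.
move=> mA mB AB fi f0; rewrite /Rintegral fine_le//.
- apply: integrable_fin_num => //; exact: (integrable_subset _ _ AB fi).
- exact: integrable_fin_num.
- apply: ge0_subset_integral => //; exact: (measurable_int leb).
Qed.

Lemma primitive_le f x : leb_integrable f ->
  (forall t, 0 <= f t) -> primitive f x <= \int[leb]_t f t.
Proof. by move=> fi f0; apply: ge0_subset_Rintegral. Qed.

Lemma ae_primitive_cvg f : leb_integrable f ->
  {ae leb, forall x, derivable (primitive f) x 1 /\ derive1 (primitive f) x = f x}.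
Proof.
move=> fi; apply: FTC1Ny.
  by move=> y; apply: (integrable_subset _ _ _ fi).
by apply: open_integrable_locally fi; exact: openT.
Qed.

Let h (n : nat) : R := n.+1%:R^-1.

Let h_gt0 n : 0 < h n. Proof. by rewrite invr_gt0. Qed.

Let cvg_h : h n @[n --> \oo] --> (0 : R).
Proof. exact: cvg_harmonic. Qed.

Lemma derivable_left_quotient (F : R -> R) x : derivable F x 1 ->
  (F x - F (x - h n)) / h n @[n --> \oo] --> derive1 F x.
Proof.
move=> dF; have : (fun e => e^-1 *: (F (e + x) - F x)) e @[e --> 0^'] --> derive1 F x.
  have := dF; rewrite /derivable derive1E /derive => /cvg_ex[l] hl.
  rewrite (cvg_lim _ hl)//; move: hl; apply: cvg_trans; apply: near_eq_cvg.
  by apply: nearW => e /=; rewrite /GRing.scale/= mulr1.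
move=> /cvg_dnbhs_at_left /cvg_at_leftP /(_ (fun n => - h n)) H.
have -> : (fun n => (F x - F (x - h n)) / h n) =
    (fun n => (- h n)^-1 *: (F (- h n + x) - F x)).
  apply/funext => n; rewrite /GRing.scale/= invrN mulNr -mulrN opprB mulrC.
  by rewrite (addrC (- h n)).
apply: H; split; first by move=> n; rewrite oppr_lt0.
by rewrite -oppr0; exact: cvgN.
Qed.

(* [phi] is the square of the norm; the right-hand side collects the Steklov
   averages of a step function paired with it. *)
Lemma steklov_limit (I : finType) (A : I -> set R) (c : I -> R -> R)
    (phi alpha beta : R -> R) (tau T : R) :
  0 < tau < T ->
  (forall i, measurable (A i)) -> (forall i, A i `<=` `]0, T[) ->
  (forall i, leb_integrable (c i)) ->
  leb_integrable phi ->
  leb_integrable alpha -> (forall t, 0 <= alpha t) ->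
  (forall t, t <= 0 -> alpha t = 0) ->
  leb_integrable beta -> (forall t, 0 <= beta t) ->
  derivable (primitive phi) tau 1 -> derive1 (primitive phi) tau = phi tau ->
  (forall n, {ae leb, forall t, t < T ->
    phi t - phi (t - h n) <=
    \sum_i c i t * (primitive \1_(A i) t - primitive \1_(A i) (t - h n))
    + (primitive alpha t - primitive alpha (t - h n)) + h n * beta t}) ->
  phi tau <= \int[leb]_(t in `]-oo, tau]) (\sum_i c i t * \1_(A i) t)
    + \int[leb]_t alpha t + \int[leb]_t beta t.
Proof.
move=> /andP[tau0 tauT] mA A0T ci phii ai a0 a00 bi b0 dphi dphiE H.
have T0 : 0 < T by exact: lt_trans tauT.
pose D : set R := `]-oo, tau]%classic.
have mD : measurable D by exact: measurable_itv.
have iD f : leb_integrable f -> leb.-integrable D (EFin \o f).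
  by move=> fi; apply: (integrable_subset _ _ _ fi).
have mi f : leb_integrable f -> measurable_fun setT f.
  by move=> fi; apply/measurable_EFinP; exact: measurable_int fi.
have iA i := integrable_indic_subset (mA i) (@A0T i).
pose F i := primitive (\1_(A i) : R -> R).
have F_homo i : {homo F i : x y / x <= y} by apply: primitive_homo => // t; rewrite indicE.
have mF i : measurable_fun setT (F i) by apply: nondecreasing_measurable.
(* The quotients of [F i] are thus at most 1, and the sum of the [|c i|] dominates in the final
   passage to the limit. *)
have dF i (t : R) n : `|F i t - F i (t - h n)| <= h n.
  have tt : t - h n <= t by rewrite gerBl ltW.
  rewrite primitiveB// ger0_norm; last first.
    by apply: Rintegral_ge0 => x _; rewrite indicE.
  apply: (@le_trans _ _ (\int[leb]_(x in `](t - h n), t]) 1)).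
    apply: le_Rintegral => //.
    - by apply: (integrable_subset _ _ _ (iA i)).
    - exact: integrable_cst_itv.
  by rewrite Rintegral_cst_itv// mul1r opprB addrC subrK.
have shiftm (f : R -> R) n : measurable_fun setT f -> measurable_fun setT (fun t : R => f (t - h n)).
  by move=> mf; apply: (measurableT_comp mf); exact: measurable_funB.
(* Integrating a backward difference up to [tau] leaves only the integral of [f] over the last
   layer, of length [h n]. Divided by [h n], it tends to [phi tau] for [phi], and for the primitive
   of [alpha] it is at most the whole integral of [alpha]. *)
have shiftP f n : leb_integrable f ->
  leb.-integrable D (EFin \o (fun t : R => f t - f (t - h n))) /\
  \int[leb]_(t in D) (f t - f (t - h n)) = primitive f tau - primitive f (tau - h n).
  move=> fi; pose D' : set R := `]-oo, (tau - h n)]%classic.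
  have mD' : measurable D' by exact: measurable_itv.
  have [|i1 E1] := integral_shift (- h n) mD' (mi _ fi).
    by apply: (integrable_subset _ _ _ fi).
  have DE : [set t | D' (t + - h n)] = D.
    by apply/seteqP; split => x; rewrite /D /D' /= !in_itv/= lerD2r.
  rewrite DE in i1, E1.
  have {}i1 : leb.-integrable D (EFin \o (fun t : R => f (t - h n))) by exact: i1.
  split; first exact: (integrable_sub mD (iD _ fi) i1).
  by rewrite RintegralB//; [rewrite E1|exact: iD].
pose ia := \int[leb]_t alpha t.
have ia0 : 0 <= ia by rewrite Rintegral_ge0.
(* The primitive of [alpha] tends to the total mass of [alpha] and need not be integrable at
   infinity; cut off after [T] it is, and up to [tau < T] nothing changes. *)
pose Fa t := if t <= T then primitive alpha t else 0.
have Fa_ge0 t : 0 <= Fa t by rewrite /Fa; case: ifP => // _; exact: primitive_ge0.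
have Fa_le t : Fa t <= ia by rewrite /Fa; case: ifP => // _; exact: primitive_le.
have iFa : leb_integrable Fa.
  apply: (@integrable_dominated _ _ _ leb setT _ (fun t => ia * \1_`[0, T] t)) => //.
  - apply: measurable_fun_if => //.
    + by apply: measurable_fun_ler.
    + by apply: measurable_funTS; apply: nondecreasing_measurable => //; exact: primitive_homo.
  - exact: (integrable_scale ia _ (@integrable_indic_itv R 0 T true false)).
  - move=> t _; rewrite ger0_norm// indicE; case: (boolP (t \in _)) => [_|]; first by rewrite mulr1.
    rewrite notin_setE/= in_itv/= => /negP; rewrite negb_and -!ltNge mulr0 /Fa => h'.
    by case: ifP => // tT; rewrite primitive_eq0//; case/orP: h' => [/ltW//|]; rewrite ltNge tT.
have FaE t : t < T -> primitive alpha t = Fa t by move=> tT; rewrite /Fa ltW.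
pose G n t := \sum_i c i t * (F i t - F i (t - h n)).
have iG n : leb_integrable (G n).
  apply: (@integrable_dominated _ _ _ leb setT _ (fun t => \sum_i h n * `|c i t|)) => //.
  - apply: measurable_sum => i; apply: measurable_funM; first exact: mi.
    by apply: measurable_funB; [exact: mF|exact: (shiftm _ n (mF i))].
  - apply: integrable_bigsum => // i; apply: integrable_scale => //.
    exact: (integrable_norm (ci i)).
  - move=> t _; rewrite (le_trans (ler_norm_sum _ _ _))// ler_sum// => i _.
    by rewrite normrM mulrC ler_wpM2r.
have quot n : (primitive phi tau - primitive phi (tau - h n)) / h n <=
    \int[leb]_(t in D) (\sum_i c i t * ((F i t - F i (t - h n)) / h n)) + ia + \int[leb]_t beta t.
  have [p1 p2] := shiftP phi n phii; have [q1 q2] := shiftP Fa n iFa.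
  rewrite ler_pdivrMr// -p2.
  have iB : leb.-integrable D (EFin \o (fun t => h n * beta t)).
    exact: (integrable_scale _ mD (iD _ bi)).
  have iGP : leb.-integrable D (EFin \o (fun t => G n t + (Fa t - Fa (t - h n)))).
    exact: (integrable_add mD (iD _ (iG n)) q1).
  have iGPB : leb.-integrable D (EFin \o (fun t => G n t + (Fa t - Fa (t - h n)) + h n * beta t)).
    exact: (integrable_add mD iGP iB).
  apply: (@le_trans _ _ (\int[leb]_(t in D) (G n t + (Fa t - Fa (t - h n)) + h n * beta t))).
    apply: ae_le_Rintegral => //; apply: aeS (H n) => t Ht.
    rewrite /D/= in_itv/= => ttau; have tT := le_lt_trans ttau tauT.
    by move: (Ht tT); rewrite !FaE// (le_lt_trans _ tT)// gerBl ltW.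
  rewrite RintegralD// RintegralD//; last exact: iD.
  rewrite q2 RintegralZl//; last exact: iD.
  rewrite mulrDl mulrDl; apply: lerD; first apply: lerD.
  - rewrite -RintegralZr//; last first.
      have -> : (fun t => \sum_i c i t * ((F i t - F i (t - h n)) / h n)) = (fun t => (h n)^-1 * G n t).
        by apply/funext => t; rewrite /G mulr_sumr; apply: eq_bigr => i _; rewrite mulrA mulrC.
      exact: (integrable_scale _ mD (iD _ (iG n))).
    rewrite le_eqVlt; apply/orP; left; apply/eqP; apply: eq_Rintegral => t _.
    by rewrite /G mulr_suml; apply: eq_bigr => i _; rewrite mulrA mulfVK// gt_eqF.
  - have tt : tau - h n <= tau by rewrite gerBl ltW.
    rewrite primitiveB//; apply: (@le_trans _ _ (\int[leb]_(x in `](tau - h n), tau]) ia)).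
      apply: le_Rintegral => //; last exact: integrable_cst_itv.
      by apply: (integrable_subset _ _ _ iFa).
    by rewrite Rintegral_cst_itv// opprB addrC subrK.
  - rewrite mulrC ler_wpM2r//; [exact: ltW|exact: ge0_subset_Rintegral].
rewrite -dphiE.
have cG : \int[leb]_(t in D) (\sum_i c i t * ((F i t - F i (t - h n)) / h n)) @[n --> \oo] -->
   \int[leb]_(t in D) (\sum_i c i t * \1_(A i) t).
  apply: (@ae_dominated_Rcvg _ _ _ leb D (fun n t => \sum_i c i t * ((F i t - F i (t - h n)) / h n)) _
     (fun t => \sum_i `|c i t|) _ _ _ _ _ _).2 => //.
  - move=> n; apply: measurable_funTS; apply: measurable_sum => i; apply: measurable_funM; first exact: mi.
    apply: measurable_funM => //; apply: measurable_funB; [exact: mF|exact: (shiftm _ n (mF i))].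
  - apply: measurable_funTS; apply: measurable_sum => i; apply: measurable_funM; first exact: mi.
    by apply: measurable_indic; exact: mA.
  - have : {ae leb, forall x, forall i, derivable (F i) x 1 /\ derive1 (F i) x = \1_(A i) x}.
      apply: ae_countable => i; exact: ae_primitive_cvg.
    apply: aeS => t Ht _; apply: cvg_bigsum => i; apply: cvgM; first exact: cvg_cst.
    have [dFi <-] := Ht i; exact: derivable_left_quotient.
  - by apply: integrable_bigsum => // i; exact: (integrable_norm (iD _ (ci i))).
  - move=> n t _; rewrite (le_trans (ler_norm_sum _ _ _))// ler_sum// => i _.
    rewrite normrM ler_piMr// normrM normfV (gtr0_norm (h_gt0 n)).
    by rewrite ler_pdivrMr// mul1r.
apply: ler_cvg_to (derivable_left_quotient dphi) _ _; last exact: nearW quot.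
by apply: cvgD; [apply: cvgD => //; exact: cvg_cst|exact: cvg_cst].
Qed.

End steklov.

Section gronwall.
Context {R : realType}.
Notation leb := (@lebesgue_measure R).

(** An absorption argument replaces the exponential: if [Y a = 0] and [K * (b - a) < 1],
    monotonicity of the primitive [Y] gives [Y b <= K * (b - a) * Y b], hence [Y b = 0]. Finitely
    many steps of equal length reach [T]. *)
Lemma gronwall_ae (T K : R) (phi : R -> R) : 0 < T -> 0 <= K ->
  leb_integrable phi -> (forall t, 0 <= phi t) ->
  (forall t, t <= 0 -> phi t = 0) ->
  {ae leb, forall t, t \in `]0, T[ -> phi t <= K * primitive phi t} ->
  {ae leb, forall t, t \in `]0, T[ -> phi t = 0}.
Proof.
move=> T0 K0 phii phi0 phi00 H; pose Y := primitive phi.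
have Y0 t : 0 <= Y t by exact: primitive_ge0.
have Yh : {homo Y : x y / x <= y} by exact: primitive_homo.
have step (a b : R) : 0 <= a -> a <= b -> b <= T -> K * (b - a) < 1 -> Y a = 0 -> Y b = 0.
  move=> a0 ab bT Kab Ya; apply/eqP; rewrite eq_le Y0 andbT.
  have Yb : Y b <= K * Y b * (b - a).
    rewrite -[leLHS]subr0 -Ya primitiveB// -Rintegral_itv_bndo_bndc; last first.
      by apply: (integrable_subset _ _ _ phii).
    rewrite -(Rintegral_cst_itv _ false true)//.
    apply: ae_le_Rintegral => //.
    - by apply: (integrable_subset _ _ _ phii).
    - exact: integrable_cst_itv.
    - apply: aeS H => t Ht /=; rewrite in_itv/= => /andP[at_ tb].
      apply: le_trans (Ht _) _; first by rewrite in_itv/= (le_lt_trans a0)//= (lt_le_trans tb).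
      by rewrite ler_wpM2l// Yh// ltW.
  rewrite leNgt; apply/negP => Ybp.
  by move: Yb; rewrite mulrAC ler_pMl// leNgt Kab.
have [N KN] : exists N : nat, K * T < N.+1%:R.
  by exists (Num.bound (K * T)); rewrite (lt_trans (archi_boundP _)) ?ltr_nat// mulr_ge0// ltW.
have YT : forall k : nat, (k <= N.+1)%N -> Y (k%:R * (T / N.+1%:R)) = 0.
  elim=> [_|k IH kN]; first by rewrite mul0r; exact: primitive_eq0.
  have d0 : 0 < T / N.+1%:R by rewrite divr_gt0.
  apply: (step (k%:R * (T / N.+1%:R))); last exact/IH/ltnW.
  - by rewrite mulr_ge0// ltW.
  - by rewrite ler_wpM2r ?(ltW d0)// ler_nat.
  - rewrite mulrCA -ler_pdivlMl// mulVf ?gt_eqF// ler_pdivrMr// mul1r ler_nat//.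
  - by rewrite -mulrBl -natrB// subSnn mul1r mulrA ltr_pdivrMr// mul1r.
have {}YT : Y T = 0 by rewrite -(YT N.+1)// mulrC divfK.
apply: aeS H => t Ht tT; apply/eqP; rewrite eq_le phi0 andbT.
rewrite (le_trans (Ht tT))// (_ : primitive phi t = 0) ?mulr0//.
apply/eqP; rewrite eq_le Y0 andbT -YT Yh//.
by move: tT; rewrite in_itv/= => /andP[_ /ltW].
Qed.

End gronwall.

(** * Lebesgue measure and test functions on R^d *)

Section boxes.
Context {R : realType} {d : nat}.
Notation mu := (lebesgue_rV R d).
Implicit Types (A : set 'rV[R]_d) (l u : 'I_d -> R).

Definition obox l u : set 'rV[R]_d := [set x | forall i, l i < x ord0 i < u i].
Definition cbox l u : set 'rV[R]_d := [set x | forall i, l i <= x ord0 i <= u i].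

Lemma measurable_coord_box (B : 'I_d -> set R) : (forall i, measurable (B i)) ->
  measurable [set x : 'rV[R]_d | forall i, B i (x ord0 i)].
Proof.
move=> mB; rewrite (_ : [set x | _] = \bigcap_(i : 'I_d) [set x : 'rV[R]_d | B i (x ord0 i)]).
  apply: fin_bigcap_measurable => // i _.
  by rewrite -[X in measurable X]setTI; exact: measurable_coord.
by apply/seteqP; split => x /= H i // *; exact: H.
Qed.

Lemma measurable_obox l u : measurable (obox l u).
Proof.
rewrite (_ : obox l u = [set x : 'rV[R]_d | forall i, (`]l i, u i[%classic : set R) (x ord0 i)]).
  by apply: (@measurable_coord_box (fun i => `]l i, u i[%classic)) => i; exact: measurable_itv.
by apply/seteqP; split => x /= H i; have := H i; rewrite in_itv.
Qed.

Lemma obox_sub_cbox l u : obox l u `<=` cbox l u.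
Proof. by move=> x /= H i; have /andP[h1 h2] := H i; rewrite !ltW. Qed.

Lemma compact_cbox l u : compact (cbox l u).
Proof.
rewrite (_ : cbox l u = [set x : 'rV[R]_d | forall i, (`[l i, u i]%classic : set R) (x ord0 i)]).
  by apply: (@rV_compact R d (fun i => `[l i, u i]%classic)) => i; exact: segment_compact.
by apply/seteqP; split => x /= H i; have := H i; rewrite in_itv.
Qed.

Let ratb (l : {ffun 'I_d -> rat}) i : R := ratr (l i).

(** Rational corners make the boxes countable, which yields measurability of open sets and localizes
    statements that hold almost everywhere. The closed box is kept inside [A] so that [box_fun] is a
    test function of [A]. *)
Lemma open_rat_box A x : open A -> A x ->
  exists l u : {ffun 'I_d -> rat}, obox (ratb l) (ratb u) x /\
    cbox (ratb l) (ratb u) `<=` A.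
Proof.
rewrite openE => /[apply] /nbhs_ballP[e /= e0 eA].
have H i : exists q : rat * rat, (x ord0 i - e < ratr q.1 < x ord0 i) /\ (x ord0 i < ratr q.2 < x ord0 i + e).
  have [|q1] := @rat_in_itvoo R (x ord0 i - e) (x ord0 i); first by rewrite gtrBl.
  have [|q2] := @rat_in_itvoo R (x ord0 i) (x ord0 i + e); first by rewrite ltrDl.
  by rewrite !in_itv/= => h2 h1; exists (q1, q2).
have [q Hq] := choice H.
exists [ffun i => (q i).1], [ffun i => (q i).2]; split.
  by move=> i; rewrite /ratb !ffunE; have [/andP[_ ->] /andP[-> _]] := Hq i.
move=> y yb; apply: eA; split => // i j; rewrite (ord1 i).
have := yb j; rewrite /ratb !ffunE => /andP[y1 y2].
have [/andP[a1 a2] /andP[b1 b2]] := Hq j.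
rewrite /ball/= ltr_distlC (lt_le_trans a1 y1)/=; exact: le_lt_trans b2.
Qed.

Lemma open_bigcup_obox A : open A -> A = \bigcup_n
  (if unpickle n is Some (l, u) then
     if `[< cbox (ratb l) (ratb u) `<=` A >] then obox (ratb l) (ratb u) else set0
   else set0).
Proof.
move=> oA; apply/seteqP; split => x.
  move=> Ax; have [l [u [xlu luA]]] := open_rat_box oA Ax.
  by exists (pickle (l, u)) => //; rewrite pickleK/= asboolT.
move=> [n _]; case: unpickle => [[l u]|//]; case: asboolP => // luA /obox_sub_cbox.
exact: luA.
Qed.

Lemma open_measurable_rV A : open A -> measurable A.
Proof.
move=> oA; rewrite (open_bigcup_obox oA); apply: bigcupT_measurable => n.
by case: unpickle => [[l u]|//]; case: ifP => // _; exact: measurable_obox.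
Qed.

Lemma continuous_measurable_rV (f : 'rV[R]_d -> R) : continuous f ->
  measurable_fun setT f.
Proof.
move=> /continuousP cf.
apply: (measurability _ (RGenOInfty.measurableE R)) => // _ [_ [x ->] <-].
by rewrite setTI; apply: open_measurable_rV; apply: cf; exact: interval_open.
Qed.

Lemma ae_open A (P : 'rV[R]_d -> Prop) : open A ->
  (forall l u, cbox l u `<=` A -> {ae mu, forall x, obox l u x -> P x}) ->
  {ae mu, forall x, A x -> P x}.
Proof.
move=> oA H.
have /(_ mu) := @ae_countable _ _ R _ ({ffun 'I_d -> rat} * {ffun 'I_d -> rat})%type
  (fun lu x => cbox (ratb lu.1) (ratb lu.2) `<=` A -> obox (ratb lu.1) (ratb lu.2) x -> P x).
move=> /(_ _)/wrap[].
  move=> [l u] /=; have [luA|luA] := pselect (cbox (ratb l) (ratb u) `<=` A).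
    by apply: aeS (H _ _ luA) => x + _.
  by apply: aeW.
apply: aeS => x Hx Ax; have [l [u [xlu luA]]] := open_rat_box oA Ax.
exact: (Hx (l, u)).
Qed.

Lemma norm_coord_le (x : 'rV[R]_d) i : `|x ord0 i| <= `|x|.
Proof.
rewrite [leRHS]/Num.norm/= mx_normrE.
by apply: (le_bigmax _ (fun ij => `|x ij.1 ij.2|) (ord0, i)).
Qed.

Lemma bounded_set_lty A : bounded_set A -> measurable A -> (mu A < +oo)%E.
Proof.
move=> [M [_ HM]] mA.
pose B (i : 'I_d) : set R := `[- (`|M| + 1), `|M| + 1]%classic.
have AB : A `<=` [set x | forall i, B i (x ord0 i)].
  move=> x Ax i; rewrite /B /= in_itv/= -ler_norml (le_trans (norm_coord_le _ _))//.
  by apply: HM => //; rewrite (le_lt_trans (ler_norm _))// ltrDl.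
have mB i : measurable (B i) by exact: measurable_itv.
apply: (@le_lt_trans _ _ (mu [set x | forall i, B i (x ord0 i)])).
  by apply: le_measure => //; rewrite inE//; exact: measurable_coord_box.
rewrite lebesgue_rV_box//.
have Bfin i : lebesgue_measure (B i) \is a fin_num.
  rewrite /B lebesgue_measure_itv/=; case: ifP => // _; by rewrite -EFinN -EFinD.
have -> : (\prod_(i < d) lebesgue_measure (B i))%E = (\prod_(i < d) fine (lebesgue_measure (B i)))%:E.
  elim/big_ind2 : _ => // [x1 x2 y1 y2 -> ->|i _]; first by rewrite EFinM.
  by rewrite fineK.
exact: ltry.
Qed.

Lemma closed_measurable_rV A : closed A -> measurable A.
Proof.
by move=> cA; rewrite -(setCK A); apply: measurableC; apply: open_measurable_rV; exact: closed_openC.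
Qed.

Lemma compact_measurable_rV A : compact A -> measurable A.
Proof.
by move=> cA; apply: closed_measurable_rV; exact: compact_closed.
Qed.

Lemma compact_lty A : compact A -> (mu A < +oo)%E.
Proof.
move=> cA; apply: bounded_set_lty; first exact: compact_bounded.
exact: compact_measurable_rV.
Qed.

Lemma cbox_lty l u : (mu (cbox l u) < +oo)%E.
Proof. exact/compact_lty/compact_cbox. Qed.

Lemma integrable_indic_compact A : compact A -> mu.-integrable setT (EFin \o (\1_A : 'rV[R]_d -> R)).
Proof.
move=> cA; have mA := compact_measurable_rV cA.
apply/integrableP; split; first exact/measurable_EFinP/measurable_indic.
rewrite (eq_integral (fun x => (\1_A x)%:E)); last first.
  by move=> x _; rewrite /= ger0_norm// indicE.
by rewrite integral_indic// setIT compact_lty.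
Qed.

End boxes.

(** * Functions whose integrals over boxes vanish *)

Section pi_lambda.
Context {R : realType} {d : nat}.
Notation mu := (lebesgue_rV R d).

Definition ray (c : 'I_d -> R) : set 'rV[R]_d := [set x | forall i, x ord0 i < c i].
Definition rays : set (set 'rV[R]_d) := range ray.

Lemma rays_setI : setI_closed rays.
Proof.
move=> _ _ [a _ <-] [b _ <-]; exists (fun i => Num.min (a i) (b i)) => //.
apply/seteqP; split => x /=.
  by move=> H; split => i; have := H i; rewrite lt_min => /andP[].
by move=> [Ha Hb] i; rewrite lt_min Ha Hb.
Qed.

Lemma measurable_rays : (@measurable _ 'rV[R]_d) `<=` <<s rays >>.
Proof.
apply: smallest_sub; first exact: smallest_sigma_algebra.
rewrite -bigcup_seq => A [i /= _] [B mB <-].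
have mi : measurable_fun [set: g_sigma_algebraType rays] (fun x : 'rV[R]_d => x ord0 i : R).
  apply: (measurability _ (RGenInftyO.measurableE R)) => // _ [_ [c ->] <-].
  (* A half-space bounds one coordinate only; it is the union of the rays whose other bounds are the
     integers [n]. *)
  rewrite setTI (_ : _ @^-1` _ =
    \bigcup_n ray (fun j => if j == i then c else n%:R)); last first.
    apply/seteqP; split => x /=.
      rewrite in_itv/= => xc.
      exists (\max_(j < d) Num.bound `|x ord0 j|)%N => // j; case: eqVneq => [->//|_].
      apply: (le_lt_trans (ler_norm _)); apply: (lt_le_trans (archi_boundP _)) => //.
      by rewrite ler_nat; exact: (leq_bigmax (F := fun j => Num.bound `|x ord0 j|)).
    by move=> [n _ /(_ i)]; rewrite eqxx in_itv.
  apply: bigcupT_measurable => n; apply: sub_sigma_algebra.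
  by exists (fun j => if j == i then c else n%:R).
by have := mi measurableT B mB; rewrite setTI.
Qed.

(** The rays form a pi-system that generates the sigma-algebra, and the sets over which [G]
    integrates to 0 inside the box form a Dynkin system. A ray cuts the box in a box with the same
    lower corner, so only the upper corner has to vary. *)
Lemma integral_oboxes_eq0 (G : 'rV[R]_d -> R) (l u : 'I_d -> R) :
  mu.-integrable (obox l u) (EFin \o G) ->
  (forall u', obox l u' `<=` obox l u -> (\int[mu]_(x in obox l u') (G x)%:E = 0)%E) ->
  {ae mu, forall x, obox l u x -> G x = 0}.
Proof.
move=> iG H; pose Q := obox l u.
have mQ : measurable Q by exact: measurable_obox.
pose D : set (set 'rV[R]_d) := [set A | measurable A /\ (\int[mu]_(x in A `&` Q) (G x)%:E = 0)%E].
have iGS A : measurable A -> A `<=` Q -> mu.-integrable A (EFin \o G).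
  by move=> mA AQ; exact: integrableS iG.
have mG : measurable_fun Q (EFin \o G) by exact: (measurable_int mu).
have dD : dynkin D.
  split.
  - by split => //; rewrite setTI H.
  - move=> A [mA A0]; split; first exact: measurableC.
    have : (\int[mu]_(x in Q) (G x)%:E = 0)%E by rewrite H.
    have QE : A `&` Q `|` ~` A `&` Q = Q by rewrite -setIUl setUv setTI.
    rewrite -[in X in X -> _]QE.
    rewrite integral_setU//.
    + by rewrite A0 add0e.
    + exact: measurableI.
    + by apply: measurableI => //; exact: measurableC.
    + by rewrite QE.
    + by apply/disj_setPS => x [[Ax _] [nAx _]].
  - move=> F tF DF; have mF n : measurable (F n) by have [] := DF n.
    split; first exact: bigcupT_measurable.
    rewrite setI_bigcupl integral_bigcup//.
    + by rewrite eseries0// => n _ _; have [] := DF n.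
    + by apply: trivIset_setIr.
    + by move=> n; exact: measurableI.
    + apply: iGS; first by apply: bigcupT_measurable => n; exact: measurableI.
      by move=> x [n _ []].
have sub : <<s rays >> `<=` D.
  apply: (lambda_system_subset rays_setI ((dynkin_lambda_system D).1 dD)) => //.
  move=> _ [c _ <-]; split.
    rewrite (_ : ray c = [set x : 'rV[R]_d | forall i, (`]-oo, c i[%classic : set R) (x ord0 i)]).
      by apply: (@measurable_coord_box _ _ (fun i => `]-oo, c i[%classic)) => i; exact: measurable_itv.
    by apply/seteqP; split => x /= Hx i; have := Hx i; rewrite in_itv.
  have E : ray c `&` Q = obox l (fun i => Num.min (c i) (u i)).
    apply/seteqP; split => x /=.
      by move=> [xc xQ] i; have := xQ i; rewrite lt_min xc.
    move=> xm; split => i; have := xm i; rewrite lt_min => /andP[h1 /andP[h2 h3]] //.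
    by rewrite h1.
  by rewrite E H// -E; exact: subIsetr.
have := @integral_ae_eq _ _ _ mu Q mQ (cst 0) (EFin \o G) iG (measurable_cst _).
move=> /(_ _)/wrap[].
  move=> E EQ mE; rewrite integral0 -(setIidl EQ).
  by have [_] := sub _ (measurable_rays mE).
by apply: aeS => x /= h Qx; have := h Qx => -[].
Qed.

End pi_lambda.

(** * Test functions of product form *)

Section test_functions.
Context {R : realType} {d : nat}.
Notation mu := (lebesgue_rV R d).
Implicit Types (A : set 'rV[R]_d) (l u : 'I_d -> R) (g : 'I_d -> R -> R).

Definition tensor g (x : 'rV[R]_d) : R := \prod_(i < d) g i (x ord0 i).

Lemma is_derive_tensor g i (x : 'rV[R]_d) : (forall j, smooth (g j)) ->
  is_derive x (delta_mx ord0 i : 'rV[R]_d) (tensor g)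
    (tensor (fun j => if j == i then derive1 (g i) else g j) x).
Proof.
move=> sg; pose C := \prod_(j < d | j != i) g j (x ord0 j).
have E (h : R) : tensor g (h *: delta_mx ord0 i + x) = g i (h + x ord0 i) * C.
  rewrite /tensor (bigD1 i)//= !mxE !eqxx/= mulr1; congr (_ * _).
  by apply: eq_bigr => j ji; rewrite !mxE eqxx (negbTE ji) mulr0 add0r.
have Ex : tensor g x = g i (x ord0 i) * C by rewrite /tensor (bigD1 i).
have E' : tensor (fun j => if j == i then derive1 (g i) else g j) x = derive1 (g i) (x ord0 i) * C.
  rewrite /tensor (bigD1 i)//= eqxx; congr (_ * _).
  by apply: eq_bigr => j /negbTE ->.
have [dg gE] := smooth_derivable (sg i) (x ord0 i).
have cv : h^-1 *: ((tensor g \o shift x) (h *: (delta_mx ord0 i : 'rV[R]_d)) - tensor g x)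
    @[h --> 0^'] --> derive1 (g i) (x ord0 i) * C.
  have -> : (fun h : R => h^-1 *: ((tensor g \o shift x) (h *: (delta_mx ord0 i : 'rV[R]_d)) - tensor g x)) =
      (fun h : R => h^-1 *: ((g i \o shift (x ord0 i)) (h *: 1) - g i (x ord0 i)) * C).
    apply/funext => h /=; rewrite E Ex -mulrBl /GRing.scale/= mulr1.
    by rewrite mulrA.
  apply: cvgM; last exact: cvg_cst.
  by rewrite -gE /derive; apply/cvg_ex; move: dg => /cvg_ex.
apply: DeriveDef; first by apply/cvg_ex; eexists; exact: cv.
by rewrite E'; exact: cvg_lim cv.
Qed.

Lemma continuous_tensor g : (forall j, continuous (g j)) -> continuous (tensor g).
Proof.
move=> cg x; rewrite /tensor.
apply: cvg_big => [||i _]; [exact: mul_continuous|exact: nbhs_filter|].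
by apply: continuous_comp; [exact: coord_continuous|exact: cg].
Qed.

(** A partial derivative of a product of one-variable functions is again such a product, with one
    factor differentiated; hence the induction over all [g]. *)
Lemma Ck_tensor k g : (forall j, smooth (g j)) -> Ck k (tensor g).
Proof.
elim: k g => [|k IH] g sg; first by apply: continuous_tensor => j; exact: smooth_continuous.
split.
- by apply: continuous_tensor => j; exact: smooth_continuous.
- by move=> i x; have [] := is_derive_tensor i x sg.
- move=> i; rewrite (_ : partial i _ = tensor (fun j => if j == i then derive1 (g i) else g j)).
    by apply: IH => j; case: eqP => // _; exact: smooth_derive.
  by apply/funext => x; have [_] := is_derive_tensor i x sg.
Qed.

Definition box_fun l u n := tensor (fun i => cutoff (l i) (u i) n).

Lemma test_fun_box A l u n : cbox l u `<=` A -> test_fun A (box_fun l u n).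
Proof.
move=> luA; split; first by move=> k; apply: Ck_tensor => j; exact: smooth_cutoff.
exists (cbox l u); split => //; first exact: compact_cbox.
move=> x /existsNP[i xi]; rewrite /box_fun /tensor (bigD1 i)//= cutoff_eq0 ?mul0r//.
by apply/negP => /andP[a b]; apply: xi; rewrite !ltW.
Qed.

Lemma cvg_box_fun l u (x : 'rV[R]_d) :
  box_fun l u n x @[n --> \oo] --> (\1_(obox l u) x : R).
Proof.
have -> : \1_(obox l u) x = \prod_(i < d) (l i < x ord0 i < u i)%R%:R :> R.
  rewrite indicE; have [/set_mem xlu|] := boolP (x \in _).
    by rewrite big1// => i _; rewrite xlu.
  rewrite notin_setE => /existsNP[i /negP xi].
  by rewrite (bigD1 i)//= (negbTE xi) mul0r.
rewrite /box_fun /tensor; apply: cvg_big => [|i _]; first exact: mul_continuous.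
exact: cvg_cutoff.
Qed.

Lemma box_fun_norm_le1 l u n (x : 'rV[R]_d) : `|box_fun l u n x| <= 1.
Proof.
rewrite /box_fun /tensor; elim/big_ind : _ => [|a b ha hb|i _]; first by rewrite normr1.
  by rewrite normrM -[leRHS]mulr1 ler_pM.
by rewrite ger0_norm ?cutoff_ge0// cutoff_le1.
Qed.

Lemma test_fun_continuous A phi : test_fun A phi -> continuous phi.
Proof. by move=> [/(_ 0%N)]. Qed.

Lemma test_fun_partial A phi i : test_fun A phi -> test_fun A (partial i phi).
Proof.
move=> [Cphi [K [cK KA K0]]]; split; first by move=> k; have [_ _ /(_ i)] := Cphi k.+1.
exists K; split => // x Kx.
have oK : open (~` K) by apply: closed_openC; apply: compact_closed => //; exact: norm_hausdorff.
rewrite /partial (@near_eq_derive _ _ _ _ (cst 0)) ?derive_cst//.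
move: oK; rewrite openE => /(_ x Kx); rewrite /interior => h.
by near=> y; apply: K0; near: y.
Unshelve. all: by end_near. Qed.

Lemma test_fun_bounded A phi : test_fun A phi -> exists M, forall x, `|phi x| <= M.
Proof.
move=> tphi; have cphi := test_fun_continuous tphi.
have [_ [K [cK KA K0]]] := tphi.
have [M [_ HM]] := compact_bounded (continuous_compact (continuous_subspaceT cphi) cK).
exists (`|M| + 1) => x; have [Kx|Kx] := pselect (K x); last by rewrite K0// normr0 addr_ge0.
by apply: HM; [rewrite (le_lt_trans (ler_norm _))// ltrDl|exists x].
Qed.

End test_functions.

Section lemma_du_bois_reymond.
Context {R : realType} {d : nat}.
Notation mu := (lebesgue_rV R d).

(** The functions [box_fun] converge boundedly to indicators of boxes, so [G] integrates to 0 over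
    every box whose closure lies in [A]. *)
Lemma dotL_test_eq0 (A : set 'rV[R]_d) (G : 'rV[R]_d -> R) : open A ->
  mu.-integrable A (EFin \o G) ->
  (forall phi, test_fun A phi -> dotL A G phi = 0) ->
  {ae mu, forall x, A x -> G x = 0}.
Proof.
move=> oA iG H; have mA := open_measurable_rV oA.
have mG : measurable_fun A G by apply/measurable_EFinP; exact: (measurable_int mu).
apply: ae_open => // l u luA.
have oluA : obox l u `<=` A by apply: subset_trans luA; exact: obox_sub_cbox.
apply: integral_oboxes_eq0.
  by apply: integrableS iG => //; exact: measurable_obox.
move=> u' u'u.
have u'A : obox l u' `<=` A by exact: subset_trans u'u oluA.
have iGu' : mu.-integrable (obox l u') (EFin \o G).
  by apply: integrableS iG => //; exact: measurable_obox.
suff E : \int[mu]_(x in obox l u') G x = 0.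
  by rewrite -[LHS]fineK ?[fine _]E//; apply: integrable_fin_num => //; exact: measurable_obox.
have [[x0 x0u']|u'0] := pselect (obox l u' !=set0); last first.
  have -> : obox l u' = set0 by apply/seteqP; split => // x xu'; apply: u'0; exists x.
  by rewrite Rintegral_set0.
have cu'A : cbox l u' `<=` A.
  apply: subset_trans luA => x xlu' i; have /andP[-> xu'i] /= := xlu' i.
  rewrite (le_trans xu'i)// leNgt; apply/negP => uu'.
  (* Moving the coordinate [i] of [x0] to the midpoint of [t] and [u' i] gives a point of the small
     box that is outside [obox l u], a contradiction. Nonemptiness is what forces [u' <= u]. *)
  pose t := Num.max (x0 ord0 i) (u i).
  have /andP[h1 h2] := x0u' i.
  have : obox l u' (\row_j if j == i then (t + u' i) / 2 else x0 ord0 j).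
    move=> j; rewrite mxE; case: eqP => [->|_]; last exact: x0u'.
    have tu : t < u' i by rewrite /t gt_max h2.
    have [tm mu'] := midf_lt tu; have x0t : x0 ord0 i <= t by rewrite le_max lexx.
    by rewrite mu' andbT (lt_trans h1)// (le_lt_trans x0t).
  move=> /u'u /(_ i); rewrite mxE eqxx => /andP[_]; rewrite ltNge => /negP; apply.
  have : u i <= t by rewrite le_max lexx orbT.
  have [|tm _] := @midf_lt _ t (u' i); first by rewrite /t gt_max h2.
  by move=> /le_trans; apply; exact: ltW.
have [|||||_ cv] := @dominated_Rcvg _ _ _ mu A (fun n x => G x * box_fun l u' n x)
    (fun x => G x * \1_(obox l u') x) (fun x => `|G x|).
- exact: mA.
- move=> n; apply: measurable_funM => //; apply: measurable_funTS.
  by apply: continuous_measurable_rV; exact: test_fun_continuous (test_fun_box n cu'A).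
- by move=> x _; apply: cvgM; [exact: cvg_cst|exact: cvg_box_fun].
- exact: (integrable_norm iG).
- by move=> n x _; rewrite normrM ler_piMr// box_fun_norm_le1.
have <- : \int[mu]_(x in A) (G x * \1_(obox l u') x) = \int[mu]_(x in obox l u') G x.
  rewrite -[in RHS](setIidr u'A) Rintegral_mkcondr; apply: eq_Rintegral => t _.
  by rewrite indicE patchE; case: ifP; rewrite ?mulr1 ?mulr0.
apply: (cvg_unique _ cv); first exact: Rhausdorff.
have -> : (fun n => \int[mu]_(x in A) (G x * box_fun l u' n x)) = cst 0.
  by apply/funext => n; apply: H; exact: test_fun_box.
exact: cvg_cst.
Qed.

End lemma_du_bois_reymond.

(** * Lebesgue spaces *)

(** One interface for L^2, H_0^1, L^p, H^-1 and L^p', so that the theory of Bochner functions is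
    developed once. All clauses are relative to [X], outside of which [N] may be infinite or
    meaningless. *)
Definition seminorm_on (R : realType) (E : lmodType R) (X : set E) (N : E -> \bar R) :=
  [/\ X 0, (forall a x y, X x -> X y -> X (a *: x + y)),
      (forall x, X x -> N x \is a fin_num),
      (forall x y, X x -> X y -> (N (x + y)%R <= N x + N y)%E)
    & (forall a x, X x -> N (a *: x) = (`|a|%:E * N x)%E)].

Section seminorms.
Context {R : realType} {E : lmodType R} {X : set E} {N : E -> \bar R}.
Hypothesis XN : seminorm_on X N.
Implicit Types x y : E.

Let X0 : X 0. Proof. by have [] := XN. Qed.

Lemma seminormD x y : X x -> X y -> X (x + y).
Proof. by have [_ XL _ _ _] := XN => Xx Xy; rewrite -[x]scale1r; exact: XL. Qed.

Lemma seminormZ a x : X x -> X (a *: x).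
Proof. by have [_ XL _ _ _] := XN => Xx; rewrite -[_ *: _]addr0; exact: XL. Qed.

Lemma seminormB x y : X x -> X y -> X (x - y).
Proof. by move=> Xx Xy; apply: seminormD => //; rewrite -scaleN1r; exact: seminormZ. Qed.

Lemma seminorm_sum (I : finType) (a : I -> R) (x : I -> E) :
  (forall i, X (x i)) -> X (\sum_i a i *: x i).
Proof.
move=> Xx; elim/big_ind : _ => [//|y z|i _]; [exact: seminormD|exact: seminormZ].
Qed.

Definition rnorm x : R := fine (N x).

Lemma rnormK x : X x -> (rnorm x)%:E = N x.
Proof. by have [_ _ Xf _ _] := XN => Xx; rewrite fineK// Xf. Qed.

Lemma rnormZ a x : X x -> rnorm (a *: x) = `|a| * rnorm x.
Proof.
have [_ _ Xf _ XZ] := XN => Xx; rewrite /rnorm XZ// fineM//; exact: Xf.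
Qed.

Lemma rnormN x : X x -> rnorm (- x) = rnorm x.
Proof. by move=> Xx; rewrite -scaleN1r rnormZ// normrN1 mul1r. Qed.

Lemma rnorm0 : rnorm 0 = 0.
Proof. by rewrite -[0 in LHS](scale0r (0 : E)) rnormZ// normr0 mul0r. Qed.

Lemma rnormD x y : X x -> X y -> rnorm (x + y) <= rnorm x + rnorm y.
Proof.
have [_ _ Xf XD _] := XN => Xx Xy; rewrite -lee_fin EFinD !rnormK//; last exact: seminormD.
exact: XD.
Qed.

Lemma rnorm_ge0 x : X x -> 0 <= rnorm x.
Proof.
move=> Xx; have XNx : X (- x) by rewrite -scaleN1r; exact: seminormZ.
have := rnormD Xx XNx; rewrite subrr rnorm0 rnormN//; lra.
Qed.

Lemma rnormB x y : X x -> X y -> rnorm (x - y) <= rnorm x + rnorm y.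
Proof.
move=> Xx Xy; rewrite -(rnormN Xy); apply: rnormD => //.
by rewrite -scaleN1r; exact: seminormZ.
Qed.

Lemma rnorm_distC x y : X x -> X y -> rnorm (x - y) = rnorm (y - x).
Proof. by move=> Xx Xy; rewrite -rnormN ?opprB//; exact: seminormB. Qed.

Lemma rnorm_dist x y : X x -> X y -> `|rnorm x - rnorm y| <= rnorm (x - y).
Proof.
move=> Xx Xy; rewrite ler_norml; apply/andP; split.
  rewrite lerNl opprB lerBlDr rnorm_distC// -[X in rnorm X <= _](subrK x y).
  by apply: rnormD => //; exact: seminormB.
rewrite lerBlDr -[X in rnorm X <= _](subrK y x).
by apply: rnormD => //; exact: seminormB.
Qed.

End seminorms.
Arguments rnorm {R E} N x.

Lemma conj_exp_ge1 {R : realType} (p : R) : 1 < p -> 1 <= conj_exp p.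
Proof. by move=> p1; rewrite ler_pdivlMr ?subr_gt0// mul1r gerBl. Qed.

Section Lp_spaces.
Context {R : realType} {d : nat}.
Notation mu := (lebesgue_rV R d).
Variable Om : set 'rV[R]_d.
Hypothesis mOm : measurable Om.
Implicit Types (v w : 'rV[R]_d -> R) (r : R).

Lemma integral_norm_powR v r : r != 0 ->
  (\int[mu]_x (`|(EFin \o (v \_ Om)) x| `^ r) = \int[mu]_(x in Om) (`|v x| `^ r)%:E)%E.
Proof.
move=> r0; rewrite [RHS]integral_mkcond; apply: eq_integral => x _.
rewrite /= !patchE; case: ifP => _; rewrite ?normr0 ?poweR_EFin//.
by rewrite powR0.
Qed.

Lemma Lp_normE r v : r != 0 ->
  Lp_norm Om r%:E v = ((\int[mu]_(x in Om) (`|v x| `^ r)%:E) `^ r^-1)%E.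
Proof. by move=> r0; rewrite -integral_norm_powR// /Lp_norm unlock. Qed.

Lemma LpP r v : 0 < r -> Lp Om r%:E v <->
  measurable_fun Om v /\ mu.-integrable Om (EFin \o (fun x => `|v x| `^ r)).
Proof.
move=> r0; have rn0 : r != 0 by rewrite gt_eqF.
have mE : measurable_fun setT (v \_ Om) <-> measurable_fun Om v.
  by split => h; [exact/(measurable_restrictT _ _).2|exact/(measurable_restrictT _ _).1].
have i0 : (0 <= \int[mu]_(x in Om) (`|v x| `^ r)%:E)%E.
  by apply: integral_ge0 => x _; rewrite lee_fin powR_ge0.
have LE : v \_ Om \in Lfun mu r%:E <-> measurable_fun setT (v \_ Om) /\
    ((\int[mu]_(x in Om) (`|v x| `^ r)%:E) `^ r^-1 < +oo)%E.
  split.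
    move=> /andP[]; rewrite !inE => mv fv; split => //.
    by rewrite -Lp_normE.
  move=> [mv fv]; apply/andP; rewrite !inE; split => //.
  by move: fv; rewrite -Lp_normE.
split.
  move=> /LE[mv fv]; split; first exact/mE.
  apply/integrableP; split.
    apply/measurable_EFinP; apply: (measurableT_comp (measurable_powR r)).
    by apply: measurableT_comp => //; exact/mE.
  under eq_integral do rewrite /= ger0_norm ?powR_ge0//.
  by apply: lty_poweRy fv; rewrite invr_eq0.
move=> [mv /integrableP[_ iv]]; apply/LE; split; first exact/mE.
apply: poweR_lty; move: iv; under eq_integral do rewrite /= ger0_norm ?powR_ge0//.
exact.
Qed.

Lemma restrict_linear a v w : (a *: v + w) \_ Om = a *: (v \_ Om) + w \_ Om.
Proof.
apply/funext => x; rewrite !fctE/= !patchE/= /GRing.scale/=; case: ifP => //.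
by rewrite mulr0 addr0.
Qed.

Lemma Lp_seminorm r : 1 <= r -> seminorm_on (Lp Om r%:E) (Lp_norm Om r%:E).
Proof.
move=> r1; have r1' : (1 <= r%:E)%E by rewrite lee_fin.
have [L0 LL] := @Lfun_submod_closed _ _ _ mu r%:E r1'.
have mL v : Lp Om r%:E v -> measurable_fun setT (v \_ Om).
  by move=> /andP[]; rewrite !inE.
have restrictD v w : (v + w) \_ Om = v \_ Om + w \_ Om.
  by rewrite -[v in LHS]scale1r restrict_linear scale1r.
have restrictZ a v : (a *: v) \_ Om = a *: (v \_ Om).
  apply/funext => x; rewrite !fctE/= !patchE/= /GRing.scale/=; case: ifP => //.
  by rewrite mulr0.
split.
- rewrite /Lp/= (_ : 0 \_ Om = 0)//; apply/funext => x; rewrite patchE.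
  by case: ifP.
- by move=> a v w Lv Lw; rewrite /Lp/= restrict_linear; exact: LL.
- move=> v /andP[_]; rewrite inE /= => h.
  by rewrite ge0_fin_numE//; exact: Lnorm_ge0.
- move=> v w Lv Lw; rewrite /Lp_norm restrictD.
  by apply: eminkowski => //; exact: mL.
- by move=> a v Lv; rewrite /Lp_norm restrictZ (LnormZ (Lfun_Sub r1' Lv) a).
Qed.

Hypothesis Omfin : (mu Om < +oo)%E.

Lemma integrable_cst_Om (k : R) : mu.-integrable Om (EFin \o (fun=> k)).
Proof.
apply: measurable_bounded_integrable => //.
by exists `|k|; split => // z zk t _ /=; rewrite ltW.
Qed.

Lemma measurable_norm_powR v r : measurable_fun Om v ->
  measurable_fun Om (fun x => `|v x| `^ r).
Proof.
move=> mv; apply: (measurableT_comp (measurable_powR r)).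
exact: measurableT_comp.
Qed.

Lemma powR_le1D (a r s : R) : 0 <= a -> 0 <= r -> r <= s -> a `^ r <= 1 + a `^ s.
Proof.
move=> a0 r0 rs; have [a1|/ltW a1] := leP a 1.
  apply: (@le_trans _ _ 1); last by rewrite lerDl powR_ge0.
  have -> : 1 = 1 `^ r :> R by rewrite powR1.
  by rewrite ge0_ler_powR// nnegrE.
by apply: (le_trans (ler_powR a1 rs)); rewrite lerDr.
Qed.

Lemma Lp_inclusion r s v : 0 < r -> r <= s -> Lp Om s%:E v -> Lp Om r%:E v.
Proof.
move=> r0 rs /LpP[|mv iv]; first exact: lt_le_trans rs.
apply/LpP => //; split => //.
apply: (@integrable_dominated _ _ _ mu Om _ (fun x => 1 + `|v x| `^ s)) => //.
- exact: measurable_norm_powR.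
- by apply: (integrableD _ (integrable_cst_Om 1) iv).
- by move=> x _; rewrite ger0_norm ?powR_ge0// powR_le1D// ltW.
Qed.

Lemma Lp_bounded r v M : 0 < r -> measurable_fun Om v -> (forall x, Om x -> `|v x| <= M) ->
  Lp Om r%:E v.
Proof.
move=> r0 mv vM; apply/LpP => //; split => //.
apply: measurable_bounded_integrable => //; first exact: measurable_norm_powR.
exists (`|M| `^ r); split; first by rewrite num_real.
move=> z zM x Ox /=; rewrite ger0_norm ?powR_ge0// (le_trans _ (ltW zM))//.
rewrite ge0_ler_powR ?nnegrE// ?(ltW r0)//.
by rewrite (le_trans (vM _ Ox))// ler_norm.
Qed.

Lemma dotL_hoelder r h v : 1 < r -> Lp Om (conj_exp r)%:E h -> Lp Om r%:E v ->
  mu.-integrable Om (EFin \o (fun x => h x * v x)) /\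
  `|dotL Om h v| <= rnorm (Lp_norm Om (conj_exp r)%:E) h * rnorm (Lp_norm Om r%:E) v.
Proof.
move=> r1 Lh Lv; have r0 : 0 < r by rewrite (lt_trans _ r1).
have r10 : 0 < r - 1 by rewrite subr_gt0.
have r'1 := conj_exp_ge1 r1.
have r'0 : 0 < conj_exp r by rewrite divr_gt0.
have conj : (conj_exp r)^-1 + r^-1 = 1.
  by rewrite /conj_exp invf_div -[X in _ + X]mul1r -mulrDl subrK divff// gt_eqF.
have /andP[+ _] := Lh; rewrite !inE => mh.
have /andP[+ _] := Lv; rewrite !inE => mv.
have H := hoelder mu mh mv r'0 r0 conj.
have hv : ((h \_ Om) \* (v \_ Om))%R = (fun x => h x * v x) \_ Om.
  by apply/funext => x /=; rewrite !patchE; case: ifP => //; rewrite mulr0.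
rewrite hv Lnorm1 in H.
have E : (\int[mu]_x `|(EFin \o ((fun x => h x * v x)%R \_ Om)) x| = \int[mu]_(x in Om) `|(h x * v x)%:E|)%E.
  rewrite [RHS]integral_mkcond; apply: eq_integral => x _ /=.
  by rewrite !patchE; case: ifP; rewrite ?normr0.
rewrite E -[X in (_ <= X * _)%E]/(Lp_norm Om (conj_exp r)%:E h) -[X in (_ <= _ * X)%E]/(Lp_norm Om r%:E v) in H.
rewrite -(rnormK (Lp_seminorm r'1) Lh) -(rnormK (Lp_seminorm (ltW r1)) Lv) -EFinM in H.
have ihv : mu.-integrable Om (EFin \o (fun x => h x * v x)).
  apply/integrableP; split; last by apply: le_lt_trans H _; exact: ltry.
  apply/measurable_EFinP.
  apply: measurable_funM; exact/(measurable_restrictT _ _).2.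
split => //; rewrite -lee_fin; apply: le_trans H.
rewrite EFin_normr_Rintegral//; apply: le_abse_integral => //.
exact: (measurable_int mu).
Qed.

Lemma conj_exp2 : conj_exp (2 : R) = 2.
Proof. by rewrite /conj_exp [X in X - 1](_ : 2 = 1 + 1)// addrK divr1. Qed.

Lemma dotL2_integrable v w : Lp Om 2%:E v -> Lp Om 2%:E w ->
  mu.-integrable Om (EFin \o (fun x => v x * w x)).
Proof.
move=> Lv Lw; have [||//] := @dotL_hoelder 2 v w _ _ Lw; first by rewrite ltr1n.
by rewrite conj_exp2.
Qed.

Lemma dotLC v w : dotL Om v w = dotL Om w v.
Proof. by apply: eq_Rintegral => x _; rewrite mulrC. Qed.

Lemma dotL_linearl a u v w : mu.-integrable Om (EFin \o (fun x => u x * w x)) ->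
  mu.-integrable Om (EFin \o (fun x => v x * w x)) ->
  dotL Om (a *: u + v) w = a * dotL Om u w + dotL Om v w.
Proof.
move=> iu iv; have iau : mu.-integrable Om (EFin \o (fun x => a * (u x * w x))).
  exact: (integrableZl _ a iu).
rewrite /dotL -RintegralZl// -RintegralD//; apply: eq_Rintegral => x _.
by rewrite !fctE /GRing.scale/= mulrDl mulrA.
Qed.

Lemma dotL_linearr a u v w : mu.-integrable Om (EFin \o (fun x => w x * u x)) ->
  mu.-integrable Om (EFin \o (fun x => w x * v x)) ->
  dotL Om w (a *: u + v) = a * dotL Om w u + dotL Om w v.
Proof.
move=> iu iv; rewrite !(dotLC w) dotL_linearl//.
  by apply: eq_integrable iu => // x _ /=; rewrite mulrC.
by apply: eq_integrable iv => // x _ /=; rewrite mulrC.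
Qed.

Lemma dotL_ge0 v : 0 <= dotL Om v v.
Proof. by apply: Rintegral_ge0 => x _; rewrite -expr2 sqr_ge0. Qed.

Lemma Lp_norm2E v : Lp Om 2%:E v -> rnorm (Lp_norm Om 2%:E) v = Num.sqrt (dotL Om v v).
Proof.
move=> Lv; rewrite /rnorm Lp_normE//.
have -> : (\int[mu]_(x in Om) (`|v x| `^ 2)%:E = (dotL Om v v)%:E)%E.
  rewrite /dotL /Rintegral fineK; last first.
    by apply: integrable_fin_num => //; exact: dotL2_integrable.
  by apply: eq_integral => x _; rewrite powR_mulrn// real_normK ?num_real// expr2.
by rewrite poweR_EFin /= powR12_sqrt// dotL_ge0.
Qed.

Lemma Lp_norm2_sqr v : Lp Om 2%:E v -> rnorm (Lp_norm Om 2%:E) v ^+ 2 = dotL Om v v.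
Proof. by move=> Lv; rewrite Lp_norm2E// sqr_sqrtr// dotL_ge0. Qed.

End Lp_spaces.

(** * Integration by parts and Sobolev spaces *)

Section translation_rV.
Context {R : realType} {d : nat}.
Notation mu := (lebesgue_rV R d).

Let prods : set (set 'rV[R]_d) :=
  [set A | exists2 B : 'I_d -> set R, (forall i, measurable (B i)) &
     A = [set x : 'rV[R]_d | forall i, B i (x ord0 i)]].

Let prods_setI : setI_closed prods.
Proof.
move=> _ _ [A mA ->] [B mB ->]; exists (fun i => A i `&` B i).
  by move=> i; exact: measurableI.
apply/seteqP; split => x /=; first by move=> [a b] i; split.
by move=> ab; split => i; have [] := ab i.
Qed.

Let measurable_prods : (@measurable _ 'rV[R]_d) = <<s prods >>.
Proof.
apply/seteqP; split.
  apply: (subset_trans (@measurable_rays R d)).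
  apply: smallest_sub; first exact: smallest_sigma_algebra.
  move=> _ [c _ <-]; apply: sub_sigma_algebra; exists (fun i => `]-oo, c i[%classic).
    by move=> i; exact: measurable_itv.
  by apply/seteqP; split => x /= Hx i; have := Hx i; rewrite in_itv.
apply: smallest_sub; first exact: sigma_algebra_measurable.
by move=> _ [B mB ->]; exact: measurable_coord_box.
Qed.

Variable v : 'rV[R]_d.
Let sh (x : 'rV[R]_d) : 'rV[R]_d := x + v.

Let msh : measurable_fun setT sh.
Proof.
apply: measurable_fun_rV => i.
under eq_fun do rewrite /sh mxE.
by apply: measurable_funD => //; exact: measurable_coord.
Qed.

(** Both measures agree on products of measurable sets, by invariance on the line; these products
    form a generating pi-system, and cubes of finite measure exhaust the space. *)
Lemma lebesgue_rV_shift (A : set 'rV[R]_d) : measurable A ->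
  pushforward mu sh A = mu A.
Proof.
pose cube (k : nat) : set 'rV[R]_d := [set x | forall i, (`[- k%:R, k%:R]%classic : set R) (x ord0 i)].
have prod_shift B : prods B -> pushforward mu sh B = mu B.
  move=> [C mC ->]; rewrite /= /pushforward.
  rewrite (_ : sh @^-1` _ = [set x : 'rV[R]_d | forall i, ((fun t : R => t + v ord0 i) @^-1` C i) (x ord0 i)]).
    have mC' i : measurable ((fun t : R => t + v ord0 i) @^-1` C i).
      rewrite -[X in measurable X]setTI.
      exact: (measurable_funD (@measurable_id _ _ setT) (measurable_cst (v ord0 i))).
    rewrite (lebesgue_rV_box mC') (lebesgue_rV_box mC); apply: eq_bigr => i _.
    by rewrite -[RHS](lebesgue_measure_shift (v ord0 i)).
  by apply/seteqP; split => x /= H i; have := H i; rewrite /sh mxE.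
have prod_cube k : prods (cube k) by exists (fun=> `[- k%:R, k%:R]%classic).
apply: (@measure_unique _ R _ prods cube measurable_prods prods_setI _ _
  (measure_function_pushforward__canonical__measure_function_Measure mu msh) mu) => //.
- apply/seteqP; split => // x _; exists (\max_(j < d) Num.bound `|x ord0 j|)%N => // i /=.
  rewrite in_itv/= -ler_norml ltW// (lt_le_trans (archi_boundP _))//.
  by rewrite ler_nat; exact: (leq_bigmax (F := fun j => Num.bound `|x ord0 j|)).
- move=> k; rewrite /= prod_shift//.
  rewrite (_ : cube k = cbox (fun=> - k%:R) (fun=> k%:R)); last first.
    by apply/seteqP; split => x /= H i; have := H i; rewrite /= in_itv.
  exact: cbox_lty.
Qed.

Lemma integral_shift_rV (f : 'rV[R]_d -> R) : mu.-integrable setT (EFin \o f) ->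
  mu.-integrable setT (EFin \o (f \o sh)) /\
  \int[mu]_x f (x + v) = \int[mu]_x f x.
Proof.
move=> intf; have /measurable_EFinP mf := measurable_int _ intf.
have E (g : 'rV[R]_d -> \bar R) : (\int[pushforward mu sh]_y g y = \int[mu]_y g y)%E.
  by apply: eq_measure_integral => A mA _; exact: lebesgue_rV_shift.
have intfh : mu.-integrable setT (EFin \o (f \o sh)).
  apply/integrableP; split.
    by apply/measurable_EFinP; exact: measurableT_comp msh.
  move/integrableP : intf => [_]; rewrite -E ge0_integral_pushforward//.
  by apply: measurableT_comp => //; exact/measurable_EFinP.
split => //; rewrite /Rintegral -[in RHS]E.
by rewrite (integral_pushforward msh)//; exact/measurable_EFinP.
Qed.

End translation_rV.

Section integration_by_parts.
Context {R : realType} {d : nat}.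
Notation mu := (lebesgue_rV R d).

Let h (n : nat) : R := n.+1%:R^-1.
Let h_gt0 n : 0 < h n. Proof. by rewrite invr_gt0. Qed.

(** Translation invariance makes the integral of every difference quotient [q n] vanish. The mean
    value theorem bounds the quotients by a bound of the partial derivative, and dominated
    convergence gives the claim. *)
Lemma Rintegral_partial_eq0 (i : 'I_d) (K : set 'rV[R]_d) (chi : 'rV[R]_d -> R) :
  compact K -> (forall x, ~ K x -> chi x = 0) -> continuous chi ->
  (forall x, derivable chi x (delta_mx ord0 i : 'rV[R]_d)) ->
  continuous (partial i chi) ->
  (exists M, forall x, `|partial i chi x| <= M) ->
  mu.-integrable setT (EFin \o chi) ->
  \int[mu]_x partial i chi x = 0.
Proof.
move=> cK K0 cchi dchi cp [M' HM'] ichi.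
pose e : 'rV[R]_d := delta_mx ord0 i.
have [M [_ HM]] := compact_bounded cK.
pose M0 := `|M| + 1.
have KM x : K x -> forall j, `|x ord0 j| <= M0.
  move=> Kx j; apply: le_trans (norm_coord_le _ _) _; apply: HM => //.
  by rewrite /M0 (le_lt_trans (ler_norm _))// ltrDl.
(* One unit larger than a cube around [K], because [q n] also looks at the point shifted by
   [h n <= 1]. *)
pose B : set 'rV[R]_d := cbox (fun=> - (M0 + 1)) (fun=> M0 + 1).
pose q n (x : 'rV[R]_d) := (h n)^-1 * (chi (h n *: e + x) - chi x).
have is_d (x : 'rV[R]_d) (s : R) : is_derive s 1 (fun s : R => chi (s *: e + x)) (partial i chi (s *: e + x)).
  have cv := dchi (s *: e + x).
  have E : (fun r : R => r^-1 *: (((fun s : R => chi (s *: e + x)) \o shift s) (r *: 1) - chi (s *: e + x))) =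
     (fun r : R => r^-1 *: ((chi \o shift (s *: e + x)) (r *: e) - chi (s *: e + x))).
    apply/funext => r /=; have -> : r *: (1 : R) = r by exact: mulr1.
    by rewrite scalerDl addrA.
  by apply: DeriveDef; rewrite ?/derivable /partial /derive E.
have qle n x : `|q n x| <= M'.
  have [|c _] := @MVT _ (fun s : R => chi (s *: e + x)) (fun s => partial i chi (s *: e + x))
      0 (h n) (h_gt0 n) (fun s _ => is_d x s).
    by apply: derivable_within_continuous => s _; have [] := is_d x s.
  rewrite scale0r add0r subr0 /q => ->; rewrite mulrCA mulVf ?gt_eqF// mulr1.
  exact: HM'.
have M'0 : 0 <= M' by exact: le_trans (HM' 0).
have h1 n : h n <= 1 by rewrite invf_le1// ler1n.
have qB n x : ~ B x -> q n x = 0.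
  move=> /existsNP[j xj].
  have xj' : M0 + 1 < `|x ord0 j|.
    by rewrite ltNge; apply/negP; rewrite ler_norml => /xj.
  rewrite /q !K0 ?subrr ?mulr0// => /KM/(_ j).
    by apply/negP; rewrite -ltNge (lt_trans _ xj')// ltrDl.
  rewrite !mxE eqxx/=; apply/negP; rewrite -ltNge.
  have : `|x ord0 j| <= `|h n * (j == i)%:R + x ord0 j| + `|h n * (j == i)%:R|.
    by rewrite -[X in `|X| <= _](addKr (h n * (j == i)%:R)) addrC ler_normB.
  have : `|h n * (j == i)%:R| <= 1.
    by case: (j == i); rewrite ?mulr1 ?mulr0 ?normr0// ger0_norm// ltW.
  by move=> ? ?; lra.
have iq n : mu.-integrable setT (EFin \o q n) /\ \int[mu]_x q n x = 0.
  have [i1 E1] := integral_shift_rV (h n *: e) ichi.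
  have E2 : q n = (fun x => (h n)^-1 * (chi (x + h n *: e) - chi x)).
    by apply/funext => x; rewrite /q (addrC x).
  have i2 : mu.-integrable setT (EFin \o (fun x => chi (x + h n *: e) - chi x)).
    exact: (integrableB _ i1 ichi).
  rewrite E2; split; first exact: (integrableZl _ _ i2).
  by rewrite RintegralZl// RintegralB// E1 subrr mulr0.
have [|||||_ cv] := @dominated_Rcvg _ _ _ mu setT q (partial i chi) (fun x => M' * \1_B x).
- exact: measurableT.
- by move=> n; have [/measurable_int/measurable_EFinP] := iq n.
- move=> x _; have := is_d x 0; rewrite scale0r add0r => -[dx dE].
  move: dx; rewrite /derivable => dx.
  have {}dx : r^-1 *: (((fun s : R => chi (s *: e + x)) \o shift 0) (r *: 1) - chi (0 *: e + x))
      @[r --> 0^'] --> partial i chi x.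
    by rewrite -dE /derive; apply/cvg_ex; move: dx => /cvg_ex.
  have Hh : (forall n, 0 < h n) /\ h n @[n --> \oo] --> (0 : R).
    by split => //; exact: (@cvg_harmonic R).
  move/cvg_dnbhs_at_right/cvg_at_rightP : dx => /(_ h Hh).
  apply: cvg_trans; apply: near_eq_cvg; apply: nearW => n /=.
  have -> : h n *: (1 : R) = h n by exact: mulr1.
  by rewrite addr0 scale0r add0r.
- by apply: (integrableZl _ M' (integrable_indic_compact _)) => //; exact: compact_cbox.
- move=> n x _; rewrite indicE; case: (boolP (x \in B)) => [_|]; first by rewrite mulr1.
  by rewrite notin_setE => /(@qB n) ->; rewrite normr0 mulr0.
apply: (cvg_unique _ cv); first exact: Rhausdorff.
have -> : (fun n => \int[mu]_x q n x) = cst 0 by apply/funext => n; have [] := iq n.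
exact: cvg_cst.
Qed.

End integration_by_parts.

(** * Seminorms from semidefinite bilinear forms *)

Section semi_inner_product.
Context {R : realType} {E : lmodType R}.
Variables (X : set E) (B : E -> E -> R).
Hypotheses (X0 : X 0) (XL : forall a x y, X x -> X y -> X (a *: x + y)).
Hypotheses (BC : forall x y, B x y = B y x)
  (BL : forall a x y z, X x -> X y -> X z -> B (a *: x + y) z = a * B x z + B y z)
  (B0 : forall x, 0 <= B x x).

Lemma semi_inner_expand a x y : X x -> X y ->
  B (a *: x + y) (a *: x + y) = a ^+ 2 * B x x + 2 * a * B x y + B y y.
Proof.
move=> Xx Xy; have Xz := XL a Xx Xy.
rewrite BL// BC BL// [B y (_ + _)]BC BL// (BC y x); ring.
Qed.

Lemma semi_inner_cauchy x y : X x -> X y ->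
  `|B x y| <= Num.sqrt (B x x) * Num.sqrt (B y y).
Proof.
move=> Xx Xy.
have key : B x y ^+ 2 <= B x x * B y y.
  have [xx0|xxn0] := eqVneq (B x x) 0.
    (* When [B x x = 0], the quadratic polynomial in the coefficient of [x] is affine; if [B x y]
       were not 0, the coefficient chosen below would give it the value -1. *)
    suff -> : B x y = 0 by rewrite xx0 mul0r expr0n.
    apply: contrapT => /eqP xy0.
    have := B0 (- (B y y + 1) / (2 * B x y) *: x + y).
    rewrite semi_inner_expand// xx0 mulr0 add0r.
    rewrite -mulrA [_ / _ * B x y]mulrAC -mulrA invfM.
    have -> : 2 * (- (B y y + 1) * (B x y * (2^-1 * (B x y)^-1))) = - (B y y + 1).
      by field; rewrite xy0.
    by lra.
  have xxp : 0 < B x x by rewrite lt_def xxn0 B0.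
  have := B0 (- B x y / B x x *: x + y); rewrite semi_inner_expand//.
  have -> : (- B x y / B x x) ^+ 2 * B x x + 2 * (- B x y / B x x) * B x y + B y y =
     B y y - B x y ^+ 2 / B x x by field.
  by rewrite subr_ge0 ler_pdivrMr// mulrC.
rewrite -sqrtrM// -sqrtr_sqr ler_wsqrtr//.
Qed.

Lemma semi_inner_seminorm : seminorm_on X (fun x => (Num.sqrt (B x x))%:E).
Proof.
split => //.
- move=> x y Xx Xy; rewrite -EFinD lee_fin.
  rewrite -(ler_pXn2r (n := 2)) ?nnegrE ?addr_ge0 ?sqrtr_ge0//.
  rewrite sqrrD !sqr_sqrtr//.
  have := semi_inner_expand 1 Xx Xy; rewrite scale1r => ->.
  have := semi_inner_cauchy Xx Xy; have := ler_norm (B x y).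
  rewrite expr1n mul1r mulr1 mulr_natl !mulr2n; lra.
- move=> a x Xx; rewrite -EFinM; congr EFin.
  have := semi_inner_expand a Xx X0; rewrite addr0 => ->.
  have z0 z : X z -> B z 0 = 0.
    move=> Xz; rewrite BC; have := BL (-1) X0 X0 Xz; rewrite scaler0 addr0 mulN1r; lra.
  rewrite !z0// mulr0 !addr0 sqrtrM ?sqr_ge0// sqrtr_sqr//.
Qed.

End semi_inner_product.

Lemma seminorm_on_sub (R : realType) (E : lmodType R) (X X' : set E) (N N' : E -> \bar R) :
  seminorm_on X N -> X' 0 -> X' `<=` X ->
  (forall a x y, X' x -> X' y -> X' (a *: x + y)) ->
  (forall x, X x -> N' x = N x) -> seminorm_on X' N'.
Proof.
move=> XN X'0 X'X X'L NN'; have [X0 XL Xf XD XZ] := XN; split => //.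
- by move=> x /X'X Xx; rewrite NN'// Xf.
- move=> x y /X'X Xx /X'X Xy; rewrite (NN' _ (seminormD XN Xx Xy)) !NN'//; exact: XD.
- move=> a x /X'X Xx; rewrite (NN' _ (seminormZ XN a Xx)) NN'//; exact: XZ.
Qed.

Section sobolev.
Context {R : realType} {d : nat}.
Notation mu := (lebesgue_rV R d).
Variable Om : set 'rV[R]_d.
Hypotheses (oOm : open Om) (bOm : bounded_set Om).
Implicit Types v w phi psi : 'rV[R]_d -> R.

Let mOm : measurable Om := open_measurable_rV oOm.
Let Omfin : (mu Om < +oo)%E := bounded_set_lty bOm mOm.
Let L2_seminorm : seminorm_on (Lp Om 2%:E) (Lp_norm Om 2%:E).
Proof. by apply: Lp_seminorm => //; rewrite ler1n. Qed.

Lemma test_fun_Lp r phi : 0 < r -> test_fun Om phi -> Lp Om r%:E phi.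
Proof.
move=> r0 tphi; have [M HM] := test_fun_bounded tphi.
apply: (@Lp_bounded _ _ _ mOm Omfin _ _ M) => //.
by apply: measurable_funTS; apply: continuous_measurable_rV; exact: test_fun_continuous tphi.
Qed.

Lemma test_fun_L2 phi : test_fun Om phi -> Lp Om 2%:E phi.
Proof. exact: test_fun_Lp. Qed.

Lemma Lp_integrable r v : 1 <= r -> Lp Om r%:E v -> mu.-integrable Om (EFin \o v).
Proof.
move=> r1 Lv; have /LpP[//|//|mv iv] : Lp Om 1%:E v by apply: (@Lp_inclusion _ _ _ mOm Omfin 1 r).
apply: (integrable_dominated mOm mv iv) => x _.
by rewrite powRr1.
Qed.

Lemma continuous_linear (a : R) phi psi : continuous phi -> continuous psi ->
  continuous (a *: phi + psi).
Proof.
move=> cphi cpsi x; apply: (@continuousD _ _ _ (fun y => a * phi y) psi); last exact: cpsi.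
by apply: (@continuousM _ _ (cst a) phi); [exact: cst_continuous|exact: cphi].
Qed.

Lemma Ck_linear k (a : R) phi psi : Ck k phi -> Ck k psi -> Ck k (a *: phi + psi).
Proof.
elim: k phi psi => [|k IH] phi psi; first exact: continuous_linear.
move=> [c1 d1 p1] [c2 d2 p2]; split.
- exact: continuous_linear.
- by move=> i x; apply: derivableD => //; exact: derivableZ.
- move=> i; rewrite (_ : partial i _ = a *: partial i phi + partial i psi); first by apply: IH; [exact: p1|exact: p2].
  apply/funext => x; rewrite /partial deriveD//; last exact: derivableZ.
  by rewrite deriveZ.
Qed.

Lemma test_fun_linear (a : R) phi psi : test_fun Om phi -> test_fun Om psi ->
  test_fun Om (a *: phi + psi).
Proof.
move=> [C1 [K1 [cK1 KO1 K01]]] [C2 [K2 [cK2 KO2 K02]]]; split.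
  by move=> k; exact: Ck_linear.
exists (K1 `|` K2); split; first exact: compactU.
- by move=> x [/KO1|/KO2].
- by move=> x /not_orP[n1 n2]; rewrite !fctE K01// K02// scaler0 addr0.
Qed.

Lemma test_fun0 : test_fun Om (0 : 'rV[R]_d -> R).
Proof.
split; last by exists set0; split => //; exact: compact0.
elim=> [|k IH]; first exact: cst_continuous.
split; first exact: cst_continuous.
- by move=> i x; exact: derivable_cst.
- move=> i; rewrite (_ : partial i 0 = 0)//; apply/funext => x.
  by rewrite /partial derive_cst.
Qed.

Lemma dotL_integrable2 v w : Lp Om 2%:E v -> Lp Om 2%:E w ->
  mu.-integrable Om (EFin \o (fun x => v x * w x)).
Proof. exact: dotL2_integrable. Qed.

Lemma dotL_linear a u v w : Lp Om 2%:E u -> Lp Om 2%:E v -> Lp Om 2%:E w ->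
  dotL Om (a *: u + v) w = a * dotL Om u w + dotL Om v w.
Proof. by move=> Lu Lv Lw; apply: dotL_linearl => //; exact: dotL_integrable2. Qed.

(** The partial derivative of the compactly supported product [phi * psi] has integral 0. It follows
    that test functions are in [H1], so that [grad_norm (v - phi)] in the definition of [H10] is a
    value of the seminorm on [H1]. *)
Lemma test_fun_weak_gradient phi : test_fun Om phi ->
  is_weak_gradient Om phi (fun i => partial i phi).
Proof.
move=> tphi i; split; first by apply: test_fun_Lp => //; exact: test_fun_partial.
move=> psi tpsi.
have Lphi := test_fun_L2 tphi; have Lpsi := test_fun_L2 tpsi.
have tdphi := test_fun_partial i tphi; have tdpsi := test_fun_partial i tpsi.
have Ldphi := test_fun_L2 tdphi; have Ldpsi := test_fun_L2 tdpsi.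
have i1 := dotL_integrable2 Lphi Ldpsi; have i2 := dotL_integrable2 Ldphi Lpsi.
apply/eqP; rewrite -addr_eq0 /dotL -RintegralD//; apply/eqP.
have [C1 [K [cK KO K0]]] := tphi.
have [_ d1 _] := C1 1%N; have [C2 _] := tpsi; have [_ d2 _] := C2 1%N.
have dphi x : derivable phi x (delta_mx ord0 i : 'rV[R]_d) by exact: d1.
have dpsi x : derivable psi x (delta_mx ord0 i : 'rV[R]_d) by exact: d2.
have pE : partial i (phi * psi) = (fun x => phi x * partial i psi x + partial i phi x * psi x).
  apply/funext => x; rewrite /partial deriveM// /GRing.scale/= addrC mulrC [RHS]addrC.
  by congr (_ + _); rewrite mulrC.
rewrite (_ : \int[mu]_(x in Om) _ = \int[mu]_x partial i (phi * psi) x); last first.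
  rewrite pE Rintegral_mkcond; apply: eq_Rintegral => x _; rewrite patchE; case: ifPn => //.
  rewrite notin_setE => Omx; have Kx : ~ K x by move=> /KO.
  rewrite K0// mul0r add0r.
  have [_ [K' [_ KO' K0']]] := tpsi; rewrite K0' ?mulr0//; by move=> /KO'.
have cphi := test_fun_continuous tphi; have cpsi := test_fun_continuous tpsi.
have cpphi := test_fun_continuous tdphi; have cppsi := test_fun_continuous tdpsi.
have [M1 B1] := test_fun_bounded tphi; have [M2 B2] := test_fun_bounded tpsi.
have [M3 B3] := test_fun_bounded tdphi; have [M4 B4] := test_fun_bounded tdpsi.
have M10 : 0 <= M1 := le_trans (normr_ge0 _) (B1 0).
have M20 : 0 <= M2 := le_trans (normr_ge0 _) (B2 0).
have M30 : 0 <= M3 := le_trans (normr_ge0 _) (B3 0).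
have M40 : 0 <= M4 := le_trans (normr_ge0 _) (B4 0).
apply: (@Rintegral_partial_eq0 _ _ i K).
- exact: cK.
- by move=> x Kx; rewrite fctE K0// mul0r.
- by move=> x; apply: continuousM; [exact: cphi|exact: cpsi].
- by move=> x; exact: derivableM.
- rewrite pE => x.
  apply: (@continuousD _ _ _ (fun x => phi x * partial i psi x)
                             (fun x => partial i phi x * psi x)).
    by apply: (@continuousM _ _ phi (partial i psi)); [exact: cphi|exact: cppsi].
  by apply: (@continuousM _ _ (partial i phi) psi); [exact: cpphi|exact: cpsi].
- exists (M1 * M4 + M3 * M2) => x; rewrite pE (le_trans (ler_normD _ _))// !normrM.
  by rewrite lerD// ler_pM.
- apply: (@integrable_dominated _ _ _ mu setT _ (fun x => (M1 * M2) * \1_K x)) => //.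
  + by apply: measurable_funM; exact: continuous_measurable_rV.
  + exact: (integrableZl _ (M1 * M2) (integrable_indic_compact cK)).
  + move=> x _; rewrite indicE; case: (boolP (x \in K)) => [_|].
      by rewrite mulr1 normrM ler_pM.
    by rewrite notin_setE => Kx; rewrite fctE K0// mul0r normr0 mulr0.
Qed.

Lemma test_fun_H1 phi : test_fun Om phi -> H1 Om phi.
Proof.
move=> tphi; split; first exact: test_fun_Lp.
by exists (fun i => partial i phi); exact: test_fun_weak_gradient.
Qed.

Lemma is_weak_gradient_linear a v w G H : Lp Om 2%:E v -> Lp Om 2%:E w ->
  is_weak_gradient Om v G -> is_weak_gradient Om w H ->
  is_weak_gradient Om (a *: v + w) (fun i => a *: G i + H i).
Proof.
move=> Lv Lw vG wH i; have [LG vGi] := vG i; have [LH wHi] := wH i.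
split; first by have [_ L _ _ _] := L2_seminorm; exact: L.
move=> phi tphi; have L1 := test_fun_L2 tphi.
have L2 := test_fun_L2 (test_fun_partial i tphi).
rewrite !dotL_linear// vGi// wHi//; ring.
Qed.

Lemma is_weak_gradient_unique v G H : is_weak_gradient Om v G ->
  is_weak_gradient Om v H -> forall i, {ae mu, forall x, Om x -> G i x = H i x}.
Proof.
move=> vG vH i; have [LG vGi] := vG i; have [LH vHi] := vH i.
have LD := seminormB L2_seminorm LG LH.
have : {ae mu, forall x, Om x -> (G i - H i) x = 0}.
  apply: dotL_test_eq0 => //; first by apply: (Lp_integrable _ LD); rewrite ler1n.
  move=> phi tphi; have L1 := test_fun_L2 tphi.
  have -> : G i - H i = (-1) *: H i + G i by rewrite scaleN1r addrC.
  rewrite dotL_linear// mulN1r; apply/eqP; rewrite addrC subr_eq0; apply/eqP/oppr_inj.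
  by rewrite -vGi// -vHi.
by apply: aeS => x h /h /eqP; rewrite !fctE subr_eq0 => /eqP.
Qed.

Lemma grad_is_weak_gradient v : H1 Om v -> is_weak_gradient Om v (grad Om v).
Proof. by move=> [_ [G vG]]; rewrite /grad; exact: (xgetPex _ (ex_intro _ G vG)). Qed.

Lemma grad_Lp v i : H1 Om v -> Lp Om 2%:E (grad Om v i).
Proof. by move=> /grad_is_weak_gradient/(_ i)[]. Qed.

Lemma H1_linear a v w : H1 Om v -> H1 Om w -> H1 Om (a *: v + w).
Proof.
move=> Hv Hw; have [Lv _] := Hv; have [Lw _] := Hw; split.
  by have [_ L _ _ _] := L2_seminorm; exact: L.
exists (fun i => a *: grad Om v i + grad Om w i).
by apply: is_weak_gradient_linear => //; exact: grad_is_weak_gradient.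
Qed.

Lemma H1_0 : H1 Om 0. Proof. exact/test_fun_H1/test_fun0. Qed.

(** [grad] is picked by [xget] separately for each function, hence is linear only almost everywhere,
    through uniqueness of weak gradients. *)
Lemma grad_linear a v w i : H1 Om v -> H1 Om w ->
  {ae mu, forall x, Om x -> grad Om (a *: v + w) i x = a * grad Om v i x + grad Om w i x}.
Proof.
move=> Hv Hw; have [Lv _] := Hv; have [Lw _] := Hw.
have := is_weak_gradient_unique (grad_is_weak_gradient (H1_linear a Hv Hw))
 (is_weak_gradient_linear a Lv Lw (grad_is_weak_gradient Hv) (grad_is_weak_gradient Hw)) i.
by apply: aeS.
Qed.

Lemma dot_gradC v w : dot_grad Om v w = dot_grad Om w v.
Proof. by apply: eq_bigr => i _; exact: dotLC. Qed.

Lemma dot_grad_ge0 v : 0 <= dot_grad Om v v.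
Proof. by apply: sumr_ge0 => i _; exact: dotL_ge0. Qed.

Lemma dot_grad_linear a u v w : H1 Om u -> H1 Om v -> H1 Om w ->
  dot_grad Om (a *: u + v) w = a * dot_grad Om u w + dot_grad Om v w.
Proof.
move=> Hu Hv Hw; rewrite /dot_grad mulr_sumr -big_split/=; apply: eq_bigr => i _.
rewrite -dotL_linear; [|exact: grad_Lp..].
apply: ae_eq_Rintegral; apply: aeS (grad_linear a i Hu Hv) => x h /h ->.
by rewrite !fctE.
Qed.

Let grad_semi_inner : seminorm_on (H1 Om) (fun v => (Num.sqrt (dot_grad Om v v))%:E).
Proof.
apply: semi_inner_seminorm.
- exact: H1_0.
- exact: H1_linear.
- exact: dot_gradC.
- exact: dot_grad_linear.
- exact: dot_grad_ge0.
Qed.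

Lemma grad_normE v : H1 Om v -> grad_norm Om v = (Num.sqrt (dot_grad Om v v))%:E.
Proof.
move=> Hv; rewrite /grad_norm.
pose g x := Num.sqrt (\sum_(i < d) grad Om v i x ^+ 2).
have s0 x : 0 <= \sum_(i < d) grad Om v i x ^+ 2 by apply: sumr_ge0 => i _; exact: sqr_ge0.
have gg x : g x * g x = \sum_(i < d) grad Om v i x * grad Om v i x.
  by rewrite -expr2 sqr_sqrtr//; apply: eq_bigr => i _; rewrite expr2.
have ig i := dotL_integrable2 (grad_Lp i Hv) (grad_Lp i Hv).
have iS : mu.-integrable Om (EFin \o (fun x => \sum_(i < d) grad Om v i x * grad Om v i x)).
  have -> : EFin \o (fun x => \sum_(i < d) grad Om v i x * grad Om v i x) =
     (fun x => \sum_(i < d) (grad Om v i x * grad Om v i x)%:E)%E.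
    by apply/funext => t /=; rewrite sumEFin.
  by apply: integrable_sum => // i _; exact: ig.
have mg : measurable_fun Om g.
  apply: (measurableT_comp (continuous_measurable_fun (@sqrt_continuous R))).
  apply: measurable_sum => i; apply: measurable_funX.
  by have /LpP[|//|] := grad_Lp i Hv.
have Lg : Lp Om 2%:E g.
  apply/LpP => //; split => //; apply: eq_integrable iS => // x _ /=.
  by rewrite -gg powR_mulrn// real_normK ?num_real// expr2.
have -> : Lp_norm Om 2%:E g = (rnorm (Lp_norm Om 2%:E) g)%:E by rewrite (rnormK L2_seminorm).
rewrite Lp_norm2E//; congr (Num.sqrt _)%:E.
rewrite /dotL /dot_grad /dotL; under eq_Rintegral do rewrite gg.
rewrite /Rintegral.
have -> : (\int[mu]_(x in Om) (\sum_(i < d) grad Om v i x * grad Om v i x)%:E =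
   \sum_(i < d) \int[mu]_(x in Om) (grad Om v i x * grad Om v i x)%:E)%E.
  under eq_integral do rewrite -sumEFin.
  by rewrite integral_sum// => i; exact: ig.
by rewrite -sum_fine// => i _; apply: integrable_fin_num; [exact: mOm|exact: ig].
Qed.

Lemma H1_seminorm : seminorm_on (H1 Om) (grad_norm Om).
Proof.
apply: (seminorm_on_sub grad_semi_inner) => //; [exact: H1_0|exact: H1_linear|].
by move=> v Hv; rewrite grad_normE.
Qed.

Lemma H10_linear a v w : H10 Om v -> H10 Om w -> H10 Om (a *: v + w).
Proof.
move=> [Hv av] [Hw aw]; split; first exact: H1_linear.
(* This tolerance for [v] is at most [e / 2] after multiplication by [|a|]; the summand 1 covers
   [a = 0]. *)
move=> e e0; pose e' := e / (2 * (`|a| + 1)).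
have a1 : 0 < `|a| + 1 by rewrite ltr_wpDl.
have e'0 : 0 < e' by rewrite divr_gt0// mulr_gt0.
have ae' : `|a| * e' <= e / 2.
  have -> : `|a| * e' = e / 2 * (`|a| / (`|a| + 1)) by rewrite /e'; field; rewrite gt_eqF.
  by rewrite ler_piMr ?divr_ge0 ?(ltW e0)// ler_pdivrMr// mul1r lerDl.
have [phi [tphi p1 p2]] := av _ e'0.
have e20 : 0 < e / 2 by rewrite divr_gt0.
have [psi [tpsi q1 q2]] := aw _ e20.
exists (a *: phi + psi); split; first exact: test_fun_linear.
all: have -> : a *: v + w - (a *: phi + psi) = a *: (v - phi) + (w - psi)
  by rewrite scalerBr opprD addrACA.
- have Lv := Hv.1; have Lw := Hw.1.
  have L1 := seminormB L2_seminorm Lv (test_fun_L2 tphi).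
  have L2 := seminormB L2_seminorm Lw (test_fun_L2 tpsi).
  have L3 := seminormZ L2_seminorm a L1.
  rewrite -(rnormK L2_seminorm) ?lte_fin; last exact: (seminormD L2_seminorm).
  rewrite -(rnormK L2_seminorm) ?lte_fin// in p1; rewrite -(rnormK L2_seminorm) ?lte_fin// in q1.
  apply: le_lt_trans (rnormD L2_seminorm L3 L2) _; rewrite (rnormZ L2_seminorm)//.
  by rewrite [ltRHS]splitr ler_ltD// (le_trans _ ae')// ler_wpM2l// ltW.
- have N := H1_seminorm.
  have L1 := seminormB N Hv (test_fun_H1 tphi).
  have L2 := seminormB N Hw (test_fun_H1 tpsi).
  have L3 := seminormZ N a L1.
  rewrite -(rnormK N) ?lte_fin; last exact: (seminormD N).
  rewrite -(rnormK N) ?lte_fin// in p2; rewrite -(rnormK N) ?lte_fin// in q2.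
  apply: le_lt_trans (rnormD N L3 L2) _; rewrite (rnormZ N)//.
  by rewrite [ltRHS]splitr ler_ltD// (le_trans _ ae')// ler_wpM2l// ltW.
Qed.

Lemma H10_0 : H10 Om 0.
Proof.
split; first exact: H1_0.
move=> e e0; exists 0; split; first exact: test_fun0.
- rewrite subr0 -(rnormK L2_seminorm); last exact: H1_0.1.
  by rewrite (rnorm0 L2_seminorm) lte_fin.
- rewrite subr0 -(rnormK H1_seminorm); last exact: H1_0.
  by rewrite (rnorm0 H1_seminorm) lte_fin.
Qed.

Lemma H10_seminorm : seminorm_on (H10 Om) (grad_norm Om).
Proof.
have sub : H10 Om `<=` H1 Om by move=> v [].
exact: (seminorm_on_sub H1_seminorm H10_0 sub H10_linear (fun _ _ => erefl)).
Qed.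

Lemma dot_grad_cauchy v w : H1 Om v -> H1 Om w ->
  `|dot_grad Om v w| <= rnorm (grad_norm Om) v * rnorm (grad_norm Om) w.
Proof.
move=> Hv Hw; rewrite /rnorm !grad_normE//=.
have H := @semi_inner_cauchy R _ (H1 Om) (dot_grad Om).
have {}H := H H1_linear.
have {}H := H dot_gradC.
have {}H := H dot_grad_linear.
have {}H := H dot_grad_ge0.
have {}H := H _ _ Hv Hw.
exact: H.
Qed.

End sobolev.

(** * The dual space H^-1 *)

Section Hm1_space.
Context {R : realType} {d : nat}.
Variable Om : set 'rV[R]_d.
Hypotheses (oOm : open Om) (bOm : bounded_set Om).

Let N := H10_seminorm oOm bOm.
Notation n1 := (rnorm (grad_norm Om)).

Lemma Hm1_0r g : Hm1 Om g -> g 0 = 0.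
Proof.
move=> [gL _]; have := gL (-1) 0 0 (H10_0 oOm bOm) (H10_0 oOm bOm).
by rewrite scaler0 addr0 mulN1r addNr.
Qed.

Lemma Hm1Z g a v : Hm1 Om g -> H10 Om v -> g (a *: v) = a * g v.
Proof.
move=> Hg Hv; have [gL _] := Hg; have := gL a v 0 Hv (H10_0 oOm bOm).
by rewrite addr0 (Hm1_0r Hg) addr0.
Qed.

Lemma Hm1_norm_ub g v : H10 Om v -> n1 v <= 1 -> (`|g v|%:E <= Hm1_norm Om g)%E.
Proof.
move=> Hv v1; apply: ereal_sup_ubound; exists v => //; split => //.
by rewrite -(rnormK N Hv) lee_fin.
Qed.

Lemma Hm1_norm_fin g : Hm1 Om g -> Hm1_norm Om g \is a fin_num.
Proof.
move=> Hg; have [gL [C HC]] := Hg.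
have ub : (Hm1_norm Om g <= `|C|%:E)%E.
  apply: ge_ereal_sup => _ [v [Hv v1] <-].
  apply: (le_trans (HC v Hv)); rewrite -(rnormK N Hv) -EFinM lee_fin.
  rewrite -(rnormK N Hv) lee_fin in v1.
  have n0 := rnorm_ge0 N Hv.
  rewrite (@le_trans _ _ (`|C| * n1 v))// ?ler_wpM2r ?ler_norm//.
  by rewrite ler_piMr.
rewrite fin_numElt (le_lt_trans ub (ltry _)) andbT.
apply: (@lt_le_trans _ _ `|g 0|%:E); first exact: ltNyr.
by apply: Hm1_norm_ub; [exact: H10_0|rewrite (rnorm0 N)].
Qed.

Lemma Hm1_bound g v : Hm1 Om g -> H10 Om v ->
  `|g v| <= rnorm (Hm1_norm Om) g * n1 v.
Proof.
move=> Hg Hv; have n0 := rnorm_ge0 N Hv.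
(* A [v] of seminorm 0 cannot be normalized; then the unspecified constant in the definition of
   [Hm1] already gives [g v = 0]. *)
have [v0|vn0] := eqVneq (n1 v) 0.
  have [_ [C /(_ v Hv)]] := Hg; rewrite -(rnormK N Hv) -EFinM lee_fin v0 !mulr0.
  exact.
have vp : 0 < n1 v by rewrite lt_def vn0.
have Hv' := seminormZ N (n1 v)^-1 Hv.
have : `|g ((n1 v)^-1 *: v)| <= rnorm (Hm1_norm Om) g.
  rewrite -lee_fin /rnorm fineK ?Hm1_norm_fin//; apply: Hm1_norm_ub => //.
  by rewrite (rnormZ N)// gtr0_norm ?invr_gt0// mulVf.
by rewrite Hm1Z// normrM gtr0_norm ?invr_gt0// ler_pdivrMl// mulrC.
Qed.

Lemma Hm1_norm_le g (C : R) : 0 <= C -> (forall v, H10 Om v -> `|g v| <= C * n1 v) ->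
  (Hm1_norm Om g <= C%:E)%E.
Proof.
move=> C0 H; apply: ge_ereal_sup => _ [v [Hv v1] <-]; rewrite lee_fin.
rewrite -(rnormK N Hv) lee_fin in v1.
by rewrite (le_trans (H _ Hv))// ler_piMr.
Qed.

Lemma Hm1_linear (a : R) g h : Hm1 Om g -> Hm1 Om h -> Hm1 Om (a *: g + h).
Proof.
move=> Hg Hh; split.
  move=> b v w Hv Hw; have [gL _] := Hg; have [hL _] := Hh.
  by rewrite !fctE /GRing.scale/= gL// hL//; ring.
exists (`|a| * rnorm (Hm1_norm Om) g + rnorm (Hm1_norm Om) h) => v Hv.
rewrite -(rnormK N Hv) -EFinM lee_fin !fctE (le_trans (ler_normD _ _))//.
rewrite mulrDl lerD ?Hm1_bound// normrM -mulrA ler_wpM2l// Hm1_bound//.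
Qed.

Lemma Hm1_zero : Hm1 Om (0 : ('rV[R]_d -> R) -> R).
Proof.
split; first by move=> a v w _ _; rewrite -[RHS]/(a * 0 + 0) mulr0 addr0.
exists 0 => v Hv; have -> : (0 : ('rV[R]_d -> R) -> R) v = 0 by [].
by rewrite normr0 mul0e.
Qed.

Lemma Hm1_seminorm : seminorm_on (Hm1 Om) (Hm1_norm Om).
Proof.
have nn g : Hm1 Om g -> (rnorm (Hm1_norm Om) g)%:E = Hm1_norm Om g.
  by move=> Hg; rewrite /rnorm fineK// Hm1_norm_fin.
have n0 g : Hm1 Om g -> 0 <= rnorm (Hm1_norm Om) g.
  move=> Hg; have n00 : n1 0 <= 1 by rewrite (rnorm0 N).
  rewrite -lee_fin nn//; apply: le_trans (Hm1_norm_ub g (H10_0 oOm bOm) n00).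
  by rewrite lee_fin.
have Zle a g : Hm1 Om g -> (Hm1_norm Om (a *: g) <= `|a|%:E * Hm1_norm Om g)%E.
  move=> Hg; rewrite -(nn _ Hg) -EFinM; apply: Hm1_norm_le; first by rewrite mulr_ge0// n0.
  by move=> v Hv; rewrite fctE normrM -mulrA ler_wpM2l// Hm1_bound.
have HZ a g : Hm1 Om g -> Hm1 Om (a *: g).
  by move=> Hg; rewrite -[_ *: _]addr0; apply: Hm1_linear => //; exact: Hm1_zero.
split.
- exact: Hm1_zero.
- exact: Hm1_linear.
- exact: Hm1_norm_fin.
- move=> g h Hg Hh; rewrite -(nn g)// -(nn h)// -EFinD; apply: Hm1_norm_le.
    by rewrite addr_ge0// n0.
  move=> v Hv; rewrite fctE (le_trans (ler_normD _ _))// mulrDl.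
  by rewrite lerD// Hm1_bound.
- move=> a g Hg; apply/eqP; rewrite eq_le Zle//=.
  have [->|an0] := eqVneq a 0.
    rewrite normr0 mul0e -nn; last exact: HZ.
    by rewrite lee_fin n0//; exact: HZ.
  have Ha := HZ a _ Hg; have := Zle a^-1 _ Ha.
  rewrite scalerA mulVf// scale1r -(nn _ Ha) -(nn _ Hg) -!EFinM !lee_fin.
  by rewrite normfV ler_pdivlMl// normr_gt0.
Qed.

End Hm1_space.

(** * Bochner spaces *)

Section bochner_theory.
Context {R : realType} {E : lmodType R} {X : set E} {N : E -> \bar R}.
Notation leb := (@lebesgue_measure R).
Notation n := (rnorm N).
Hypothesis XN : seminorm_on X N.
Variable T : R.
Implicit Types (u : R -> E) (A : set R).

(** [E] carries no sigma-algebra. A step function has finitely many values on measurable sets, so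
    its composition with any real function [F] is measurable, with no condition on [F]. *)
Definition fmeasurable u := forall F : E -> R, measurable_fun [set: R] (F \o u).

Lemma fmeasurable_indic A (x : E) u : measurable A -> fmeasurable u ->
  fmeasurable (fun t => (\1_A t : R) *: x + u t).
Proof.
move=> mA mu F.
have -> : F \o (fun t => (\1_A t : R) *: x + u t) =
    (fun t => \1_A t * F (x + u t) + (1 - \1_A t) * F (u t)).
  apply/funext => t /=; rewrite indicE; case: (t \in A).
    by rewrite scale1r mul1r subrr mul0r addr0.
  by rewrite scale0r add0r mul0r add0r subr0 mul1r.
apply: measurable_funD; apply: measurable_funM.
- exact: measurable_indic.
- exact: (mu (fun y => F (x + y))).
- by apply: measurable_funB => //; exact: measurable_indic.
- exact: mu.
Qed.

Lemma fmeasurable_simple_add s u : simple_in X s -> fmeasurable u ->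
  fmeasurable (fun t => s t + u t).
Proof.
move=> [k [A [x [mA Xx sE]]]]; rewrite (funext sE) => {sE s}.
elim: k A x mA Xx u => [|k IH] A x mA Xx u mu.
  by rewrite (_ : (fun t => _) = u)//; apply/funext => t; rewrite big_ord0 add0r.
rewrite (_ : (fun t => _) = (fun t =>
    \sum_(i < k) (\1_(A (widen_ord (leqnSn k) i)) t : R) *: x (widen_ord (leqnSn k) i) +
    ((\1_(A ord_max) t : R) *: x ord_max + u t))); last first.
  by apply/funext => t; rewrite big_ord_recr/= addrA.
apply: IH => //; exact: fmeasurable_indic.
Qed.

Lemma fmeasurable_simple s : simple_in X s -> fmeasurable s.
Proof.
move=> ss F; have m0 : fmeasurable (fun=> 0 : E) by move=> G; exact: measurable_cst.
have := fmeasurable_simple_add ss m0 F; congr (measurable_fun _ _).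
by apply/funext => t /=; rewrite addr0.
Qed.

Lemma fmeasurable_simple_sub s s' : simple_in X s -> simple_in X s' ->
  fmeasurable (fun t => s t - s' t).
Proof.
move=> ss ss'; apply: fmeasurable_simple_add => // F.
exact: (fmeasurable_simple ss' (fun y => F (- y))).
Qed.

Lemma simple_in_sub s t : simple_in X s -> X (s t).
Proof. by move=> [k [A [x [_ Xx ->]]]]; exact: (seminorm_sum XN). Qed.

Lemma simple_in_indic s B : simple_in X s -> measurable B ->
  simple_in X (fun t => (\1_B t : R) *: s t).
Proof.
move=> [k [A [x [mA Xx sE]]]] mB; exists k, (fun i => A i `&` B), x; split => //.
  by move=> i; exact: measurableI.
move=> t; rewrite sE scaler_sumr; apply: eq_bigr => i _.
by rewrite scalerA indicI /= mulrC.
Qed.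

(** All properties that hold almost everywhere are moved to one measurable set [A] of full measure
    in []0, T[], where they hold at each point. Then [\1_A t * F (u t)] is a pointwise limit of
    measurable functions and is itself Borel measurable. *)
Definition good_set u A (s : nat -> R -> E) :=
  [/\ measurable A, A `<=` `]0, T[, {ae leb, forall t, t \in `]0, T[ -> A t},
     (forall t, A t -> X (u t)) &
     (forall k, simple_in X (s k)) /\
     (forall t, A t -> n (s k t - u t) @[k --> \oo] --> 0)].

Lemma bochner_good_set q u : bochner T q X N u -> exists A (s : nat -> R -> E), good_set u A s.
Proof.
move=> [Xu [s [ss su]] _].
have [Z [mZ Z0 subZ]] := aeI Xu su.
have gd t : t \in `]0, T[ -> ~ Z t -> X (u t) /\ (N (s k t - u t) @[k --> \oo] --> 0%E).
  move=> tT Zt; apply: contrapT => h; apply/Zt/subZ => /= -[h1 h2]; apply: h.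
  by split; [exact: h1|exact: h2].
have mT : measurable (`]0, T[%classic : set R) by exact: measurable_itv.
exists (`]0, T[%classic `\` Z), s; split.
- exact: measurableD.
- by move=> t [].
- by exists Z; split => // t /= ht; apply: contrapT => Zt; apply: ht.
- by move=> t [tT Zt]; have [] := gd t tT Zt.
- split => // t [tT Zt]; have [Xut cv] := gd t tT Zt.
  by move/fine_cvg : cv; exact.
Qed.

Section good.
Variables (u : R -> E) (A : set R) (s : nat -> R -> E).
Hypothesis uAs : good_set u A s.

Let mA : measurable A. Proof. by have [] := uAs. Qed.
Let Xu t : A t -> X (u t). Proof. by have [_ _ _ h _] := uAs; exact: h. Qed.
Let ss k : simple_in X (s k). Proof. by have [_ _ _ _ []] := uAs. Qed.
Let su t : A t -> n (s k t - u t) @[k --> \oo] --> 0.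
Proof. by have [_ _ _ _ [_]] := uAs; exact. Qed.

Lemma measurable_along (F : E -> R) C :
  (forall x y, X x -> X y -> `|F x - F y| <= C * n (x - y)) ->
  measurable_fun [set: R] (fun t => \1_A t * F (u t)).
Proof.
move=> HF.
apply: (@measurable_fun_cvg _ _ _ _ (fun k t => \1_A t * F (s k t))).
- move=> k; apply: measurable_funM; first exact: measurable_indic.
  exact: (fmeasurable_simple (ss k)).
- move=> t _; rewrite indicE; have [/set_mem At|_] := boolP (t \in A); last first.
    by rewrite mul0r; under eq_fun do rewrite mul0r; exact: cvg_cst.
  rewrite mul1r; under eq_fun do rewrite mul1r.
  apply/cvgrPdist_le => e e0.
  have C0 : 0 < `|C| + 1 by rewrite ltr_wpDl.
  have e1 : 0 < e / (`|C| + 1) by rewrite divr_gt0.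
  have /cvgrPdist_le/(_ _ e1) := su At; apply: filterS => k.
  rewrite sub0r normrN => h; have Xs := simple_in_sub t (ss k).
  rewrite distrC (le_trans (HF _ _ Xs (Xu At)))//.
  rewrite (@le_trans _ _ ((`|C| + 1) * n (s k t - u t)))//.
    rewrite ler_wpM2r//; first by apply: (rnorm_ge0 XN); exact: (seminormB XN Xs (Xu At)).
    by rewrite (le_trans (ler_norm _))// lerDl.
  rewrite mulrC -ler_pdivlMr//; apply: le_trans h; exact: ler_norm.
Qed.

Lemma measurable_rnorm : measurable_fun [set: R] (fun t => \1_A t * n (u t)).
Proof.
by apply: (@measurable_along n 1) => x y Xx Xy; rewrite mul1r (rnorm_dist XN).
Qed.

Lemma measurable_rnorm_dist s' : simple_in X s' ->
  measurable_fun [set: R] (fun t => \1_A t * n (s' t - u t)).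
Proof.
move=> ss'.
apply: (@measurable_fun_cvg _ _ _ _ (fun k t => \1_A t * n (s' t - s k t))).
- move=> k; apply: measurable_funM; first exact: measurable_indic.
  exact: (fmeasurable_simple_sub ss' (ss k)).
- move=> t _; rewrite indicE; have [/set_mem At|_] := boolP (t \in A); last first.
    by rewrite mul0r; under eq_fun do rewrite mul0r; exact: cvg_cst.
  rewrite mul1r; under eq_fun do rewrite mul1r.
  apply/cvgrPdist_le => e e0.
  have /cvgrPdist_le/(_ _ e0) := su At; apply: filterS => k.
  rewrite sub0r normrN => h; have Xs := simple_in_sub t (ss k).
  have Xs' := simple_in_sub t ss'.
  have X1 := seminormB XN Xs' (Xu At); have X2 := seminormB XN Xs' Xs.
  apply: (le_trans (rnorm_dist XN X1 X2)).
  have -> : s' t - u t - (s' t - s k t) = s k t - u t by rewrite opprB addrC addrA subrK.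
  by apply: le_trans h; exact: ler_norm.
Qed.

Lemma integrable_rnorm_powR (q : R) : 0 < q -> bochner T q%:E X N u ->
  leb_integrable (fun t => (\1_A t * n (u t)) `^ q).
Proof.
move=> q0 [_ _]; rewrite unlock => fin.
have mn := measurable_rnorm.
have mnq : measurable_fun [set: R] (fun t => (\1_A t * n (u t)) `^ q).
  exact: (measurableT_comp (measurable_powR q) mn).
apply/integrableP; split; first exact/measurable_EFinP.
have E1 : (\int[leb]_t `|((N \o u) \_ `]0%R, T[) t| `^ q = \int[leb]_t `|((\1_A t * n (u t)) `^ q)%:E|)%E.
  apply: ae_eq_integral_nomeas; have [_ AT aeA _ _] := uAs.
  apply: aeS aeA => t HA _; rewrite patchE indicE.
  have [/set_mem tT|tT] := boolP (t \in _).
    have At := HA tT; rewrite mem_set// mul1r /= -(rnormK XN (Xu At)).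
    have n0 := rnorm_ge0 XN (Xu At).
    by rewrite [in RHS]ger0_norm ?powR_ge0//= ger0_norm// poweR_EFin.
  rewrite memNset; last by move=> /AT tT'; move/negP: tT; apply; rewrite inE.
  by rewrite mul0r powR0 ?gt_eqF// abse0 poweR0r ?gt_eqF//= normr0.
rewrite -E1; apply: lty_poweRy fin; by rewrite invr_eq0 gt_eqF.
Qed.

Lemma bochner_approx (q e : R) : 1 <= q -> 0 < e ->
  leb_integrable (fun t => (\1_A t * n (u t)) `^ q) ->
  exists s', [/\ simple_in X s',
    leb_integrable (fun t => (\1_A t * n (s' t - u t)) `^ q)
  & \int[leb]_t ((\1_A t * n (s' t - u t)) `^ q) <= e].
Proof.
move=> q1 e0 iu; have q0 : 0 < q by exact: lt_le_trans q1.
pose b t := \1_A t * n (u t).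
have mb : measurable_fun [set: R] b := measurable_rnorm.
have b0 t : 0 <= b t.
  rewrite /b indicE; have [/set_mem At|_] := boolP (t \in A); last by rewrite mul0r.
  by rewrite mul1r (rnorm_ge0 XN)//; exact: Xu.
(* The approximants converge without any domination. Setting [s k] to 0 where its norm exceeds twice
   that of [u] bounds the error by [3 * b], whose power [q] is integrable. *)
pose B k : set R := [set t | n (s k t) <= 2 * b t].
have mB k : measurable (B k).
  rewrite -[X in measurable X]setTI.
  apply: (@measurable_fun_le _ _ _ setT (fun t => n (s k t)) (fun t => 2 * b t)) => //.
  - exact: (fmeasurable_simple (ss k)).
  - exact: measurable_funM.
pose s' k t := (\1_(B k) t : R) *: s k t.
have ss' k : simple_in X (s' k) by exact: simple_in_indic.
pose f k t := (\1_A t * n (s' k t - u t)) `^ q.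
have f_le k t : `|f k t| <= (3 * b t) `^ q.
  rewrite ger0_norm ?powR_ge0// /f /b indicE; have [/set_mem At|_] := boolP (t \in A); last first.
    by rewrite !mul0r mulr0.
  rewrite !mul1r; have Xs' := simple_in_sub t (ss' k); have Xut := Xu At.
  have n0 := rnorm_ge0 XN (seminormB XN Xs' Xut); have nu0 := rnorm_ge0 XN Xut.
  rewrite ge0_ler_powR ?nnegrE ?(ltW q0) ?mulr_ge0//.
  apply: (le_trans (rnormB XN Xs' Xut)).
  suff : n (s' k t) <= 2 * n (u t) by lra.
  rewrite /s' indicE; have [/set_mem|_] := boolP (t \in B k).
    by rewrite scale1r /B /= /b indicE mem_set// mul1r.
  by rewrite scale0r (rnorm0 XN) mulr_ge0.
have ib : leb_integrable (fun t => (3 * b t) `^ q).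
  have -> : EFin \o (fun t => (3 * b t) `^ q) = EFin \o (fun t => 3 `^ q * b t `^ q).
    by apply/funext => t /=; rewrite powRM.
  by exact: integrable_scale.
have f0 t : f k t @[k --> \oo] --> 0.
  rewrite /f indicE; have [/set_mem At|_] := boolP (t \in A); last first.
    by under eq_fun do rewrite mul0r powR0 ?gt_eqF//; exact: cvg_cst.
  have Xut := Xu At; have nu0 := rnorm_ge0 XN Xut.
  have bt : b t = n (u t) by rewrite /b indicE mem_set// mul1r.
  have pw (x : R) : 0 <= x -> x <= 1 -> x `^ q <= x.
    rewrite le_eqVlt => /predU1P[<-|x0] x1; first by rewrite powR0 ?gt_eqF.
    by apply: ge1r_powR => //; rewrite x0.
  have cv : n (s' k t - u t) @[k --> \oo] --> 0.
    (* If [u t] has norm 0, the truncated approximant has norm 0, kept or not. Otherwise [s k t] is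
       eventually closer to [u t] than the norm of [u t], and the truncation is inactive. *)
    have [nz|np] := eqVneq (n (u t)) 0.
      apply: cvg_near_cst; apply: nearW => k.
      have Xs' := simple_in_sub t (ss' k).
      apply/eqP; rewrite eq_le (rnorm_ge0 XN (seminormB XN Xs' Xut)) andbT.
      apply: (le_trans (rnormB XN Xs' Xut)); rewrite nz addr0.
      rewrite /s' indicE; have [/set_mem|_] := boolP (t \in B k).
        by rewrite scale1r /B /= bt nz mulr0.
      by rewrite scale0r (rnorm0 XN).
    have np' : 0 < n (u t) by rewrite lt_def np.
    apply: cvg_trans (su At); apply: near_eq_cvg.
    have /cvgrPdist_le/(_ _ np') := su At; apply: filterS => k h.
    rewrite /s' indicE mem_set ?scale1r// /B /= bt.
    have Xs := simple_in_sub t (ss k).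
    have := rnorm_dist XN Xs Xut; rewrite sub0r normrN in h.
    have := ler_norm (n (s k t) - n (u t)); have := ler_norm (n (s k t - u t)).
    lra.
  apply/cvgrPdist_le => e' e'0.
  have m0 : 0 < Num.min e' 1 by rewrite lt_min e'0/=.
  have /cvgrPdist_le/(_ _ m0) := cv; apply: filterS => k.
  rewrite !sub0r !normrN mul1r le_min => /andP[h1 h2].
  have Xs' := simple_in_sub t (ss' k).
  have n0 := rnorm_ge0 XN (seminormB XN Xs' Xut).
  rewrite ger0_norm in h1 => //; rewrite ger0_norm in h2 => //.
  by rewrite ger0_norm ?powR_ge0// (le_trans (pw _ n0 h2)).
have mf k : measurable_fun [set: R] (f k).
  exact: (measurableT_comp (measurable_powR q) (measurable_rnorm_dist (ss' k))).
have [|||||_ cv] := @dominated_Rcvg _ _ _ leb setT f (cst 0) (fun t => (3 * b t) `^ q).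
- exact: measurableT.
- exact: mf.
- by move=> t _; exact: f0.
- exact: ib.
- by move=> k t _; exact: f_le.
rewrite Rintegral_cst// mul0r in cv.
have /cvgrPdist_le/(_ _ e0) [k _ /(_ k (leqnn k))] := cv.
rewrite sub0r normrN ger0_norm; last by apply: Rintegral_ge0 => t _; exact: powR_ge0.
move=> fe; exists (s' k); split => //.
apply: (@integrable_dominated _ _ _ leb setT (f k) (fun t => (3 * b t) `^ q)).
- exact: measurableT.
- exact: mf.
- exact: ib.
- by move=> t _; exact: f_le.
Qed.

End good.

End bochner_theory.
Arguments good_set {R E} X N T u A s.

(** * Approximation of duality pairings *)

Section dual_pairing.
Context {R : realType} {E1 E2 : lmodType R}.
Notation leb := (@lebesgue_measure R).
Context {X1 : set E1} {N1 : E1 -> \bar R} {X2 : set E2} {N2 : E2 -> \bar R}.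
Hypotheses (XN1 : seminorm_on X1 N1) (XN2 : seminorm_on X2 N2).
Variable b : E2 -> E1 -> R.
Hypothesis bl : forall a y y' x, X2 y -> X2 y' -> X1 x ->
  b (a *: y + y') x = a * b y x + b y' x.
Hypothesis br : forall y x x', X2 y -> X1 x -> X1 x' -> b y (x - x') = b y x - b y x'.
Hypothesis b_le : forall y x, X2 y -> X1 x -> `|b y x| <= rnorm N2 y * rnorm N1 x.

Lemma pairing_sum (I : finType) (a : I -> R) (y : I -> E2) x : (forall i, X2 (y i)) ->
  X1 x -> b (\sum_i a i *: y i) x = \sum_i a i * b (y i) x.
Proof.
move=> Xy Xx.
have b0 : b 0 x = 0.
  have X0 : X2 0 by have [] := XN2.
  by have := bl (-1) X0 X0 Xx; rewrite scaler0 addr0 mulN1r addNr.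
suff [] : X2 (\sum_i a i *: y i) /\ b (\sum_i a i *: y i) x = \sum_i a i * b (y i) x by [].
elim/big_rec2 : _ => [|i r s _ [Xs IH]]; first by split => //; have [] := XN2.
split; last by rewrite bl// IH.
by apply: (seminormD XN2) => //; exact: (seminormZ XN2).
Qed.

(* Young's inequality, with the weight l chosen so that the second term is small *)
Lemma young_small (p Z e : R) : 1 < p -> 0 <= Z -> 0 < e ->
  exists2 l, 0 < l & l `^ p * Z <= e /\
    forall x y, 0 <= x -> 0 <= y -> x * y <= (l^-1) `^ conj_exp p * x `^ conj_exp p + l `^ p * y `^ p.
Proof.
move=> p1 Z0 e0; have p0 : 0 < p by exact: lt_trans p1.
have p10 : 0 < p - 1 by rewrite subr_gt0.
have Z1 : 0 < Z + 1 by rewrite ltr_wpDl.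
have eZ : 0 < e / (Z + 1) by rewrite divr_gt0.
pose l := (e / (Z + 1)) `^ p^-1; have l0 : 0 < l by exact: powR_gt0.
exists l => //; split.
  rewrite /l -powRrM mulVf ?gt_eqF// powRr1 ?(ltW eZ)//.
  by rewrite mulrAC ler_pdivrMr// ler_wpM2l ?(ltW e0)// lerDl.
move=> x y x0 y0.
have q0 : 0 < conj_exp p by rewrite divr_gt0.
have q1 := conj_exp_ge1 p1.
have conj : (conj_exp p)^-1 + p^-1 = 1.
  by rewrite /conj_exp invf_div -[X in _ + X]mul1r -mulrDl subrK divff// gt_eqF.
have lV0 : 0 <= l^-1 by rewrite invr_ge0 ltW.
have -> : x * y = (l^-1 * x) * (l * y) by rewrite mulrACA mulVf ?mul1r// gt_eqF.
apply: (le_trans (conjugate_powR (mulr_ge0 lV0 x0) (mulr_ge0 (ltW l0) y0) q0 p0 conj)).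
rewrite !powRM// ?(ltW l0)//; apply: lerD.
  by rewrite ler_pdivrMr// ler_peMr// mulr_ge0 ?powR_ge0.
by rewrite ler_pdivrMr// ler_peMr// ?(ltW p1)// mulr_ge0 ?powR_ge0.
Qed.

(* Only G is approximated; z enters through the coefficients c i, which need not
   be step functions. *)
Lemma pairing_step_approx (T p e : R) (z : R -> E1) (G : R -> E2) A1 s1 A2 s2 :
  1 < p -> 0 < e -> good_set X1 N1 T z A1 s1 -> good_set X2 N2 T G A2 s2 ->
  leb_integrable (fun t => (\1_A1 t * rnorm N1 (z t)) `^ p) ->
  leb_integrable (fun t => (\1_A2 t * rnorm N2 (G t)) `^ conj_exp p) ->
  exists (k : nat) (A : 'I_k -> set R) (c : 'I_k -> R -> R) (alpha beta : R -> R),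
  [/\ (forall i, [/\ measurable (A i), A i `<=` `]0, T[ & leb_integrable (c i)]),
      [/\ leb_integrable alpha, (forall t, 0 <= alpha t) &
          (forall t, t <= 0 -> alpha t = 0)],
      leb_integrable beta /\ (forall t, 0 <= beta t),
      \int[leb]_t alpha t + \int[leb]_t beta t <= e
    & forall r t, A2 r -> A1 t ->
        `|b (G r) (z t) - \sum_i c i t * \1_(A i) r| <= alpha r + beta t].
Proof.
move=> p1 e0 gz gG im iG; have p0 : 0 < p by exact: lt_trans p1.
have p10 : 0 < p - 1 by rewrite subr_gt0.
have q1 := conj_exp_ge1 p1.
have q0 : 0 < conj_exp p by exact: lt_le_trans q1.
have [mA1 A1T _ Xz _] := gz; have [mA2 A2T _ XG _] := gG.
pose m t := \1_A1 t * rnorm N1 (z t).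
have m0 t : 0 <= m t.
  rewrite /m indicE; have [/set_mem At|_] := boolP (t \in A1); last by rewrite mul0r.
  by rewrite mul1r (rnorm_ge0 XN1)//; exact: Xz.
pose Z := \int[leb]_t (m t `^ p).
have Z0 : 0 <= Z by apply: Rintegral_ge0 => t _; exact: powR_ge0.
have e20 : 0 < e / 2 by rewrite divr_gt0.
have [l l0 [lZ young]] := young_small p1 Z0 e20.
have lV : 0 < (l^-1) `^ conj_exp p by rewrite powR_gt0// invr_gt0.
(* The order matters: [l] is fixed from the size of [z], and [G] is then approximated finely enough
   to compensate the possibly large weight [lV]. Each of the two error integrals is at most
   [e / 2]. *)
have [s [ss is_ sle]] := bochner_approx XN2 gG q1 (divr_gt0 e20 lV) iG.
have [k [B [y [mB Xy sE]]]] := ss.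
pose ed t := \1_A2 t * rnorm N2 (s t - G t).
have ed0 t : 0 <= ed t.
  rewrite /ed indicE; have [/set_mem At|_] := boolP (t \in A2); last by rewrite mul0r.
  rewrite mul1r (rnorm_ge0 XN2)//; apply: (seminormB XN2); last exact: XG.
  exact: (simple_in_sub XN2).
have mT : measurable (`]0, T[%classic : set R) by exact: measurable_itv.
(* The coefficients pair the values [y i] of the step function with [z t]. Cutting [B i] down to
   []0, T[] gives it finite measure and changes nothing at the times [r] in [A2]. *)
exists k, (fun i => B i `&` `]0, T[%classic), (fun i t => \1_A1 t * b (y i) (z t)),
  (fun r => (l^-1) `^ conj_exp p * ed r `^ conj_exp p), (fun t => l `^ p * m t `^ p); split.
- move=> i; split; [exact: measurableI|by move=> t []|].
  have m1 : measurable_fun [set: R] (fun t => \1_A1 t * b (y i) (z t)).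
    apply: (measurable_along XN1 gz (F := b (y i)) (C := rnorm N2 (y i))) => x x' Xx Xx'.
    by rewrite -br//; apply: b_le => //; exact: (seminormB XN1).
  apply: (@integrable_dominated _ _ _ leb setT _
    (fun t => rnorm N2 (y i) * (\1_`]0, T[ t + m t `^ p))) => //.
  + apply: integrable_scale => //; apply: integrable_add => //.
    exact: (@integrable_indic_itv R 0 T false true).
  + move=> t _; rewrite normrM /m !indicE.
    have [/set_mem At|_] := boolP (t \in A1); last first.
      by rewrite normr0 mul0r mulr_ge0 ?addr_ge0 ?powR_ge0// (rnorm_ge0 XN2).
    rewrite mem_set; last exact: A1T.
    rewrite normr1 !mul1r (le_trans (b_le (Xy i) (Xz _ At)))//.
    have n0 := rnorm_ge0 XN1 (Xz _ At).
    rewrite ler_wpM2l ?(rnorm_ge0 XN2)//.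
    by rewrite -[leLHS](powRr1 n0) powR_le1D// ltW.
- split.
  + by apply: integrable_scale => //; exact: is_.
  + by move=> t; rewrite mulr_ge0 ?powR_ge0.
  + move=> t t0; rewrite /ed indicE memNset ?mul0r ?powR0 ?mulr0 ?gt_eqF//.
    by move=> /A2T /=; rewrite in_itv/= ltNge t0.
- split; first exact: integrable_scale.
  by move=> t; rewrite mulr_ge0 ?powR_ge0.
- rewrite RintegralZl// RintegralZl// [leRHS]splitr; apply: lerD; last exact: lZ.
  by rewrite mulrC -ler_pdivlMr.
- move=> r t Ar At.
  have Xs := simple_in_sub XN2 r ss; have XGr := XG _ Ar; have Xzt := Xz _ At.
  have -> : \sum_i (\1_A1 t * b (y i) (z t)) * \1_(B i `&` `]0, T[%classic) r = b (s r) (z t).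
    rewrite sE pairing_sum//; apply: eq_bigr => i _.
    rewrite indicI /= [\1_(`]0, T[%classic) r]indicE mem_set; last exact: A2T.
    by rewrite indicE mem_set// mul1r mulr1 mulrC.
  have -> : b (G r) (z t) - b (s r) (z t) = b (G r - s r) (z t).
    by rewrite -(scaleN1r (s r)) addrC [in RHS]addrC bl// mulN1r.
  have XGs := seminormB XN2 XGr Xs.
  apply: (le_trans (b_le XGs Xzt)); rewrite (rnorm_distC XN2)//.
  have -> : rnorm N2 (s r - G r) = ed r by rewrite /ed indicE mem_set// mul1r.
  have -> : rnorm N1 (z t) = m t by rewrite /m indicE mem_set// mul1r.
  exact: young.
Qed.

End dual_pairing.

(** * Power nonlinearities *)

Section nonlinearity.
Context {R : realType}.
Implicit Types p q a b x : R.

Definition power p x : R := `|x| `^ (p - 2) * x.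

Lemma powerN p x : power p (- x) = - power p x.
Proof. by rewrite /power normrN mulrN. Qed.

Lemma power_ge0E p x : 2 <= p -> 0 <= x -> power p x = x `^ (p - 1).
Proof.
move=> p2; rewrite le_eqVlt => /predU1P[<-|x0].
  by rewrite /power mulr0 powR0//; apply/eqP; move: p2; lra.
rewrite /power gtr0_norm// -[X in _ * X](powRr1 (ltW x0)) -powRD; last by rewrite (gt_eqF x0) implybT.
by congr (_ `^ _); ring.
Qed.

Lemma norm_power p x : 2 <= p -> `|power p x| = `|x| `^ (p - 1).
Proof.
move=> p2; rewrite -power_ge0E// /power normrM normr_id.
by rewrite [X in X * _]ger0_norm// powR_ge0.
Qed.

Lemma is_derive_powR_pred p x : 0 < x -> is_derive x 1 (fun x => x `^ (p - 1)) ((p - 1) * x `^ (p - 2)).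
Proof.
move=> x0; have := @is_derive1_powR R (p - 1) x x0.
by congr is_derive; congr (_ * _ `^ _); ring.
Qed.

(* eta s^{p-2} dominates the lower power s^{q-2} up to a constant *)
Lemma power_absorb p q eta B : 2 <= q -> q < p -> 0 < eta -> 0 <= B ->
  exists2 C, 0 <= C & forall x, 0 <= x -> B * x `^ (q - 2) <= eta * x `^ (p - 2) + C.
Proof.
move=> q2 qp eta0 B0.
have pq0 : 0 < p - q by rewrite subr_gt0.
pose K := (B / eta) `^ (p - q)^-1 + 1.
have K1 : 1 <= K by rewrite /K lerDr powR_ge0.
exists (B * K `^ (q - 2)); first by rewrite mulr_ge0 ?powR_ge0.
move=> x x0; have [xK|Kx] := leP x K.
  rewrite (@le_trans _ _ (B * K `^ (q - 2)))//.
    rewrite ler_wpM2l// ge0_ler_powR ?nnegrE ?subr_ge0//; exact: le_trans K1.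
  by rewrite lerDr mulr_ge0 ?powR_ge0// ltW.
have xp : 0 < x by apply: lt_trans Kx; exact: lt_le_trans K1.
apply: (@le_trans _ _ (eta * x `^ (p - 2))); last by rewrite lerDl mulr_ge0 ?powR_ge0.
have -> : p - 2 = (p - q) + (q - 2) by ring.
rewrite (@powRD _ x (p - q) (q - 2)) ?(gt_eqF xp) ?implybT// mulrA ler_wpM2r ?powR_ge0//.
rewrite mulrC -ler_pdivrMr//.
have Be : 0 <= B / eta by rewrite divr_ge0// ltW.
have -> : B / eta = ((B / eta) `^ (p - q)^-1) `^ (p - q).
  by rewrite -powRrM mulVf ?gt_eqF// powRr1.
apply: ge0_ler_powR.
- exact: ltW.
- by rewrite nnegrE powR_ge0.
- by rewrite nnegrE ltW.
- by rewrite ltW// (lt_trans _ Kx)// /K ltrDl.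
Qed.

Lemma continuous_powR_ge0 r (x : R) : 0 < r -> {within `[0, x], continuous (fun s : R => s `^ r)}.
Proof.
move=> r0; have [x0|x0] := ltP 0 x; last first.
  move: x0; rewrite le_eqVlt => /predU1P[->|x0].
    by rewrite set_itv1; exact: continuous_subspace1.
  rewrite set_itv_ge ?bnd_simp -?ltNge//; exact: continuous_subspace0.
apply/continuous_within_itvP => //; split.
- move=> y; rewrite in_itv/= => /andP[y0 _]; apply: differentiable_continuous; apply/derivable1_diffP.
  by have [] := @is_derive1_powR R r y y0.
- by rewrite powR0 ?gt_eqF//; exact: powR_cvg0.
- have cx : {for x, continuous (fun s : R => s `^ r)}.
    apply: differentiable_continuous; apply/derivable1_diffP.
    by have [] := @is_derive1_powR R r x x0.
  exact: cvg_at_left_filter cx.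
Qed.

(** On nonnegative arguments, [psi s = eta * s]^ (p - 1) + C * s - B * s [^ (q - 1)] is
    nondecreasing, since [power_absorb] makes its derivative nonnegative. Oddness of [power] gives
    the other signs. The absolute value lets the lower-order coefficient have either sign. *)
Lemma power_diff_le p q eta B : 2 <= q -> q < p -> 0 < eta -> 0 <= B ->
  exists2 C, 0 <= C & forall a b,
    B * `|(power q a - power q b) * (a - b)| <=
    eta * ((power p a - power p b) * (a - b)) + C * (a - b) ^+ 2.
Proof.
move=> q2 qp eta0 B0; have p2 : 2 <= p by apply: le_trans (ltW qp).
have p10 : 0 < p - 1 by move: p2; lra.
have q10 : 0 < q - 1 by move: q2; lra.
(* The factors [p - 1] and [q - 1] are those produced by differentiating [psi]. *)
have [C C0 HC] := power_absorb q2 qp (mulr_gt0 eta0 p10) (mulr_ge0 B0 (ltW q10)).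
exists C => //.
have pos a b : 0 <= b -> b <= a ->
    B * (a `^ (q - 1) - b `^ (q - 1)) <= eta * (a `^ (p - 1) - b `^ (p - 1)) + C * (a - b).
  move=> b0; rewrite le_eqVlt => /predU1P[->|ba]; first by rewrite !subrr !mulr0 addr0.
  pose psi s := eta * s `^ (p - 1) + C * s - B * s `^ (q - 1).
  pose dpsi s := eta * ((p - 1) * s `^ (p - 2)) + C - B * ((q - 1) * s `^ (q - 2)).
  have dp s : s \in `]b, a[ -> is_derive s 1 psi (dpsi s).
    rewrite in_itv/= => /andP[bs _]; have s0 : 0 < s by exact: le_lt_trans bs.
    have D1 := @is_deriveZ _ _ _ (fun s : R => s `^ (p - 1)) eta s 1 _ (is_derive_powR_pred p s0).
    have D2 := @is_deriveZ _ _ _ (fun s : R => s `^ (q - 1)) B s 1 _ (is_derive_powR_pred q s0).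
    have D3 := @is_deriveZ _ _ _ (fun s : R => s) C s 1 _ (is_derive_id s 1).
    have D := @is_deriveB _ _ _ _ _ _ _ _ _ (@is_deriveD _ _ _ _ _ _ _ _ _ D1 D3) D2.
    by apply: is_derive_eq D _; rewrite /dpsi /GRing.scale/= mulr1.
  have sub : `[b, a] `<=` `[0, a] by apply: subset_itv; rewrite bnd_simp.
  have cpsi : {within `[b, a], continuous psi}.
    apply: (continuous_subspaceW sub) => s.
    apply: cvgB; [apply: cvgD|]; apply: cvgM; try exact: cvg_cst.
    - exact: (@continuous_powR_ge0 (p - 1) a p10).
    - by apply: (@continuous_subspaceT _ _ _ (fun s : R => s)) => t; exact: cvg_id.
    - exact: (@continuous_powR_ge0 (q - 1) a q10).
  have [c + E] := MVT ba dp cpsi.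
  rewrite in_itv/= => /andP[bc _]; have c0 : 0 < c by exact: le_lt_trans bc.
  have : 0 <= psi a - psi b.
    rewrite E mulr_ge0 ?subr_ge0 ?(ltW ba)// /dpsi.
    by have := HC c (ltW c0); rewrite !mulrA; lra.
  by rewrite /psi; lra.
have mono r a b : 2 <= r -> 0 <= b -> b <= a -> b `^ (r - 1) <= a `^ (r - 1).
  move=> r2 b0 ba; apply: ge0_ler_powR; rewrite ?nnegrE//; first by move: r2; lra.
  exact: le_trans ba.
have key a b : b <= a -> 0 <= power q a - power q b /\
    B * (power q a - power q b) <= eta * (power p a - power p b) + C * (a - b).
  move=> ba; have [b0|b0] := leP 0 b.
    have a0 : 0 <= a by exact: le_trans ba.
    rewrite (power_ge0E q2 a0) (power_ge0E p2 a0) (power_ge0E q2 b0) (power_ge0E p2 b0).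
    split; last exact: pos.
    by rewrite subr_ge0 mono.
  have b0' : 0 <= - b by rewrite oppr_ge0 ltW.
  have E r : 2 <= r -> power r b = - (- b) `^ (r - 1).
    by move=> r2; rewrite -[b in LHS]opprK powerN power_ge0E.
  (* For opposite signs the segment is split at 0: the estimates for the pairs [a, 0] and [- b, 0]
     are added. *)
  have [a0|a0] := leP 0 a.
    rewrite (power_ge0E q2 a0) (power_ge0E p2 a0) (E _ q2) (E _ p2); have pa := pos a 0 (lexx _) a0.
    have pb := pos (- b) 0 (lexx _) b0'.
    have qn : q - 1 != 0 by rewrite gt_eqF.
    have pn : p - 1 != 0 by rewrite gt_eqF.
    rewrite !powR0// !subr0 in pa pb; split; last by lra.
    by rewrite opprK addr_ge0 ?powR_ge0.
  have a0' : 0 <= - a by rewrite oppr_ge0 ltW.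
  have E' r : 2 <= r -> power r a = - (- a) `^ (r - 1).
    by move=> r2; rewrite -[a in LHS]opprK powerN power_ge0E.
  have ab : - a <= - b by rewrite lerN2.
  rewrite (E _ q2) (E _ p2) (E' _ q2) (E' _ p2); have pb := pos (- b) (- a) a0' ab; have := mono q _ _ q2 a0' ab.
  by split; lra.
move=> a b.
wlog ba : a b / b <= a.
  move=> H; have [/H//|/ltW/H] := leP b a.
  have -> : (power q b - power q a) * (b - a) = (power q a - power q b) * (a - b) by ring.
  have -> : (power p b - power p a) * (b - a) = (power p a - power p b) * (a - b) by ring.
  by have -> : (b - a) ^+ 2 = (a - b) ^+ 2 by ring.
have [k0 k1] := key a b ba; have ab0 : 0 <= a - b by rewrite subr_ge0.
rewrite ger0_norm ?mulr_ge0// mulrA.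
have := ler_wpM2r ab0 k1; rewrite mulrDl; rewrite expr2 !mulrA; exact.
Qed.

End nonlinearity.

(** * Differences of Bochner functions *)

Section good_set_operations.
Context {R : realType} {E : lmodType R} {X : set E} {N : E -> \bar R}.
Notation leb := (@lebesgue_measure R).
Notation n := (rnorm N).
Hypothesis XN : seminorm_on X N.
Variable T : R.

Lemma simple_in_subr (s s' : R -> E) : simple_in X s -> simple_in X s' ->
  simple_in X (fun t => s t - s' t).
Proof.
move=> [k [A [x [mA Xx sE]]]] [k' [A' [x' [mA' Xx' sE']]]].
exists (k + k')%N, (fun i => match fintype.split i with inl j => A j | inr j => A' j end),
  (fun i => match fintype.split i with inl j => x j | inr j => - x' j end); split.
- by move=> i; case: fintype.split.
- move=> i; case: fintype.split => // j.
  by rewrite -scaleN1r; exact: (seminormZ XN).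
- move=> t; rewrite sE sE' big_split_ord/= -sumrN; congr (_ + _); apply: eq_bigr => i _.
    by rewrite (unsplitK (inl _ i)).
  by rewrite (unsplitK (inr _ i)) scalerN.
Qed.

Lemma good_set_sub u w A A' s s' : good_set X N T u A s -> good_set X N T w A' s' ->
  good_set X N T (fun t => u t - w t) (A `&` A') (fun k t => s k t - s' k t).
Proof.
move=> [mA AT aeA Xu [ss su]] [mA' AT' aeA' Xw [ss' sw]]; split.
- exact: measurableI.
- by move=> t [/AT].
- by apply: aeS (aeI aeA aeA') => t [h h'] tT; split; [exact: h|exact: h'].
- by move=> t [At At']; apply: (seminormB XN); [exact: Xu|exact: Xw].
split; first by move=> k; exact: simple_in_subr.
move=> t [At At'].
have Xut := Xu _ At; have Xwt := Xw _ At'.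
have Xs k : X (s k t) by exact: (simple_in_sub XN).
have Xs' k : X (s' k t) by exact: (simple_in_sub XN).
have cv : n (s k t - u t) + n (s' k t - w t) @[k --> \oo] --> 0.
  by rewrite -[X in _ --> X](addr0 0); apply: cvgD; [exact: su|exact: sw].
have c0 : (fun=> 0 : R) k @[k --> \oo] --> 0 by exact: cvg_cst.
apply: squeeze_cvgr c0 cv; apply: nearW => k.
have Xd := seminormB XN (Xs k) Xut; have Xd' := seminormB XN (Xs' k) Xwt.
have -> : s k t - s' k t - (u t - w t) = (s k t - u t) - (s' k t - w t).
  by rewrite !opprB addrACA [RHS]addrACA; congr (_ + _); exact: addrC.
by rewrite (rnorm_ge0 XN) ?(rnormB XN)//; exact: (seminormB XN).
Qed.

Lemma integrable_rnorm_powR_sub (u w : R -> E) A A' s s' q : 1 <= q ->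
  good_set X N T u A s -> good_set X N T w A' s' ->
  leb_integrable (fun t => (\1_A t * n (u t)) `^ q) ->
  leb_integrable (fun t => (\1_A' t * n (w t)) `^ q) ->
  leb_integrable (fun t => (\1_(A `&` A') t * n (u t - w t)) `^ q).
Proof.
move=> q1 gu gw iu iw; have q0 : 0 <= q by exact: le_trans q1.
have gz := good_set_sub gu gw.
have [mA _ _ Xu _] := gu; have [mA' _ _ Xw _] := gw.
have mz := measurable_rnorm XN gz.
apply: (@integrable_dominated _ _ _ leb setT _
  (fun t => 2 `^ q * ((\1_A t * n (u t)) `^ q + (\1_A' t * n (w t)) `^ q))).
- exact: measurableT.
- exact: (measurableT_comp (measurable_powR q) mz).
- by apply: integrable_scale => //; exact: integrable_add.
- move=> t _; rewrite ger0_norm ?powR_ge0// indicI /= !indicE.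
  have [/set_mem At|_] := boolP (t \in A); last first.
    by rewrite !mul0r powR0 ?gt_eqF ?(lt_le_trans _ q1)// mulr_ge0 ?addr_ge0 ?powR_ge0.
  have [/set_mem At'|_] := boolP (t \in A'); last first.
    by rewrite mulr0 !mul0r powR0 ?gt_eqF ?(lt_le_trans _ q1)// mulr_ge0 ?addr_ge0 ?powR_ge0.
  have Xut := Xu _ At; have Xwt := Xw _ At'; rewrite !mul1r.
  have nu := rnorm_ge0 XN Xut; have nw := rnorm_ge0 XN Xwt.
  have nd := rnorm_ge0 XN (seminormB XN Xut Xwt); have nB := rnormB XN Xut Xwt.
  (* Here [x] is the larger of the two norms, so [x + y <= 2 * x]. *)
  have dbl x y : 0 <= x -> 0 <= y -> y <= x -> n (u t - w t) <= x + y ->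
      n (u t - w t) `^ q <= 2 `^ q * (x `^ q + y `^ q).
    move=> x0 y0 yx le_d; apply: (@le_trans _ _ ((2 * x) `^ q)).
      by apply: ge0_ler_powR => //; rewrite ?nnegrE ?mulr_ge0//; lra.
    by rewrite powRM// ler_wpM2l ?powR_ge0// lerDl powR_ge0.
  have [wu|/ltW uw] := leP (n (w t)) (n (u t)); first exact: dbl.
  by rewrite [X in _ * X]addrC; apply: dbl => //; rewrite [leRHS]addrC.
Qed.

End good_set_operations.

(** * Countable dense families of values *)

Section separability.
Context {R : realType} {E : lmodType R} {X X' : set E} {N N' : E -> \bar R}.
Hypotheses (XN : seminorm_on X N) (XN' : seminorm_on X' N').
Variable T : R.

(** A value is determined by which of the sets [A i] contain [t]. Lists of booleans record this in
    one countable type that suits every number of sets. *)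
Lemma simple_in_countable (Y : set E) (s : R -> E) : simple_in Y s ->
  exists v : seq bool -> E, forall t, exists J, s t = v J.
Proof.
move=> [k [A [x [_ _ sE]]]].
exists (fun J => \sum_(i < k) ((nth false J i)%:R : R) *: x i) => t.
exists (mkseq (fun j => if insub j is Some i then t \in A i else false) k).
rewrite sE; apply: eq_bigr => i _; rewrite nth_mkseq// indicE.
by rewrite valK.
Qed.

(** The step functions that approximate [z] for [N] and for [N'] are unrelated, and neither need
    take values in [V]. Their values therefore only serve as labels: each pair of labels is replaced
    by a value of [z] close to the first in [N] and to the second in [N']. *)
Lemma separable_values (V : set E) (z : R -> E) A s A' s' :
  good_set X N T z A s -> good_set X' N' T z A' s' -> V 0 ->
  (forall t, A t -> A' t -> V (z t)) ->
  exists (I : countType) (v : I -> E), (forall i, V (v i)) /\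
    forall t e, A t -> A' t -> 0 < e ->
      exists i, rnorm N (z t - v i) <= e /\ rnorm N' (z t - v i) <= e.
Proof.
move=> [mA AT aeA Xz [ss sz]] [mA' AT' aeA' Xz' [ss' sz']] V0 Vz.
have [a aE] := choice (fun k => simple_in_countable (ss k)).
have [a' aE'] := choice (fun k => simple_in_countable (ss' k)).
pose I := (nat * ((nat * seq bool) * (nat * seq bool)))%type : countType.
pose close (i : I) t := [/\ A t, A' t, X (a i.2.1.1 i.2.1.2) /\ X' (a' i.2.2.1 i.2.2.2),
  rnorm N (a i.2.1.1 i.2.1.2 - z t) <= i.1.+1%:R^-1
  & rnorm N' (a' i.2.2.1 i.2.2.2 - z t) <= i.1.+1%:R^-1].
(* Any time at which [z] is near both labels will do, as the triangle inequality then compares its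
   value with [z t]. Labels without such a time get 0, which is in [V]. *)
pose v i := if pselect (exists t, close i t) is left h then z (projT1 (cid h)) else 0.
exists I, v; split.
  move=> i; rewrite /v; case: pselect => // h.
  by case: (cid h) => t [At A't _ _ _] /=; exact: Vz.
move=> t e At A't e0.
have e20 : 0 < e / 2 by rewrite divr_gt0.
have [m _ /(_ m (leqnn m)) me] := near_infty_natSinv_lt (PosNum e20).
have m0 : 0 < (m.+1%:R : R)^-1 by rewrite invr_gt0.
have /cvgrPdist_le/(_ _ m0) [k _ /(_ k (leqnn k))] := sz t At.
rewrite sub0r normrN => hk.
have /cvgrPdist_le/(_ _ m0) [k' _ /(_ k' (leqnn k'))] := sz' t A't.
rewrite sub0r normrN => hk'.
have [J sJ] := aE k t; have [J' sJ'] := aE' k' t.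
have Xs := simple_in_sub XN t (ss k); have Xs' := simple_in_sub XN' t (ss' k').
rewrite sJ in hk Xs; rewrite sJ' in hk' Xs'.
exists (m, ((k, J), (k', J'))).
have cl : exists t, close (m, ((k, J), (k', J'))) t.
  exists t; split => //=; first exact: le_trans (ler_norm _) hk.
  exact: le_trans (ler_norm _) hk'.
rewrite /v; case: pselect => // h; case: (cid h) => r [/= Ar A'r _ h1 h2].
have g Y M (YM : seminorm_on Y M) y : Y y -> Y (z t) -> Y (z r) ->
    `|rnorm M (y - z t)| <= m.+1%:R^-1 -> rnorm M (y - z r) <= m.+1%:R^-1 ->
    rnorm M (z t - z r) <= e.
  move=> Yy Yt Yr k1 k2.
  have -> : z t - z r = (y - z r) - (y - z t) by rewrite opprB [RHS]addrC addrA subrK.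
  apply: (le_trans (rnormB YM (seminormB YM Yy Yr) (seminormB YM Yy Yt))).
  have k3 := le_trans (ler_norm _) k1; move: me => /= me.
  by apply: (le_trans (lerD k2 k3)); rewrite [leRHS]splitr lerD// ltW.
split; first by apply: (g _ _ XN _ Xs) => //; exact: Xz.
by apply: (g _ _ XN' _ Xs') => //; exact: Xz'.
Qed.

End separability.

(** * From the energy inequality to Gronwall's lemma *)

Section energy_gronwall.
Context {R : realType}.
Notation leb := (@lebesgue_measure R).

(** The bound holds for all [r] and [t] in [W], not almost all pairs, because it is also used on the
    diagonal, a null set of the plane. The index type is any finite type, so that sums of kernels
    can use a disjoint union. *)
Definition step_approximable (T : R) (W : set R) (b : R -> R -> R) :=
  forall e, 0 < e -> exists (I : finType) (A : I -> set R) (c : I -> R -> R) (alpha beta : R -> R),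
  [/\ (forall i, [/\ measurable (A i), A i `<=` `]0, T[ & leb_integrable (c i)]),
      [/\ leb_integrable alpha, (forall t, 0 <= alpha t) &
          (forall t, t <= 0 -> alpha t = 0)],
      leb_integrable beta /\ (forall t, 0 <= beta t),
      \int[leb]_t alpha t + \int[leb]_t beta t <= e
    & forall r t, W r -> W t ->
        `|b r t - \sum_i c i t * \1_(A i) r| <= alpha r + beta t].

Lemma step_approximableD T W b b' : step_approximable T W b -> step_approximable T W b' ->
  step_approximable T W (fun r t => b r t + b' r t).
Proof.
move=> ab ab' e e0; have e2 : 0 < e / 2 by rewrite divr_gt0.
have [I [A [c [al [be [HA [ia al0 al00] [ib be0] le1 H]]]]]] := ab _ e2.
have [I' [A' [c' [al' [be' [HA' [ia' al0' al00'] [ib' be0'] le1' H']]]]]] := ab' _ e2.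
exists (I + I')%type, (fun i => match i with inl j => A j | inr j => A' j end),
  (fun i => match i with inl j => c j | inr j => c' j end),
  (fun t => al t + al' t), (fun t => be t + be' t); split.
- by case.
- split; first exact: integrable_add.
  + by move=> t; rewrite addr_ge0.
  + by move=> t t0; rewrite al00// al00'// addr0.
- split; first exact: integrable_add.
  by move=> t; rewrite addr_ge0.
- rewrite !RintegralD// addrACA [leRHS]splitr; exact: lerD.
- move=> r t Wr Wt; rewrite big_sumType/=.
  rewrite opprD addrACA [leRHS]addrACA; apply: (le_trans (ler_normD _ _)).
  by apply: lerD; [exact: H|exact: H'].
Qed.

Lemma integrable_indicM (A : set R) (f : R -> R) : measurable A ->
  leb_integrable f -> leb_integrable (fun t => f t * \1_A t).
Proof.
move=> mA fi; apply: (@integrable_dominated _ _ _ leb setT _ (fun t => `|f t|)).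
- exact: measurableT.
- apply: measurable_funM; first by apply/measurable_EFinP; exact: measurable_int fi.
  by apply: measurable_indic; exact: mA.
- exact: (integrable_norm fi).
- by move=> x _; rewrite normrM ler_piMr// indicE; case: (x \in A); rewrite ?normr1 ?normr0.
Qed.

Lemma Rintegral_bigsum (D : set R) (J : finType) (g : J -> R -> R) : measurable D ->
  (forall i, leb.-integrable D (EFin \o g i)) ->
  \sum_i \int[leb]_(r in D) g i r = \int[leb]_(r in D) \sum_i g i r.
Proof.
move=> mD ig; rewrite /Rintegral.
transitivity (fine (\sum_i \int[leb]_(r in D) (g i r)%:E)%E).
  rewrite (eq_bigr (fun i => (fine (\int[leb]_(r in D) (g i r)%:E))%:E)) ?sumEFin//.
  by move=> i _; rewrite fineK//; apply: integrable_fin_num => //; exact: ig.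
rewrite -integral_sum//; congr fine; apply: eq_integral => r _.
by rewrite sumEFin.
Qed.

Lemma primitiveZ (k : R) (f : R -> R) x : leb_integrable f ->
  primitive (fun r => k * f r) x = k * primitive f x.
Proof. by move=> fi; rewrite /primitive RintegralZl//; exact: integrable_subset fi. Qed.

(** The second argument of the kernel is frozen: [k i] and [be] stand for multiples of [c i t] and
    [beta t] at a fixed time, which is why [be] gets multiplied by the length of the interval. *)
Lemma step_increment_le (I : finType) (A : I -> set R) (k : I -> R) (alpha f : R -> R) s t T be :
  s <= t ->
  (forall i, measurable (A i)) -> (forall i, A i `<=` `]0, T[) ->
  leb_integrable alpha -> leb_integrable f ->
  {ae leb, forall r, f r <= \sum_i k i * \1_(A i) r + alpha r + be} ->
  primitive f t - primitive f s <=
  \sum_i k i * (primitive \1_(A i) t - primitive \1_(A i) s) +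
  (primitive alpha t - primitive alpha s) + (t - s) * be.
Proof.
move=> st mA AT ia if_ Hle.
have mI : measurable (`]s, t]%classic : set R) by exact: measurable_itv.
have iA i := integrable_indic_subset (mA i) (@AT i).
rewrite primitiveB// primitiveB//.
have sub g : leb_integrable g -> leb.-integrable `]s, t] (EFin \o g).
  exact: integrable_subset.
have -> : \sum_i k i * (primitive \1_(A i) t - primitive \1_(A i) s) =
    \sum_i \int[leb]_(r in `]s, t]) (k i * \1_(A i) r).
  by apply: eq_bigr => i _; rewrite primitiveB// RintegralZl//; exact: sub.
have ikA i : leb.-integrable `]s, t] (EFin \o (fun r => k i * (\1_(A i) r : R))).
  by apply: integrable_scale => //; exact: sub.
have ick : leb.-integrable `]s, t] (EFin \o (fun=> be) : R -> \bar R) by exact: integrable_cst_itv.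
have is_ := integrable_bigsum mI ikA.
rewrite Rintegral_bigsum// mulrC -(@Rintegral_cst_itv R s t be false false)// -RintegralD//; last exact: sub.
rewrite -RintegralD//; last by apply: integrable_add => //; exact: sub.
apply: ae_le_Rintegral => //; first exact: sub.
  by apply: integrable_add => //; apply: integrable_add => //; exact: sub.
by apply: aeS Hle => r h _.
Qed.

(** [steklov_limit] bounds [phi tau] by the integral of the approximate kernel on the diagonal,
    where it differs from [b t t <= K * phi t] by at most [alpha t + beta t]. The factor 2 of the
    increment inequality turns [K] into [2 * K]. *)
Lemma energy_gronwall (T K : R) (W : set R) (b : R -> R -> R) (phi : R -> R) :
  0 < T -> 0 <= K -> measurable W -> W `<=` `]0, T[ ->
  {ae leb, forall t, t \in `]0, T[ -> W t} ->
  leb_integrable phi -> (forall t, 0 <= phi t) ->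
  (forall t, t <= 0 -> phi t = 0) ->
  (forall t, W t -> leb_integrable (fun r => \1_W r * b r t)) ->
  step_approximable T W b ->
  (forall h, 0 < h -> {ae leb, forall t, t \in `]0, T[ -> phi t - phi (t - h) <=
     2 * (primitive (fun r => \1_W r * b r t) t - primitive (fun r => \1_W r * b r t) (t - h))}) ->
  {ae leb, forall t, t \in `]0, T[ -> b t t <= K * phi t} ->
  {ae leb, forall t, t \in `]0, T[ -> phi t = 0}.
Proof.
move=> T0 K0 mW WT aeW iphi phi0 phi00 ib approx incr sign.
apply: (@gronwall_ae _ T (2 * K)) => //; first exact: mulr_ge0.
apply: aeS (ae_primitive_cvg iphi) => tau [dtau ptau]; rewrite in_itv/= => tauT.
apply/ler_addgt0Pr => e e0.
(* The integrals of [al] and [be] carry the factor 2 and occur twice, once in [steklov_limit] and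
   once on the return to the diagonal in [bd]. *)
have e4 : 0 < e / 4 by rewrite divr_gt0.
have [I [A [c [al [be [HA [ia al0 al00] [ibe be0] le1 H]]]]]] := approx _ e4.
have mA i : measurable (A i) by have [] := HA i.
have AT i : A i `<=` `]0, T[ by have [] := HA i.
have ic i : leb_integrable (c i) by have [] := HA i.
have A0 i t : t <= 0 -> (\1_(A i) t : R) = 0.
  by move=> t0; rewrite indicE memNset// => /AT /=; rewrite in_itv/= ltNge t0.
have I2 (f : R -> R) : leb_integrable f -> leb_integrable (fun t => 2 * f t).
  exact: integrable_scale.
have i2c i := I2 _ (ic i).
have sum0 (k : I -> R) t : ~ (0 < t < T) -> \sum_i k i * \1_(A i) t = 0.
  move=> nt; apply: big1 => i _; rewrite indicE memNset ?mulr0// => /AT /=.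
  by rewrite in_itv.
have sum2 t r : \sum_i 2 * c i t * \1_(A i) r = 2 * \sum_i c i t * \1_(A i) r.
  by rewrite mulr_sumr; apply: eq_bigr => i _; rewrite mulrA.
have [tau0 tauT'] := andP tauT.
apply: (@le_trans _ _ (\int[leb]_(t in `]-oo, tau]) (\sum_i (2 * c i t) * \1_(A i) t)
    + \int[leb]_t (2 * al t) + \int[leb]_t (2 * be t))).
  apply: (@steklov_limit R I A (fun i t => 2 * c i t) phi _ _ tau T) => //.
  - exact: I2.
  - by move=> t; rewrite mulr_ge0.
  - by move=> t t0; rewrite al00// mulr0.
  - exact: I2.
  - by move=> t; rewrite mulr_ge0.
  - move=> n; set hn := n.+1%:R^-1; have hn0 : 0 < hn by rewrite invr_gt0.
    apply: aeS (aeI aeW (incr hn hn0)) => t [Wt It] tT.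
    have tht : t - hn <= t by rewrite gerBl ltW.
    (* The inequality is required on all of []-oo, T[]. For [t <= 0] everything vanishes by the
       extension by 0, except the nonnegative term in [be]. *)
    have [t0|t0] := leP t 0.
      have th0 : t - hn <= 0 by exact: le_trans t0.
      rewrite !phi00// subrr big1; last first.
        move=> i _; rewrite !primitive_eq0 ?subrr ?mulr0// => s s0; exact: A0.
      rewrite !primitive_eq0 ?subrr ?add0r ?mulr_ge0 ?(ltW hn0)//.
        by move=> s s0; rewrite al00// mulr0.
      by move=> s s0; rewrite al00// mulr0.
    have tin : t \in `]0, T[ by rewrite in_itv/= t0.
    apply: (le_trans (It tin)); move/(_ tin) in Wt.
    rewrite mulrBr -!primitiveZ; [|exact: ib..].
    have := step_increment_le (k := fun i => 2 * c i t) (be := 2 * be t) tht mA AT (I2 _ ia) (I2 _ (ib t Wt)).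
    rewrite (_ : t - (t - hn) = hn); last by rewrite opprB addrC subrK.
    apply.
    apply: aeS aeW => r Wr.
    have [rT|rT] := boolP (0 < r < T); last first.
      rewrite sum0 ?add0r; last exact/negP.
      rewrite indicE memNset ?mul0r ?mulr0 ?addr_ge0 ?mulr_ge0//.
      by move=> /WT /=; rewrite in_itv/=; exact/negP.
    have /Wr {}Wr : r \in `]0, T[ by rewrite in_itv.
    rewrite indicE mem_set// mul1r -subr_ge0.
    have := H _ _ Wr Wt; rewrite ler_norml => /andP[_].
    rewrite sum2.
    by lra.
have mD : measurable (`]-oo, tau]%classic : set R) by exact: measurable_itv.
have sub g : leb_integrable g -> leb.-integrable `]-oo, tau] (EFin \o g).
  exact: integrable_subset.
have bd : \int[leb]_(t in `]-oo, tau]) (\sum_i (2 * c i t) * \1_(A i) t) <=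
   \int[leb]_(t in `]-oo, tau]) (2 * K * phi t + (2 * al t + 2 * be t)).
  apply: ae_le_Rintegral => //.
  - by apply: integrable_bigsum => // i; apply: sub; exact: integrable_indicM.
  - apply: sub; apply: integrable_add => //; first exact: integrable_scale.
    by apply: integrable_add => //; exact: I2.
  - apply: aeS (aeI aeW sign) => t [Wt St] _.
    have [tT|tT] := boolP (0 < t < T); last first.
      rewrite (sum0 (fun i => 2 * c i t)); last exact/negP.
      by rewrite !addr_ge0 ?mulr_ge0.
    have tin : t \in `]0, T[ by rewrite in_itv.
    have := H _ _ (Wt tin) (Wt tin); rewrite ler_norml => /andP[+ _].
    have := St tin.
    rewrite sum2.
    by rewrite -mulrA; lra.
have i2a := I2 _ ia; have i2b := I2 _ ibe.
rewrite !RintegralD// in bd; [|by apply: sub..|by apply: sub; apply: integrable_scale|by apply: integrable_add => //; exact: sub].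
rewrite !RintegralZl// in bd *; try exact: sub.
have := primitive_le tau ia al0; have := primitive_le tau ibe be0.
rewrite /primitive -/(primitive phi tau) in bd * => p1 p2.
by lra.
Qed.

End energy_gronwall.

Section integrable_along.
Context {R : realType} {E : lmodType R} {X : set E} {N : E -> \bar R}.
Notation leb := (@lebesgue_measure R).
Hypothesis XN : seminorm_on X N.

Lemma integrable_along (T q C : R) (u : R -> E) A s (F : E -> R) : 1 <= q -> 0 <= C ->
  good_set X N T u A s ->
  leb_integrable (fun t => (\1_A t * rnorm N (u t)) `^ q) ->
  (forall x y, X x -> X y -> F (x - y) = F x - F y) ->
  (forall x, X x -> `|F x| <= C * rnorm N x) ->
  leb_integrable (fun t => \1_A t * F (u t)).
Proof.
move=> q1 C0 gu iu Fl Fb; have [mA AT _ Xu _] := gu.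
apply: (@integrable_dominated _ _ _ leb setT _
  (fun t => C * (\1_`]0, T[ t + (\1_A t * rnorm N (u t)) `^ q))).
- exact: measurableT.
- apply: (measurable_along XN gu (C := C)) => x y Xx Xy.
  by rewrite -Fl//; apply: Fb; exact: (seminormB XN).
- apply: integrable_scale => //; apply: integrable_add => //.
  exact: (@integrable_indic_itv R 0 T false true).
- move=> t _; rewrite normrM !indicE.
  have [/set_mem At|_] := boolP (t \in A); last first.
    by rewrite normr0 mul0r mulr_ge0 ?addr_ge0 ?powR_ge0.
  rewrite mem_set; last exact: AT.
  rewrite normr1 !mul1r (le_trans (Fb _ (Xu _ At)))//.
  have n0 := rnorm_ge0 XN (Xu _ At).
  by rewrite ler_wpM2l// -[leLHS](powRr1 n0) powR_le1D.
Qed.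

End integrable_along.

(** * Uniqueness *)

Section weak_increment.
Context {R : realType} {d : nat} {Om : set 'rV[R]_d}.
Notation leb := (@lebesgue_measure R).
Notation mu := (lebesgue_rV R d).
Hypotheses (oOm : open Om) (bOm : bounded_set Om).
Variables (T p : R).
Hypotheses (T0 : 0 < T) (p1 : 1 < p).
Notation V := (H10_Lp Om p).
Notation pc := (conj_exp p).
Notation n1 := (rnorm (grad_norm Om)).
Notation np := (rnorm (Lp_norm Om p%:E)).

Let mOm : measurable Om. Proof. exact: open_measurable_rV. Qed.
Let Omfin : (mu Om < +oo)%E. Proof. exact: bounded_set_lty. Qed.
Let pc1 : 1 <= pc. Proof. exact: conj_exp_ge1. Qed.

Lemma H10_Lp_0 : V 0.
Proof.
by split; [exact: H10_0|have [] := Lp_seminorm Om (ltW p1)].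
Qed.

Lemma dotL_duall (a : R) y y' x : Lp Om pc%:E y -> Lp Om pc%:E y' -> Lp Om p%:E x ->
  dotL Om (a *: y + y') x = a * dotL Om y x + dotL Om y' x.
Proof.
by move=> Ly Ly' Lx; apply: dotL_linearl => //; apply: (dotL_hoelder mOm p1 _ Lx).1.
Qed.

Lemma dotL_dualBl y y' x : Lp Om pc%:E y -> Lp Om pc%:E y' -> Lp Om p%:E x ->
  dotL Om (y - y') x = dotL Om y x - dotL Om y' x.
Proof.
move=> Ly Ly' Lx; rewrite -scaleN1r addrC dotL_duall// mulN1r addrC //.
Qed.

Lemma dotL_dualBr y x x' : Lp Om pc%:E y -> Lp Om p%:E x -> Lp Om p%:E x' ->
  dotL Om y (x - x') = dotL Om y x - dotL Om y x'.
Proof.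
move=> Ly Lx Lx'; rewrite -scaleN1r addrC dotL_linearr//; first by rewrite mulN1r addrC.
  exact: (dotL_hoelder mOm p1 Ly Lx').1.
exact: (dotL_hoelder mOm p1 Ly Lx).1.
Qed.

Lemma Hm1_sub (y : ('rV[R]_d -> R) -> R) x x' : Hm1 Om y -> H10 Om x -> H10 Om x' ->
  y (x - x') = y x - y x'.
Proof.
by move=> [yl _] Hx Hx'; rewrite -scaleN1r addrC yl// mulN1r addrC.
Qed.

Definition dual_rep (D g : R -> ('rV[R]_d -> R) -> R) h Ag sg Ah sh :=
  [/\ good_set (Hm1 Om) (Hm1_norm Om) T g Ag sg,
      good_set (Lp Om pc%:E) (Lp_norm Om pc%:E) T h Ah sh,
      leb_integrable (fun t => (\1_Ag t * rnorm (Hm1_norm Om) (g t)) `^ 2),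
      leb_integrable (fun t => (\1_Ah t * rnorm (Lp_norm Om pc%:E) (h t)) `^ pc)
    & {ae leb, forall t, t \in `]0, T[ -> forall v, V v -> D t v = g t v + dotL Om (h t) v}].

Lemma time_dual_rep D : time_dual Om T p D -> exists g h Ag sg Ah sh, dual_rep D g h Ag sg Ah sh.
Proof.
move=> [g [h [bg bh DE]]].
have [Ag [sg gg]] := bochner_good_set bg.
have [Ah [sh gh]] := bochner_good_set bh.
exists g, h, Ag, sg, Ah, sh; split => //.
  exact: (integrable_rnorm_powR (Hm1_seminorm oOm bOm) gg).
apply: (integrable_rnorm_powR (Lp_seminorm Om pc1) gh) => //.
exact: lt_le_trans pc1.
Qed.

Lemma integrable_dual_pairing g h Ag sg Ah sh v :
  good_set (Hm1 Om) (Hm1_norm Om) T g Ag sg ->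
  good_set (Lp Om pc%:E) (Lp_norm Om pc%:E) T h Ah sh ->
  leb_integrable (fun t => (\1_Ag t * rnorm (Hm1_norm Om) (g t)) `^ 2) ->
  leb_integrable (fun t => (\1_Ah t * rnorm (Lp_norm Om pc%:E) (h t)) `^ pc) ->
  forall W, measurable W -> W `<=` Ag `&` Ah -> V v ->
  leb_integrable (fun t => \1_W t * (g t v + dotL Om (h t) v)).
Proof.
move=> gg gh ig ih W mW WA [Hv Lv].
have i1 : leb_integrable (fun t => \1_Ag t * g t v).
  apply: (integrable_along (Hm1_seminorm oOm bOm) (C := n1 v) (F := fun y => y v)) gg ig _ _ => //.
  - by rewrite ler1n.
  - by rewrite (rnorm_ge0 (H10_seminorm oOm bOm)).
  - by move=> y Hy; rewrite mulrC; exact: Hm1_bound.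
have i2 : leb_integrable (fun t => \1_Ah t * dotL Om (h t) v).
  apply: (integrable_along (Lp_seminorm Om pc1) (C := np v) (F := fun y => dotL Om y v)) gh ih _ _ => //.
  - by rewrite (rnorm_ge0 (Lp_seminorm Om (ltW p1))).
  - by move=> x y Lx Ly; exact: dotL_dualBl.
  - by move=> y Hy; rewrite mulrC; exact: (dotL_hoelder mOm p1 Hy Lv).2.
have := integrable_indicM mW (integrable_add measurableT i1 i2).
congr integrable; apply/funext => t /=; congr EFin; rewrite !indicE.
have [/set_mem/WA[At Ah']|_] := boolP (t \in W); last by rewrite mulr0 mul0r.
by rewrite !mem_set// !mul1r mulr1.
Qed.

(** For fixed [v] the function [U ^~ v] is continuous, so its increment is known at every time in
    []0, T[]. The only null set is the one where [U t] and [u t] differ; it does not depend on [v],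
    which puts the quantifier over [v] inside and allows a test function that varies with time. *)
Lemma weak_increment u u0 D g h Ag sg Ah sh : dual_rep D g h Ag sg Ah sh ->
  is_time_derivative Om T p u D -> initial_condition Om T p u u0 ->
  {ae leb, forall t, t \in `]0, T[ -> forall v, V v -> dotL Om (u t) v - dotL Om u0 v =
    primitive (fun r => \1_(Ag `&` Ah) r * (g r v + dotL Om (h r) v)) t}.
Proof.
move=> [gg gh ig ih DE] Du [U [_ cU UE U0]].
have [mg gT aeg _ _] := gg; have [mh hT aeh _ _] := gh.
have UE' := UE; apply: aeS UE => t UE tT v Vv; rewrite -UE// -U0//.
(* A version of [D ^~ v] that is integrable on the line and vanishes outside []0, T[]. *)
pose e r := \1_(Ag `&` Ah) r * (g r v + dotL Om (h r) v).
have ie : leb_integrable e.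
  by apply: (integrable_dual_pairing gg gh) => //; exact: measurableI.
have mI a b (x y : bool) : measurable [set` Interval (BSide x (a : R)) (BSide y b)] by exact: measurable_itv.
have e0 r : r <= 0 -> e r = 0.
  by move=> r0; rewrite /e indicE memNset ?mul0r// => -[/gT /=]; rewrite in_itv/= ltNge r0.
have De : {ae leb, forall r, r \in `]0, T[ -> D r v = e r}.
  apply: aeS (aeI (aeI aeg aeh) DE) => r [[hg hh] hD] rT.
  by rewrite hD// /e indicE mem_set ?mul1r//; split; [exact: hg|exact: hh].
have t0T : 0 < t < T by move: tT; rewrite in_itv.
have sub (S : set R) : measurable S -> leb.-integrable S (EFin \o e).
  by move=> mS; exact: integrable_subset ie.
rewrite (weak_derivative_increment T0 (cU v Vv) (sub _ (mI 0 T false true)) _ t0T).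
  have [t0 _] := andP t0T.
  rewrite (@Rintegral_itv_bndo_bndc _ _ _ e); last exact: sub.
  by rewrite -primitiveB ?(ltW t0)// (primitive_eq0 e0 (lexx 0)) subr0.
move=> phi tphi.
transitivity (\int[leb]_(r in `]0, T[) (dotL Om (u r) v * derive1 phi r)).
  by apply: ae_eq_Rintegral; apply: aeS UE' => r hr rT; rewrite hr.
rewrite Du//; congr (- _); apply: ae_eq_Rintegral.
by apply: aeS De => r hr rT; rewrite hr.
Qed.

End weak_increment.

(** * The energy argument for the difference of two solutions *)

Section energy_uniqueness.
Context {R : realType} {d : nat} {Om : set 'rV[R]_d}.
Notation leb := (@lebesgue_measure R).
Notation mu := (lebesgue_rV R d).
Hypotheses (oOm : open Om) (bOm : bounded_set Om).
Variables (T p : R).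
Hypotheses (T0 : 0 < T) (p2 : 2 <= p).
Notation V := (H10_Lp Om p).
Notation pc := (conj_exp p).
Notation n1 := (rnorm (grad_norm Om)).
Notation np := (rnorm (Lp_norm Om p%:E)).

Let mOm : measurable Om. Proof. exact: open_measurable_rV. Qed.
Let Omfin : (mu Om < +oo)%E. Proof. exact: bounded_set_lty. Qed.
Let p1 : 1 < p. Proof. by apply: lt_le_trans p2; rewrite ltr1n. Qed.
Let p0 : 0 < p. Proof. exact: lt_trans p1. Qed.

Lemma dotL_le_Lp_norm v : Lp Om p%:E v -> dotL Om v v <= fine (mu Om) + np v `^ p.
Proof.
move=> Lv; have [mv iv] := (LpP mOm v p0).1 Lv.
have L2v : Lp Om 2%:E v by apply: (Lp_inclusion mOm Omfin) Lv.
have -> : np v `^ p = \int[mu]_(x in Om) (`|v x| `^ p).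
  rewrite /rnorm Lp_normE ?gt_eqF//.
  have -> : (\int[mu]_(x in Om) (`|v x| `^ p)%:E = (\int[mu]_(x in Om) (`|v x| `^ p))%:E)%E.
    by rewrite /Rintegral fineK//; exact: integrable_fin_num.
  rewrite poweR_EFin /= -powRrM mulVf ?gt_eqF// powRr1//.
  by apply: Rintegral_ge0 => x _; exact: powR_ge0.
have -> : fine (mu Om) = \int[mu]_(x in Om) 1.
  by rewrite Rintegral_cst// mul1r.
rewrite -RintegralD//; last exact: integrable_cst_Om.
apply: le_Rintegral => //.
- exact: dotL2_integrable.
- exact: (integrableD mOm (integrable_cst_Om mOm Omfin 1) iv).
- move=> x _ /=; rewrite -expr2 -real_normK ?num_real//.
  rewrite -[_ ^+ 2]powR_mulrn//; exact: powR_le1D.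
Qed.

Lemma energy_unique (z : R -> 'rV[R]_d -> R) G H K A0 s0 A1 s1 Ap sp A2 s2 A3 s3 :
  0 <= K ->
  good_set (Lp Om 2%:E) (Lp_norm Om 2%:E) T z A0 s0 ->
  good_set (H10 Om) (grad_norm Om) T z A1 s1 ->
  good_set (Lp Om p%:E) (Lp_norm Om p%:E) T z Ap sp ->
  good_set (Hm1 Om) (Hm1_norm Om) T G A2 s2 ->
  good_set (Lp Om pc%:E) (Lp_norm Om pc%:E) T H A3 s3 ->
  leb_integrable (fun t => (\1_A1 t * n1 (z t)) `^ 2) ->
  leb_integrable (fun t => (\1_Ap t * np (z t)) `^ p) ->
  leb_integrable (fun t => (\1_A2 t * rnorm (Hm1_norm Om) (G t)) `^ 2) ->
  leb_integrable (fun t => (\1_A3 t * rnorm (Lp_norm Om pc%:E) (H t)) `^ pc) ->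
  let W := (A0 `&` A1 `&` Ap) `&` (A2 `&` A3) in
  {ae leb, forall t, t \in `]0, T[ -> forall v, V v ->
    dotL Om (z t) v = primitive (fun r => \1_W r * (G r v + dotL Om (H r) v)) t} ->
  {ae leb, forall t, t \in `]0, T[ ->
    G t (z t) + dotL Om (H t) (z t) <= K * dotL Om (z t) (z t)} ->
  {ae leb, forall t, t \in `]0, T[ -> dotL Om (z t) (z t) = 0}.
Proof.
move=> K0 g0 g1 gp g2 g3 i1 ip i2 i3 W zE sign.
have [m0 A0T ae0 X0 _] := g0; have [m1 A1T ae1 X1 _] := g1; have [mp ApT aep Xp _] := gp.
have [m2 A2T ae2 X2 _] := g2; have [m3 A3T ae3 X3 _] := g3.
have mW : measurable W by do ![apply: measurableI => //].
have WT : W `<=` `]0, T[ by move=> t [[[/A0T]]].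
have aeW : {ae leb, forall t, t \in `]0, T[ -> W t}.
  apply: aeS (aeI (aeI (aeI ae0 ae1) aep) (aeI ae2 ae3)) => t [[[h0 h1] hp] [h2 h3]] tT.
  by split; [split; [split; [exact: h0|exact: h1]|exact: hp]|split; [exact: h2|exact: h3]].
have Wz t : W t -> Lp Om 2%:E (z t) /\ V (z t).
  by move=> [[[/X0 h0 /X1 h1] /Xp hp] _]; split => //; split.
pose phi t := \1_W t * dotL Om (z t) (z t).
have phiE t : W t -> phi t = dotL Om (z t) (z t) by move=> Wt; rewrite /phi indicE mem_set// mul1r.
have phi_ge0 t : 0 <= phi t by rewrite /phi mulr_ge0// dotL_ge0.
have phi0 t : t <= 0 -> phi t = 0.
  by move=> t0; rewrite /phi indicE memNset ?mul0r// => /WT /=; rewrite in_itv/= ltNge t0.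
(* Measurability comes from the L^2 norm along [z], integrability from the L^p bound
   [dotL_le_Lp_norm]. *)
have iphi : leb_integrable phi.
  apply: (@integrable_dominated _ _ _ leb setT _
    (fun t => fine (mu Om) * \1_`]0, T[ t + (\1_Ap t * np (z t)) `^ p)).
  - exact: measurableT.
  - have -> : phi = (fun t => \1_W t * (\1_A0 t * rnorm (Lp_norm Om 2%:E) (z t)) ^+ 2).
      apply/funext => t; rewrite /phi !indicE; have [/set_mem Wt|_] := boolP (t \in W); last by rewrite !mul0r.
      have [[[A0t _] _] _] := Wt.
      by rewrite mem_set// !mul1r Lp_norm2_sqr//; exact: X0.
    apply: measurable_funM; first by apply: measurable_indic; exact: mW.
    have L1 : (1 : R) <= 2 by rewrite ler1n.
    have m2' := measurable_rnorm (Lp_seminorm Om L1) g0.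
    exact: (measurable_funX _ m2').
  - apply: integrable_add => //; apply: integrable_scale => //.
    exact: (@integrable_indic_itv R 0 T false true).
  - move=> t _; rewrite ger0_norm//.
    have [Wt|nWt] := pselect (W t); last first.
      rewrite /phi indicE memNset// mul0r addr_ge0 ?powR_ge0// mulr_ge0// fine_ge0//.
    rewrite phiE// !indicE mem_set; last exact: WT.
    have [[_ Apt] _] := Wt.
    by rewrite mem_set// mulr1 mul1r; apply: dotL_le_Lp_norm; exact: Xp.
have small : step_approximable T W (fun r t => G r (z t) + dotL Om (H r) (z t)).
  apply: step_approximableD => e e0.
    have i2' : leb_integrable (fun t => (\1_A2 t * rnorm (Hm1_norm Om) (G t)) `^ conj_exp 2).
      by rewrite conj_exp2.
    have bl (a : R) (y y' : ('rV[R]_d -> R) -> R) x : Hm1 Om y -> Hm1 Om y' -> H10 Om x ->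
      (a *: y + y') x = a * y x + y' x by [].
    have [k [A [c [al [be [HA Hal Hbe le1 Hb]]]]]] := pairing_step_approx (H10_seminorm oOm bOm)
      (Hm1_seminorm oOm bOm) (b := fun y x => y x) bl Hm1_sub (fun y x => Hm1_bound oOm bOm (g := y) (v := x))
      (ltr1n R 2) e0 g1 g2 i1 i2'.
    exists 'I_k, A, c, al, be; split => // r t [_ [Ar _]] [[[_ At] _] _]; exact: Hb.
  have [k [A [c [al [be [HA Hal Hbe le1 Hb]]]]]] := pairing_step_approx (Lp_seminorm Om (ltW p1))
    (Lp_seminorm Om (conj_exp_ge1 p1)) (b := dotL Om) (@dotL_duall _ _ _ oOm _ p1)
    (@dotL_dualBr _ _ _ oOm _ p1) (fun y x Ly Lx => (dotL_hoelder mOm p1 Ly Lx).2)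
    p1 e0 gp g3 ip i3.
  by exists 'I_k, A, c, al, be; split => // r t [_ [_ Ar]] [[_ At] _]; exact: Hb.
suff : {ae leb, forall t, t \in `]0, T[ -> phi t = 0}.
  by move=> /(aeI aeW); apply: aeS => t [Wt Pt] tT; rewrite -phiE; [exact: Pt|exact: Wt].
apply: (energy_gronwall T0 K0 mW WT aeW iphi phi_ge0 phi0 _ small) => [t Wt|h h0|].
- apply: (integrable_dual_pairing oOm bOm p1 g2 g3 i2 i3 mW) (Wz t Wt).2.
  by move=> r [].
(* The identity at time [t - h] is tested with [z t], so both [t] and [t - h] have to avoid the
   exceptional set; its translate by [h] is null too. *)
- apply: aeS (aeI (aeI aeW zE) (ae_shift (- h) (aeI aeW zE))) => t [[Wt Et] [Ws Es]] tT.
  move/(_ tT) in Wt; move/(_ tT) in Et; have [L2t Vt] := Wz t Wt.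
  have E2 : phi t = dotL Om (z t) (z t) by exact: phiE.
  have E1 := Et _ Vt.
  (* For [t <= h] the values at [t - h] are 0 on both sides, and the claim reduces to
     [phi t <= 2 * phi t]. *)
  have [th|th] := leP (t - h) 0.
    rewrite (phi0 _ th) subr0 (primitive_eq0 _ th); last first.
      move=> r r0; rewrite indicE memNset ?mul0r// => /WT /=; rewrite in_itv/= ltNge r0//.
    rewrite subr0 -E1 -E2; have := phi_ge0 t; lra.
  have sT : t - h \in `]0, T[.
    by move: tT; rewrite !in_itv/= th => /andP[_]; apply: le_lt_trans; rewrite gerBl ltW.
  move/(_ sT) in Ws; move/(_ sT _ Vt) in Es; have [L2s Vs] := Wz _ Ws.
  rewrite -Es -E1 E2 (phiE _ Ws).
  have := dotL_ge0 Om (z t - z (t - h)).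
  have Ld : Lp Om 2%:E (z t - z (t - h)) by apply: (seminormB (Lp_seminorm Om _) L2t L2s); rewrite ler1n.
  have bil (x y y' : 'rV[R]_d -> R) : Lp Om 2%:E x -> Lp Om 2%:E y -> Lp Om 2%:E y' ->
      dotL Om (y - y') x = dotL Om y x - dotL Om y' x.
    by move=> Lx Ly Ly'; rewrite -scaleN1r addrC dotL_linear// mulN1r addrC.
  rewrite bil// (dotLC _ (z t)) (dotLC _ (z (t - h)) (_ - _)) !bil//.
  by rewrite (dotLC _ (z t) (z (t - h))); lra.
- apply: aeS (aeI aeW sign) => t [Wt St] tT; rewrite phiE; [exact: St|exact: Wt].
Qed.

End energy_uniqueness.

(** * The equation tested with the difference *)

Section nonlinear_terms.
Context {R : realType} {d : nat} {Om : set 'rV[R]_d}.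
Notation leb := (@lebesgue_measure R).
Notation mu := (lebesgue_rV R d).
Hypotheses (oOm : open Om) (bOm : bounded_set Om).
Variables (T p : R).
Hypotheses (p2 : 2 <= p).
Notation V := (H10_Lp Om p).
Notation pc := (conj_exp p).
Notation n1 := (rnorm (grad_norm Om)).
Notation np := (rnorm (Lp_norm Om p%:E)).

Let mOm : measurable Om. Proof. exact: open_measurable_rV. Qed.
Let Omfin : (mu Om < +oo)%E. Proof. exact: bounded_set_lty. Qed.
Let p1 : 1 < p. Proof. by apply: lt_le_trans p2; rewrite ltr1n. Qed.
Let p0 : 0 < p. Proof. exact: lt_trans p1. Qed.
Let pc1 : 1 <= pc. Proof. exact: conj_exp_ge1. Qed.
Let pc0 : 0 < pc. Proof. exact: lt_le_trans pc1. Qed.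

(** This rests on [(q - 1) * pc <= (p - 1) * pc = p] and on the finite measure of [Om]. *)
Lemma power_nl_Lp q v : 2 <= q -> q <= p -> Lp Om p%:E v -> Lp Om pc%:E (power_nl q v).
Proof.
move=> q2 qp /(LpP mOm v p0)[mv iv]; apply/(LpP mOm _ pc0).
have m1 : measurable_fun Om (fun x => `|v x| `^ (q - 2)).
  apply: (measurableT_comp (measurable_powR (q - 2))).
  exact: (measurableT_comp _ mv).
have mP : measurable_fun Om (power_nl q v) by exact: measurable_funM.
split => //; apply: (@integrable_dominated _ _ _ mu Om _ (fun x => 1 + `|v x| `^ p)) => //.
- apply: (measurableT_comp (measurable_powR pc)); exact: (measurableT_comp _ mP).
- exact: (integrableD mOm (integrable_cst_Om mOm Omfin 1) iv).
- move=> x _; rewrite ger0_norm ?powR_ge0//.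
  have -> : `|power_nl q v x| = `|v x| `^ (q - 1) by exact: norm_power.
  rewrite -powRrM; have q10 : 0 <= q - 1 by move: q2; lra.
  apply: powR_le1D => //; first by rewrite mulr_ge0// ltW.
  have pE : (p - 1) * pc = p by rewrite /conj_exp mulrC divfK// subr_eq0 gt_eqF.
  by rewrite -[leRHS]pE ler_wpM2r ?(ltW pc0)// lerB.
Qed.

Lemma nonlinear_diff_le b q eta : 2 <= q -> q < p -> 0 < eta ->
  exists2 C, 0 <= C & forall u w, Lp Om p%:E u -> Lp Om p%:E w ->
    b * dotL Om (power_nl q u - power_nl q w) (u - w) <=
    eta * dotL Om (power_nl p u - power_nl p w) (u - w) + C * dotL Om (u - w) (u - w).
Proof.
move=> q2 qp eta0; have [C C0 HC] := power_diff_le q2 qp eta0 (normr_ge0 b).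
exists C => // u w Lu Lw.
have Lz : Lp Om p%:E (u - w) by exact: (seminormB (Lp_seminorm Om (ltW p1))).
have int r : 2 <= r -> r <= p ->
    mu.-integrable Om (EFin \o (fun x => (power_nl r u - power_nl r w) x * (u - w) x)).
  move=> r2 rp; apply: (dotL_hoelder mOm p1 _ Lz).1.
  by apply: (seminormB (Lp_seminorm Om pc1)); exact: power_nl_Lp.
have i2 : mu.-integrable Om (EFin \o (fun x => (u - w) x * (u - w) x)).
  have L2 : Lp Om 2%:E (u - w) by apply: (Lp_inclusion mOm Omfin) Lz.
  exact: dotL2_integrable.
have iq := int _ q2 (ltW qp); have ip := int _ p2 (lexx p).
rewrite /dotL -!RintegralZl// -RintegralD//; first last.
- exact: (integrableZl mOm C i2).
- exact: (integrableZl mOm eta ip).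
apply: le_Rintegral => //.
- exact: (integrableZl mOm b iq).
- exact: (integrableD mOm (integrableZl mOm eta ip) (integrableZl mOm C i2)).
- move=> x _; have := HC (u x) (w x); rewrite expr2; apply: le_trans.
  by rewrite (le_trans (ler_norm _))// normrM.
Qed.

Lemma bounded_vanish (L : ('rV[R]_d -> R) -> R) C z (I : Type) (v : I -> 'rV[R]_d -> R) :
  (forall x y, V x -> V y -> L (x - y) = L x - L y) ->
  (forall x, V x -> `|L x| <= C * (n1 x + np x)) ->
  V z -> (forall i, V (v i)) ->
  (forall e, 0 < e -> exists i, n1 (z - v i) <= e /\ np (z - v i) <= e) ->
  (forall i, L (v i) = 0) -> L z = 0.
Proof.
move=> Ll Lb Vz Vv dense L0; apply/eqP; rewrite -normr_le0; apply/ler_addgt0Pr => e e0.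
have C1 : 0 < `|C| + 1 by rewrite ltr_wpDl.
have e1 : 0 < e / 2 / (`|C| + 1) by rewrite !divr_gt0.
have [i [h1 h2]] := dense _ e1.
have Vd : V (z - v i).
  have [Hz Lz] := Vz; have [Hv Lv] := Vv i; split; first exact: (seminormB (H10_seminorm oOm bOm)).
  exact: (seminormB (Lp_seminorm Om (ltW p1))).
have -> : L z = L (z - v i) by rewrite Ll// L0 subr0.
apply: (le_trans (Lb _ Vd)); rewrite add0r.
have n0 : 0 <= n1 (z - v i) + np (z - v i).
  by rewrite addr_ge0// ?(rnorm_ge0 (H10_seminorm oOm bOm)) ?(rnorm_ge0 (Lp_seminorm Om (ltW p1))) //; have [] := Vd.
apply: (@le_trans _ _ ((`|C| + 1) * (n1 (z - v i) + np (z - v i)))).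
  by rewrite ler_wpM2r// (le_trans (ler_norm _))// lerDl.
rewrite mulrC -ler_pdivlMr// [e]splitr mulrDl; exact: lerD.
Qed.

(** The residual of the equation at one time, with [D t] replaced by its representation by [g] and
    [h], whose two parts have bounds of their own. *)
Definition defect (M : nat) (nu alpha : R) (beta q : 'I_M -> R)
    (g f : ('rV[R]_d -> R) -> R) (h u v : 'rV[R]_d -> R) : R :=
  g v + dotL Om h v + nu * dot_grad Om u v + alpha * dotL Om (power_nl p u) v
  - \sum_(l < M) beta l * dotL Om (power_nl (q l) u) v - f v.

(** The defect is linear in the test function and bounded by a multiple of [n1 + np]: the
    functionals of H^-1 and the gradient term by [n1], the remaining terms by [np] through Hoelder's
    inequality. *)
Lemma defect_vanish (M : nat) (nu alpha : R) (beta q : 'I_M -> R)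
    (g f : ('rV[R]_d -> R) -> R) (h u z : 'rV[R]_d -> R) (I : Type) (v : I -> 'rV[R]_d -> R) :
  (forall l, 2 <= q l < p) ->
  Hm1 Om g -> Hm1 Om f -> Lp Om pc%:E h -> V u -> V z -> (forall i, V (v i)) ->
  (forall e, 0 < e -> exists i, n1 (z - v i) <= e /\ np (z - v i) <= e) ->
  (forall i, defect nu alpha beta q g f h u (v i) = 0) ->
  defect nu alpha beta q g f h u z = 0.
Proof.
move=> qp Hg Hf Lh [Hu Lu] Vz Vv dense def0.
have LP r : 2 <= r <= p -> Lp Om pc%:E (power_nl r u) by move=> /andP[r2 rp]; exact: power_nl_Lp.
have LPp : Lp Om pc%:E (power_nl p u) by apply: LP; rewrite p2 lexx.
have LPq l : Lp Om pc%:E (power_nl (q l) u) by apply: LP; have /andP[-> /ltW ->] := qp l.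
have [Hu1 _] := Hu.
pose N h := rnorm (Lp_norm Om pc%:E) h.
pose C := rnorm (Hm1_norm Om) g + N h + `|nu| * n1 u + `|alpha| * N (power_nl p u)
  + \sum_(l < M) `|beta l| * N (power_nl (q l) u) + rnorm (Hm1_norm Om) f.
apply: (bounded_vanish (C := C) _ _ Vz Vv dense def0) => [x y [Hx Lx] [Hy Ly]|x [Hx Lx]].
  have [Hx1 _] := Hx; have [Hy1 _] := Hy.
  have bil k : Lp Om pc%:E k -> dotL Om k (x - y) = dotL Om k x - dotL Om k y.
    by move=> Lk; apply: (dotL_dualBr oOm p1).
  have gr : dot_grad Om u (x - y) = dot_grad Om u x - dot_grad Om u y.
    rewrite dot_gradC -scaleN1r addrC dot_grad_linear// mulN1r addrC.
    by rewrite dot_gradC (dot_gradC Om y).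
  rewrite /defect (Hm1_sub Hg Hx Hy) (Hm1_sub Hf Hx Hy) gr !bil//.
  have -> : \sum_(l < M) beta l * dotL Om (power_nl (q l) u) (x - y) =
     \sum_(l < M) beta l * dotL Om (power_nl (q l) u) x - \sum_(l < M) beta l * dotL Om (power_nl (q l) u) y.
    by rewrite -sumrB; apply: eq_bigr => l _; rewrite bil// mulrBr.
  move: (\sum_(l < M) _) (\sum_(l < M) _) (dotL Om (power_nl p u) x) (dotL Om (power_nl p u) y).
  move: (dot_grad Om u x) (dot_grad Om u y) (dotL Om h x) (dotL Om h y) (g x) (g y) (f x) (f y).
  clear => *; ring.
have [Hx1 _] := Hx.
have n10 : 0 <= n1 x := rnorm_ge0 (H10_seminorm oOm bOm) Hx.
have np0 : 0 <= np x := rnorm_ge0 (Lp_seminorm Om (ltW p1)) Lx.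
have N0 k : Lp Om pc%:E k -> 0 <= N k by exact: (rnorm_ge0 (Lp_seminorm Om pc1)).
have bN k : Lp Om pc%:E k -> `|dotL Om k x| <= N k * (n1 x + np x).
  move=> Lk; apply: (le_trans (dotL_hoelder mOm p1 Lk Lx).2).
  by rewrite ler_wpM2l ?lerDr// N0.
have bg k : Hm1 Om k -> `|k x| <= rnorm (Hm1_norm Om) k * (n1 x + np x).
  move=> Hk; apply: (le_trans (Hm1_bound oOm bOm Hk Hx)).
  by apply: ler_wpM2l; [exact: (rnorm_ge0 (Hm1_seminorm oOm bOm))|rewrite lerDl].
have bd : `|dot_grad Om u x| <= n1 u * (n1 x + np x).
  apply: (le_trans (dot_grad_cauchy oOm bOm Hu1 Hx1)).
  by apply: ler_wpM2l; [exact: (rnorm_ge0 (H10_seminorm oOm bOm))|rewrite lerDl].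
rewrite /defect /C !mulrDl.
apply: (le_trans (ler_normB _ _)); apply: lerD; last exact: bg.
apply: (le_trans (ler_normB _ _)); apply: lerD; last first.
  rewrite mulr_suml (le_trans (ler_norm_sum _ _ _))//; apply: ler_sum => l _.
  by rewrite normrM -mulrA ler_wpM2l// bN.
apply: (le_trans (ler_normD _ _)); apply: lerD; last by rewrite normrM -mulrA ler_wpM2l// bN.
apply: (le_trans (ler_normD _ _)); apply: lerD; last by rewrite normrM -mulrA ler_wpM2l.
by apply: (le_trans (ler_normD _ _)); apply: lerD; [exact: bg|exact: bN].
Qed.

(** Subtracting the two equations tested with [u - w] removes [f] and leaves a gradient term with a
    sign. [K] is quantified before the functions because one constant has to serve almost every
    time. *)
Lemma defect_sub_le (M : nat) (nu alpha : R) (beta q : 'I_M -> R) :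
  (0 < M)%N -> 0 < nu -> 0 < alpha -> (forall l, 2 <= q l < p) ->
  exists2 K, 0 <= K & forall (g g' f : ('rV[R]_d -> R) -> R) (h h' u w : 'rV[R]_d -> R),
  Lp Om pc%:E h -> Lp Om pc%:E h' -> V u -> V w ->
  defect nu alpha beta q g f h u (u - w) = 0 ->
  defect nu alpha beta q g' f h' w (u - w) = 0 ->
  (g - g') (u - w) + dotL Om (h - h') (u - w) <= K * dotL Om (u - w) (u - w).
Proof.
move=> M0 nu0 al0 qp.
(* Each of the [M] lower-order terms may use up an equal share of the coefficient [alpha] of the
   monotone term. *)
have eta0 : 0 < alpha / M%:R by rewrite divr_gt0// ltr0n.
have ex l : exists C, 0 <= C /\ forall u w, Lp Om p%:E u -> Lp Om p%:E w ->
    beta l * dotL Om (power_nl (q l) u - power_nl (q l) w) (u - w) <=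
    alpha / M%:R * dotL Om (power_nl p u - power_nl p w) (u - w) + C * dotL Om (u - w) (u - w).
  have /andP[q2 qlp] := qp l.
  by have [C C0 HC] := nonlinear_diff_le (beta l) q2 qlp eta0; exists C.
have [C HC] := choice ex.
exists (\sum_(l < M) C l); first by apply: sumr_ge0 => l _; have [] := HC l.
move=> g g' f h h' u w Lh Lh' [Hu Lu] [Hw Lw].
have Hz : H10 Om (u - w) by exact: (seminormB (H10_seminorm oOm bOm)).
have Lz : Lp Om p%:E (u - w) by exact: (seminormB (Lp_seminorm Om (ltW p1))).
have [Hu1 _] := Hu; have [Hw1 _] := Hw; have [Hz1 _] := Hz.
have sub y y' : Lp Om pc%:E y -> Lp Om pc%:E y' ->
    dotL Om (y - y') (u - w) = dotL Om y (u - w) - dotL Om y' (u - w).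
  by move=> Ly Ly'; apply: (dotL_dualBl oOm p1).
have LP r y : 2 <= r <= p -> Lp Om p%:E y -> Lp Om pc%:E (power_nl r y).
  by move=> /andP[r2 rp]; exact: power_nl_Lp.
have pp : 2 <= p <= p by rewrite p2 lexx.
have qq l : 2 <= q l <= p by have /andP[-> /ltW ->] := qp l.
have sum_le : \sum_(l < M) beta l * dotL Om (power_nl (q l) u) (u - w)
   - \sum_(l < M) beta l * dotL Om (power_nl (q l) w) (u - w) <=
   alpha * (dotL Om (power_nl p u) (u - w) - dotL Om (power_nl p w) (u - w))
   + (\sum_(l < M) C l) * dotL Om (u - w) (u - w).
  rewrite -sub; [|exact: LP..].
  have -> : alpha * dotL Om (power_nl p u - power_nl p w) (u - w) =
      \sum_(l < M) alpha / M%:R * dotL Om (power_nl p u - power_nl p w) (u - w).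
    rewrite sumr_const card_ord -[RHS]mulr_natr mulrAC divfK// pnatr_eq0 -lt0n//.
  rewrite mulr_suml -sumrB -big_split/=; apply: ler_sum => l _.
  rewrite -mulrBr -sub; [|exact: LP..].
  by have [_] := HC l; apply.
have gr : 0 <= dot_grad Om u (u - w) - dot_grad Om w (u - w).
  have -> : dot_grad Om u (u - w) - dot_grad Om w (u - w) = dot_grad Om (u - w) (u - w).
    have -> : dot_grad Om (u - w) (u - w) = dot_grad Om ((-1) *: w + u) (u - w).
      by rewrite scaleN1r [X in dot_grad Om X _]addrC.
    by rewrite dot_grad_linear// mulN1r addrC.
  exact: dot_grad_ge0.
have := mulr_ge0 (ltW nu0) gr; rewrite mulrBr.
rewrite /defect sub// => ngr d1 d2.
have -> : (g - g') (u - w) = g (u - w) - g' (u - w) by [].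
move: sum_le ngr d1 d2; rewrite mulrBr.
move: (\sum_(l < M) beta l * dotL Om (power_nl (q l) u) (u - w)) (\sum_(l < M) _ * _) (_ * dotL Om (u - w) _).
move: (dotL Om (power_nl p u) (u - w)) (dotL Om (power_nl p w) (u - w)).
move: (dot_grad Om u (u - w)) (dot_grad Om w (u - w)) (dotL Om h (u - w)) (dotL Om h' (u - w)).
move: (g (u - w)) (g' (u - w)) (f (u - w)).
clear => *; lra.
Qed.

End nonlinear_terms.

(** * Two solutions with the same data *)

Section uniqueness.
Context {R : realType} {d : nat} {Om : set 'rV[R]_d}.
Notation leb := (@lebesgue_measure R).
Notation mu := (lebesgue_rV R d).
Hypotheses (oOm : open Om) (bOm : bounded_set Om).
Variables (T p : R).
Hypotheses (T0 : 0 < T) (p2 : 2 <= p).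
Notation V := (H10_Lp Om p).
Notation pc := (conj_exp p).

Let mOm : measurable Om. Proof. exact: open_measurable_rV. Qed.
Let p1 : 1 < p. Proof. by apply: lt_le_trans p2; rewrite ltr1n. Qed.
Let pc1 : 1 <= pc. Proof. exact: conj_exp_ge1. Qed.

Lemma dotL_eq0_ae v w : Lp Om 2%:E (v - w) -> dotL Om (v - w) (v - w) = 0 -> v = w %[ae mu in Om].
Proof.
move=> Lz z0; have iz := dotL2_integrable mOm Lz Lz.
have mz := measurable_int _ iz.
have : (\int[mu]_(x in Om) `|((v - w) x * (v - w) x)%:E| = 0)%E.
  have -> : (\int[mu]_(x in Om) `|((v - w) x * (v - w) x)%:E| = (dotL Om (v - w) (v - w))%:E)%E.
    rewrite /dotL /Rintegral fineK; last exact: integrable_fin_num.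
    by apply: eq_integral => x _; rewrite /= ger0_norm// -expr2 sqr_ge0.
  by rewrite z0.
move/(ae_eq_integral_abs mu mOm mz).1; apply: aeS => x h Ox; have := h Ox.
by move=> [] /eqP; rewrite mulf_eq0 orbb subr_eq0 => /eqP.
Qed.

Lemma difference_increment u u' u0 D D' g h Ag sg Ah sh g' h' Ag' sg' Ah' sh' (W : set R) :
  measurable W -> W `<=` (Ag `&` Ag') `&` (Ah `&` Ah') ->
  {ae leb, forall t, t \in `]0, T[ -> W t} ->
  {ae leb, forall t, t \in `]0, T[ -> Lp Om 2%:E (u t)} ->
  {ae leb, forall t, t \in `]0, T[ -> Lp Om 2%:E (u' t)} ->
  dual_rep (Om := Om) T p D g h Ag sg Ah sh -> dual_rep (Om := Om) T p D' g' h' Ag' sg' Ah' sh' ->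
  is_time_derivative Om T p u D -> is_time_derivative Om T p u' D' ->
  initial_condition Om T p u u0 -> initial_condition Om T p u' u0 ->
  {ae leb, forall t, t \in `]0, T[ -> forall v, V v -> dotL Om (u t - u' t) v =
    primitive (fun r => \1_W r * ((g r - g' r) v + dotL Om (h r - h' r) v)) t}.
Proof.
move=> mW WA aeW Lu Lu' rep rep' Du Du' iu iu'.
have inc := weak_increment oOm bOm T0 p1 rep Du iu.
have inc' := weak_increment oOm bOm T0 p1 rep' Du' iu'.
have [gg gh ig ih _] := rep; have [gg' gh' ig' ih' _] := rep'.
have [mAg AgT _ _ _] := gg; have [mAh _ _ Xh _] := gh.
have [mAg' AgT' _ _ _] := gg'; have [mAh' _ _ Xh' _] := gh'.
apply: aeS (aeI (aeI inc inc') (aeI Lu Lu')) => t [[It It'] [L2u L2u']] tT v Vv.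
have L2v : Lp Om 2%:E v by have [[[]]] := Vv.
have -> : dotL Om (u t - u' t) v = dotL Om (u t) v - dotL Om (u' t) v.
  by rewrite -scaleN1r addrC (dotL_linear oOm)//; [rewrite mulN1r addrC|exact: L2u'|exact: L2u].
(* The common initial value is inserted to apply [weak_increment] to each solution. *)
have -> : dotL Om (u t) v - dotL Om (u' t) v =
    (dotL Om (u t) v - dotL Om u0 v) - (dotL Om (u' t) v - dotL Om u0 v) by ring.
rewrite (It tT _ Vv) (It' tT _ Vv).
have i1 := integrable_dual_pairing oOm bOm p1 gg gh ig ih (measurableI _ _ mAg mAh) (@subset_refl _ _) Vv.
have i2 := integrable_dual_pairing oOm bOm p1 gg' gh' ig' ih' (measurableI _ _ mAg' mAh') (@subset_refl _ _) Vv.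
have sub f : leb_integrable f -> leb.-integrable `]-oo, t] (EFin \o f).
  exact: integrable_subset.
rewrite /primitive -RintegralB//; [|exact: sub..].
apply: ae_eq_Rintegral; apply: aeS aeW => r Wr _.
have [rT|rT] := boolP (r \in `]0, T[); last first.
  rewrite !indicE !memNset ?mul0r ?subr0//.
  - by move=> /WA[[/AgT /= rT' _] _]; move/negP: rT; apply.
  - by move=> [/AgT' /= rT' _]; move/negP: rT; apply.
  - by move=> [/AgT /= rT' _]; move/negP: rT; apply.
have {}Wr := Wr rT; have [[Agr Agr'] [Ahr Ahr']] := WA _ Wr.
rewrite !indicE !mem_set// !mul1r.
rewrite (dotL_dualBl oOm p1 (Xh _ Ahr) (Xh' _ Ahr') Vv.2).
have -> : (g r - g' r) v = g r v - g' r v by [].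
ring.
Qed.

(** The members of a countable family share one null set outside of which the equation holds for all
    of them; density then carries it over to [z t], a different test function at each time. *)
Lemma defect_ae (M : nat) (nu alpha : R) (beta q : 'I_M -> R) f Af sf u D g h Ag sg Ah sh
    (z : R -> 'rV[R]_d -> R) (I : countType) (v : I -> 'rV[R]_d -> R) :
  (forall l, 2 <= q l < p) ->
  good_set (Hm1 Om) (Hm1_norm Om) T f Af sf ->
  dual_rep (Om := Om) T p D g h Ag sg Ah sh ->
  {ae leb, forall t, t \in `]0, T[ -> V (u t)} ->
  {ae leb, forall t, t \in `]0, T[ -> V (z t)} ->
  (forall i, V (v i)) ->
  {ae leb, forall t, t \in `]0, T[ -> forall e, 0 < e -> exists i,
    rnorm (grad_norm Om) (z t - v i) <= e /\ rnorm (Lp_norm Om p%:E) (z t - v i) <= e} ->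
  (forall v, V v -> {ae leb, forall t, t \in `]0, T[ ->
     D t v + nu * dot_grad Om (u t) v + alpha * dotL Om (power_nl p (u t)) v
       - \sum_(l < M) beta l * dotL Om (power_nl (q l) (u t)) v = f t v}) ->
  {ae leb, forall t, t \in `]0, T[ ->
    defect (Om := Om) p nu alpha beta q (g t) (f t) (h t) (u t) (z t) = 0}.
Proof.
move=> qp gf [gg gh _ _ DE] Vu Vz Vv dense eqn.
have [_ _ aef Xf _] := gf; have [_ _ aeg Xg _] := gg; have [_ _ aeh Xh _] := gh.
have eqs := ae_countable (fun i => eqn _ (Vv i)).
apply: aeS (aeI (aeI (aeI aef aeg) (aeI aeh DE)) (aeI (aeI Vu Vz) (aeI dense eqs))) =>
  t [[[hf hg] [hh hD]] [[hu hz] [hd he]]] tT.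
apply: (defect_vanish oOm bOm p2 qp (Xg _ (hg tT)) (Xf _ (hf tT)) (Xh _ (hh tT)) (hu tT) (hz tT) Vv (hd tT)).
by move=> i; rewrite /defect -hD// he// subrr.
Qed.

End uniqueness.

Theorem theorem3p7 (R : realType) (d : nat) (Om : set 'rV[R]_d) (T : R)
    (M : nat) (nu alpha : R) (beta : 'I_M -> R) (p : R) (q : 'I_M -> R)
    (u0 : 'rV[R]_d -> R) (f : R -> ('rV[R]_d -> R) -> R) :
  (0 < d)%N ->
  domain Om -> bounded_set Om -> simply_connected Om -> convex_set Om ->
  lipschitz_boundary Om ->
  0 < T -> (0 < M)%N -> 0 < nu -> 0 < alpha ->
  2 <= p -> (forall l, 2 <= q l < p) ->
  Lp Om 2%:E u0 ->
  bochner T 2%:E (Hm1 Om) (Hm1_norm Om) f ->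
  forall u w : R -> 'rV[R]_d -> R,
    weak_solution Om T nu alpha beta p q f u0 u ->
    weak_solution Om T nu alpha beta p q f u0 w ->
    {ae @lebesgue_measure R, forall t, t \in `]0, T[ ->
      u t = w t %[ae lebesgue_rV R d in Om]}.
Proof.
move=> _ [oOm _ _] bOm _ _ _ T0 M0 nu0 al0 p2 qp _ bf u w.
move=> [u2 u1 up [D [tD Du eqD iu]]] [w2 w1 wp [D' [tD' Dw eqD' iw]]].
have p1 : 1 < p by apply: lt_le_trans p2; rewrite ltr1n.
have [Af [sf gf]] := bochner_good_set bf.
have [A0 [s0 g0]] := bochner_good_set u2; have [A0' [s0' g0']] := bochner_good_set w2.
have [A1 [s1 g1]] := bochner_good_set u1; have [A1' [s1' g1']] := bochner_good_set w1.
have [Ap [sp gp]] := bochner_good_set up; have [Ap' [sp' gp']] := bochner_good_set wp.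
have [g [h [Ag [sg [Ah [sh rep]]]]]] := time_dual_rep oOm bOm p1 tD.
have [g' [h' [Ag' [sg' [Ah' [sh' rep']]]]]] := time_dual_rep oOm bOm p1 tD'.
have [gg gh ig ih _] := rep; have [gg' gh' ig' ih' _] := rep'.
have L2n : seminorm_on (Lp Om 2%:E) (Lp_norm Om 2%:E) by apply: Lp_seminorm; rewrite ler1n.
have Lpn : seminorm_on (Lp Om p%:E) (Lp_norm Om p%:E) by apply: Lp_seminorm; exact: ltW.
have pc1 := conj_exp_ge1 p1.
have Lpcn := Lp_seminorm Om pc1.
have H10n := H10_seminorm oOm bOm; have Hm1n := Hm1_seminorm oOm bOm.
have p0 : 0 < p by exact: lt_trans p1.
have two1 : (1 : R) <= 2 by rewrite ler1n.
have two0 : (0 : R) < 2 by rewrite ltr0n.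
have z0 := good_set_sub L2n g0 g0'; have z1 := good_set_sub H10n g1 g1'.
have zp := good_set_sub Lpn gp gp'.
have gG := good_set_sub Hm1n gg gg'; have gH := good_set_sub Lpcn gh gh'.
have i1 := integrable_rnorm_powR_sub H10n two1 g1 g1'
  (integrable_rnorm_powR H10n g1 two0 u1) (integrable_rnorm_powR H10n g1' two0 w1).
have ip := integrable_rnorm_powR_sub Lpn (ltW p1) gp gp'
  (integrable_rnorm_powR Lpn gp p0 up) (integrable_rnorm_powR Lpn gp' p0 wp).
have iG := integrable_rnorm_powR_sub Hm1n two1 gg gg' ig ig'.
have iH := integrable_rnorm_powR_sub Lpcn pc1 gh gh' ih ih'.
have V0 : H10_Lp Om p 0 by exact: H10_Lp_0.
have aeV (y : R -> 'rV[R]_d -> R) B1 t1 Bp tp : good_set (H10 Om) (grad_norm Om) T y B1 t1 ->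
    good_set (Lp Om p%:E) (Lp_norm Om p%:E) T y Bp tp ->
    {ae @lebesgue_measure R, forall t, t \in `]0, T[ -> H10_Lp Om p (y t)}.
  move=> [_ _ ae1 X1 _] [_ _ aep Xp _]; apply: aeS (aeI ae1 aep) => t [h1 hp] tT.
  by split; [apply: X1; exact: h1|apply: Xp; exact: hp].
(* The family is drawn from the values of the difference and serves both equations, as each is
   tested with [u t - w t]. *)
have [I [v [Vv dense]]] := separable_values H10n Lpn z1 zp V0
  (fun t At Apt => conj (let: And5 _ _ _ X _ := z1 in X t At) (let: And5 _ _ _ X _ := zp in X t Apt)).
have Vu := aeV _ _ _ _ _ g1 gp; have Vw := aeV _ _ _ _ _ g1' gp'; have Vz := aeV _ _ _ _ _ z1 zp.
have dense' : {ae @lebesgue_measure R, forall t, t \in `]0, T[ -> forall e, 0 < e -> exists i,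
    rnorm (grad_norm Om) (u t - w t - v i) <= e /\ rnorm (Lp_norm Om p%:E) (u t - w t - v i) <= e}.
  have [_ _ ae1 _ _] := z1; have [_ _ aep _ _] := zp.
  apply: aeS (aeI ae1 aep) => t [h1 hp] tT e e0.
  by apply: dense => //; [exact: h1|exact: hp].
have du := defect_ae oOm bOm p2 qp gf rep Vu Vz Vv dense' eqD.
have dw := defect_ae oOm bOm p2 qp gf rep' Vw Vz Vv dense' eqD'.
have [K K0 HK] := defect_sub_le oOm bOm p2 beta M0 nu0 al0 qp.
have sign : {ae @lebesgue_measure R, forall t, t \in `]0, T[ ->
    (g t - g' t) (u t - w t) + dotL Om (h t - h' t) (u t - w t) <= K * dotL Om (u t - w t) (u t - w t)}.
  have [_ _ aeh Xh _] := gh; have [_ _ aeh' Xh' _] := gh'.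
  apply: aeS (aeI (aeI (aeI aeh aeh') (aeI Vu Vw)) (aeI du dw)) => t [[[hh hh'] [hu hw]] [hdu hdw]] tT.
  by apply: HK (hdu tT) (hdw tT); [apply: Xh; exact: hh|apply: Xh'; exact: hh'|exact: hu|exact: hw].
have [_ _ ae0 X0 _] := z0.
have ae2 (y : R -> 'rV[R]_d -> R) B t2 : good_set (Lp Om 2%:E) (Lp_norm Om 2%:E) T y B t2 ->
    {ae @lebesgue_measure R, forall t, t \in `]0, T[ -> Lp Om 2%:E (y t)}.
  by move=> [_ _ aeB XB _]; apply: aeS aeB => t hB tT; apply: XB; exact: hB.
have unique := energy_unique oOm bOm T0 p2 K0 z0 z1 zp gG gH i1 ip iG iH _ sign.
suff : {ae @lebesgue_measure R, forall t, t \in `]0, T[ -> dotL Om (u t - w t) (u t - w t) = 0}.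
  move=> /(aeI (ae2 _ _ _ z0)); apply: aeS => t [h1 h2] tT.
  by apply: (dotL_eq0_ae oOm); [exact: h1|exact: h2].
apply: unique; have [m0 _ _ _ _] := z0; have [m1 _ ae1 _ _] := z1; have [mp _ aep _ _] := zp.
have [mG _ aeG _ _] := gG; have [mH _ aeH _ _] := gH.
apply: (difference_increment oOm bOm T0 p2 _ _ _ (ae2 _ _ _ g0) (ae2 _ _ _ g0') rep rep' Du Dw iu iw).
- by do ![apply: measurableI => //].
- by move=> t [].
- apply: aeS (aeI (aeI (aeI ae0 ae1) aep) (aeI aeG aeH)) => t [[[k0 k1] kp] [k2 k3]] tT.
  by split; [split; [split; [exact: k0|exact: k1]|exact: kp]|split; [exact: k2|exact: k3]].
Qed.
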